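(* Let $X$ be a standard Gaussian in $H$ and let $Y$ be a generalized $H$-valued function defined on $(\mathcal T,\mu)$, where $\mu$ is a finite measure. There exists a subcritical GMC $M$ over $(X,Y)$ with expectation $\mathbb E M=\mu$ if and only if $Y$ is a randomized shift, i.e. the distribution of $X+Y(t)$ when $t$ is sampled independently of $X$ according to $\mu$ is absolutely continuous with respect to the distribution of $X$. If such a subcritical GMC $M$ does exist, then for every positive $(X,t)$-measurable function $f$, $$\mathbb E\int f(X,t)\,M(X,dt)=\mathbb E\int f(X+Y(t),t)\,\mu(dt).$$
   Context: $H$ is a separable infinite-dimensional real Hilbert space with a fixed orthonormal basis $(e_n)$. $(\Omega,\mathcal F,\mathbb P)$ is a standard probability space; $\mathcal T$ is a standard measurable space with measure $\mu$. $L^0(\mathcal T,\mu)$ is the space of $\mu$-equivalence classes of real measurable functions with the topology of convergence in measure. A generalized $H$-valued function on $(\mathcal T,\mu)$ is a continuous linear operator $Y:H\to L^0(\mathcal T,\mu)$; one writes $\langle Y,\xi\rangle\in L^0(\mu)$ for its value at $\xi\in H$ and $\langle Y(t),\xi\rangle$ for the value of that function at $t$. If defined on $(\Omega,\mathbb P)$ it is called a generalized random vector. Its ''value'' $Y(t)$ is identified with the sequence $(\langle Y(t),e_n\rangle)_n\in\mathbb R^{\infty}$ (defined a.e.), and measurability, laws and sums such as $X+Y(t)$ are understood in $\mathbb R^\infty$. A standard Gaussian $X$ in $H$ is a generalized random vector on $(\Omega,\mathbb P)$ such that each $\langle X,\xi\rangle$ is centered Gaussian with variance $\|\xi\|^2$.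 The pair $(X,Y)$ is called a (generalized) Gaussian field. A random measure on $(\mathcal T,\mu)$ is a random positive finite measure $M$ with $\mathbb E M\ll\mu$, where $(\mathbb E M)[A]:=\mathbb E(M[A])$. A GMC over $(X,Y)$ is a random measure $M$ on $(\mathcal T,\mu)$ that is measurable with respect to $X$ (so $M=M(X)$, and $M(X+\xi)$ is well-defined a.s. for $\xi\in H$ by the Cameron–Martin theorem) and such that for every $\xi\in H$, $M(X+\xi,dt)=e^{\langle Y(t),\xi\rangle}M(X,dt)$ a.s. It is subcritical if $\mathbb E M$ is $\sigma$-finite. A generalized $H$-valued function $Y$ on $(\mathcal T,\mu)$ is a randomized shift if $\mathrm{Law}_{\mathbb P\otimes\mu}[X+Y]\ll\mathrm{Law}_{\mathbb P}[X]$, where $\mathrm{Law}_{\mathbb P\otimes\mu}[X+Y]$ is the push-forward of $\mathbb P\otimes\mu$ under $(\omega,t)\mapsto X(\omega)+Y(t)\in\mathbb R^\infty$. *)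

(* Defs.v *)
From HB Require Import structures.
From mathcomp Require Import all_boot all_order all_algebra.
From mathcomp Require Import all_classical all_reals all_analysis.

Set Implicit Arguments.
Unset Strict Implicit.
Unset Printing Implicit Defensive.
Import Order.TTheory GRing.Theory Num.Theory.
Import numFieldNormedType.Exports.

Local Open Scope classical_set_scope.
Local Open Scope ring_scope.

(* A complete normed space with [hilbert_dot dot] is a real Hilbert space.  An
   orthonormal basis indexed by [nat] forces it to be separable and
   infinite-dimensional, and every such space has one. *)
Definition hilbert_dot (R : realType) (H : completeNormedModType R)
    (dot : {dot H for (idfun : R -> R)}) : Prop :=
  forall x : H, `|x| ^+ 2 = dot x x.

Definition orthonormal_basis (R : realType) (H : completeNormedModType R)
    (dot : {dot H for (idfun : R -> R)}) (e : nat -> H) : Prop :=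
  (forall i j, dot (e i) (e j) = (i == j)%:R) /\
  (forall x : H, series (fun n => dot x (e n) *: e n) @ \oo --> x).

(* The sigma-algebra of T is, up to a bijection, the Borel sigma-algebra of a
   complete separable metric space (a Hausdorff pseudometric space is a metric
   one). *)
Definition standard_measurable (R : realType) (d : measure_display)
    (T : measurableType d) : Prop :=
  exists (Z : completePseudoMetricType R) (h : T -> Z),
    [/\ hausdorff_space Z,
        exists D : set Z, countable D /\ dense D,
        bijective h &
        forall A : set T, measurable A <->
          exists2 B : set Z, <<s [set U : set Z | open U] >> B &
            A = h @^-1` B].

(* Isomorphism modulo null sets with a standard measurable space S carrying a
   (possibly completed) probability: off a null set N, h is injective and maps
   measurable sets to sets measurable for the completion of the law of h. *)
Definition standard_probability (R : realType) (d : measure_display)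
    (Omega : measurableType d) (P : probability Omega R) : Prop :=
  exists (d' : measure_display) (S : measurableType d') (h : Omega -> S)
      (N : set Omega),
    [/\ standard_measurable R S,
        measurable_fun setT h,
        measurable N /\ P N = 0%E,
        set_inj (~` N) h &
        forall A : set Omega, measurable A -> exists2 B : set S, measurable B &
          (pushforward P h).-negligible ((h @` (A `\` N)) `+` B)].

(* The sequence space R^oo with its product sigma-algebra. *)
Definition cylinders (R : realType) : set (set (nat -> R)) :=
  [set A | exists n : nat, exists2 B : set R, measurable B &
     A = [set x | B (x n)]].

Notation Rinf R := (g_sigma_algebraType (@cylinders R)).

(* L^0(T, mu) is the library's quotient {mfun_ mu, T >-> R}; its elements coerce
   to chosen representatives, and the conditions below do not depend on that
   choice.  Continuity is for the topology of convergence in measure, with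
   neighbourhoods {g | mu {t | eps <= |g t - f t|} < delta} of f; this is used
   for finite mu only. *)
Definition generalized_function (R : realType) (H : completeNormedModType R)
    (d : measure_display) (T : measurableType d)
    (mu : {measure set T -> \bar R}) (Y : H -> {mfun_ mu, T >-> R}) : Prop :=
  (forall (a : R) (x y : H),
     {ae mu, forall t, Y (a *: x + y) t = a * Y x t + Y y t}) /\
  (forall (x : H) (eps delta : R), 0 < eps -> 0 < delta ->
     \forall y \near x,
       (mu [set t | (eps <= `|Y y t - Y x t|)%R] < delta%:E)%E).

(* The library's [normal_prob m s] is N(m, s^2) only for s != 0. *)
Definition centered_gaussian (R : realType) (s : R) (A : set R) : \bar R :=
  if s == 0 then \d_(0 : R) A else normal_prob 0 s A.

Definition standard_gaussian (R : realType) (H : completeNormedModType R)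
    (d : measure_display) (Omega : measurableType d) (P : probability Omega R)
    (X : H -> {mfun_ P, Omega >-> R}) : Prop :=
  generalized_function X /\
  (forall (x : H) (A : set R), measurable A ->
     pushforward P (X x) A = centered_gaussian `|x| A).

(* The value at t of a generalized function, as the sequence <Y(t), e_n>. *)
Definition coords (R : realType) (H : completeNormedModType R) (e : nat -> H)
    (d : measure_display) (T : measurableType d)
    (mu : {measure set T -> \bar R}) (Y : H -> {mfun_ mu, T >-> R})
    (t : T) : Rinf R :=
  fun n => Y (e n) t.

Definition add_seq (R : realType) (x y : Rinf R) : Rinf R :=
  fun n => x n + y n.

Definition mean_measure (R : realType) (d d' : measure_display)
    (Omega : measurableType d) (T : measurableType d')
    (P : probability Omega R) (M : R.-ker Omega ~> T) (A : set T) : \bar R :=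
  (\int[P]_w M w A)%E.

Definition random_measure (R : realType) (d d' : measure_display)
    (Omega : measurableType d) (T : measurableType d')
    (P : probability Omega R) (mu : {measure set T -> \bar R})
    (M : R.-ker Omega ~> T) : Prop :=
  (forall w, (M w setT < +oo)%E) /\ mean_measure P M `<< mu.

(* The kernel m expresses that M is a function of X, M = m(X) a.s., and
   M(X + xi) is m(X + xi).  The condition does not depend on the choice of m
   since, by the Cameron-Martin theorem, X and X + xi have equivalent laws. *)
Definition gmc (R : realType) (H : completeNormedModType R)
    (dot : {dot H for (idfun : R -> R)}) (e : nat -> H)
    (d d' : measure_display) (Omega : measurableType d) (T : measurableType d')
    (P : probability Omega R) (mu : {measure set T -> \bar R})
    (X : H -> {mfun_ P, Omega >-> R}) (Y : H -> {mfun_ mu, T >-> R})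
    (M : R.-ker Omega ~> T) : Prop :=
  random_measure P mu M /\
  exists m : R.-ker (Rinf R) ~> T,
    {ae P, forall w, forall A : set T, measurable A ->
       M w A = m (coords e X w) A} /\
    (forall xi : H, {ae P, forall w, forall A : set T, measurable A ->
       m (add_seq (coords e X w) (fun n => dot xi (e n))) A =
       (\int[M w]_(t in A) (expR (Y xi t))%:E)%E}).

Definition subcritical_gmc (R : realType) (H : completeNormedModType R)
    (dot : {dot H for (idfun : R -> R)}) (e : nat -> H)
    (d d' : measure_display) (Omega : measurableType d) (T : measurableType d')
    (P : probability Omega R) (mu : {measure set T -> \bar R})
    (X : H -> {mfun_ P, Omega >-> R}) (Y : H -> {mfun_ mu, T >-> R})
    (M : R.-ker Omega ~> T) : Prop :=
  gmc dot e X Y M /\ sigma_finite setT (mean_measure P M).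

Definition randomized_shift (R : realType) (H : completeNormedModType R)
    (e : nat -> H) (d d' : measure_display) (Omega : measurableType d)
    (T : measurableType d') (P : probability Omega R)
    (mu : {measure set T -> \bar R})
    (X : H -> {mfun_ P, Omega >-> R}) (Y : H -> {mfun_ mu, T >-> R}) : Prop :=
  pushforward (P \x mu)%E
    (fun z : Omega * T => add_seq (coords e X z.1) (coords e Y z.2))
  `<< pushforward P (coords e X).

(* Main.v *)
Require Import Defs.
From HB Require Import structures.
From mathcomp Require Import all_boot all_order all_algebra.
From mathcomp Require Import all_classical all_reals all_analysis.
From mathcomp Require Import measurable_realfun.
From mathcomp Require Import ring lra.
Import Order.TTheory GRing.Theory Num.Theory.
Import numFieldNormedType.Exports.

Local Open Scope classical_set_scope.
Local Open Scope ring_scope.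
Set Implicit Arguments.
Unset Strict Implicit.

(** Let gamma be the law, on the sequence space, of the coordinates of [X].
A random measure M = m(X) is encoded by the finite measure
nu(dx, dt) = gamma(dx) m(x, dt): the joint law of the environment and of a
point sampled from M.  Both directions compare nu with the law of
(X + Y(t), t) under P (x) mu.

From a GMC to the formula.  The relation defining a GMC, taken in the direction
c e_n, and the Cameron-Martin formula for the n-th coordinate tell how nu
behaves under x |-> x + c e_n.  After the change of variables
(x, t) |-> (x - Y(t), t) the factors exp(c Y_n(t)) cancel: the image nu' of nu
is multiplied by exp(c x_n - c^2/2) under this shift, just as gamma (x) mu is
([quasi_invariant]).  Such a measure does not change when its n-th coordinate is
replaced by an independent standard normal variable
([quasi_invariant_resample]), so the integral of a function of t and of finitely
many coordinates depends only on the marginal of the measure on T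
([quasi_invariant_unique]).  The marginal of nu' is the mean of M, that is mu;
hence nu' = gamma (x) mu, and nu is the law of (X + Y(t), t).  This is the formula
([gmc_formula]).  For f(x, t) = 1_A(x) it gives the absolute continuity
([randomized_shift_of_formula]).

From a randomized shift to a GMC.  The law of (X + Y(t), t) has a first marginal
absolutely continuous with respect to gamma, so it can be written
gamma(dx) m(x, dt) ([disintegration]); put M = m(X).  Its mean is mu.  For xi in H
with coordinates b, the density of the law of X + xi with respect to gamma is
W(x) = exp(<x, xi> - |xi|^2 / 2) ([cameron_martin]), and
W(X + Y(t)) = W(X) exp(<Y(t), xi>) ([cm_density_shift]).  Shifting x by b in
gamma(dx) m(x, dt), using the disintegration and shifting back leaves the factor
exp(<Y(t), xi>) ([shift_kernel_identity]), which is the GMC relation in mean; a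
countable family of sets generating the sigma-algebra of T turns it into an
almost sure equality of measures ([shift_kernel]).

Two results are of independent interest.  That gamma is quasi-invariant under
each coordinate shift is deduced from the laws of the linear functionals of [X]
alone, by a Cramer-Wold theorem proved with trigonometric polynomials
([cramer_wold]).  The disintegration over a standard space T is made by coding T
into [0, 1] by a measurable map with an almost sure inverse
([standard_coding]), then by pushing Lebesgue measure through conditional
quantile functions ([disintegration_coded]). *)

(** * Integrals of nonnegative functions *)

Section ge0_mfun_ind.
Context d (T : measurableType d) (R : realType).
Local Open Scope ereal_scope.
Import HBNNSimple.

(** The standard machine, through the simple functions increasing to [f]. *)
Lemma ge0_mfun_ind (Q : (T -> \bar R) -> Prop) :
  (forall A, measurable A -> Q (fun x => (\1_A x)%:E)) ->
  (forall f g, measurable_fun setT f -> (forall x, 0 <= f x) -> Q f ->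
     measurable_fun setT g -> (forall x, 0 <= g x) -> Q g ->
     Q (fun x => f x + g x)) ->
  (forall (k : R) f, (0 <= k)%R -> measurable_fun setT f ->
     (forall x, 0 <= f x) -> Q f -> Q (fun x => k%:E * f x)) ->
  (forall f_ : (T -> \bar R)^nat, (forall n, measurable_fun setT (f_ n)) ->
     (forall n x, 0 <= f_ n x) -> (forall n, Q (f_ n)) ->
     (forall x, {homo f_ ^~ x : m n / (m <= n)%N >-> m <= n}) ->
     Q (fun x => limn (f_ ^~ x))) ->
  forall f, measurable_fun setT f -> (forall x, 0 <= f x) -> Q f.
Proof.
move=> Qind QD QZ Qlim f mf f0.
pose f_ := nnsfun_approx measurableT mf.
have -> : f = fun x => limn (fun n => (f_ n x)%:E).
  apply/funext => x; apply/esym/cvg_lim => //.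
  exact: cvg_nnsfun_approx.
apply: Qlim => [n|n x|n|x m n mn]; last 1 first.
- by rewrite lee_fin; exact/lefP/nd_nnsfun_approx.
- exact/measurable_EFinP.
- by rewrite lee_fin.
have -> : (fun x => (f_ n x)%:E) =
  fun x => \sum_(r <- finmap.enum_fset (fset_set (range (f_ n))))
    (r%:E * (\1_(f_ n @^-1` [set r]) x)%:E).
  apply/funext => x; rewrite fimfunE fsbig_finite//= -sumEFin.
  by apply: eq_bigr => r _; rewrite EFinM.
set s := finmap.enum_fset _.
have s0 : forall r, r \in s -> (0 <= r)%R.
  by move=> r; rewrite /s in_fset_set// inE => -[x _ <-].
pose F s := fun x => \sum_(r <- s) (r%:E * (\1_(f_ n @^-1` [set r]) x)%:E).
suff [] : [/\ measurable_fun setT (F s), forall x, 0 <= F s x & Q (F s)] by [].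
have mi r : measurable_fun setT (fun x => (\1_(f_ n @^-1` [set r]) x)%:E : \bar R).
  exact/measurable_EFinP/measurable_indic.
have i0 r x : 0 <= (\1_(f_ n @^-1` [set r]) x)%:E :> \bar R by rewrite lee_fin.
elim: s s0 => [_|r s IH s0].
  have -> : F [::] = fun x => (\1_set0 x)%:E.
    by apply/funext => x; rewrite /F big_nil indic0.
  by split; [exact/measurable_EFinP/measurable_indic|move=> x; rewrite lee_fin|exact: Qind].
have [|m1 p1 q1] := IH; first by move=> r' r's; apply: s0; rewrite inE r's orbT.
have r0 : (0 <= r)%R by apply: s0; rewrite inE eqxx.
have E1 : F (r :: s) = fun x => r%:E * (\1_(f_ n @^-1` [set r]) x)%:E + F s x.
  by apply/funext => x; rewrite /F big_cons.
rewrite E1; split.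
- by apply: emeasurable_funD => //; exact: measurable_funeM.
- by move=> x; rewrite adde_ge0// mule_ge0// lee_fin.
- apply: QD => //.
  + exact: measurable_funeM.
  + by move=> x; rewrite mule_ge0// lee_fin.
  + by apply: QZ => //; exact: Qind.
Qed.

End ge0_mfun_ind.

Lemma ge0_integral_density d (T : measurableType d) (R : realType)
    (m nu : {measure set T -> \bar R}) (g : T -> R) :
  measurable_fun setT g -> (forall x, 0 <= g x) ->
  (forall A, measurable A -> nu A = \int[m]_(x in A) (g x)%:E)%E ->
  forall f, measurable_fun setT f -> (forall x, 0 <= f x)%E ->
  (\int[nu]_x f x = \int[m]_x (f x * (g x)%:E))%E.
Proof.
move=> /measurable_EFinP mg g0 nuE; apply: ge0_mfun_ind.
- move=> A mA; rewrite integral_indic// setIT nuE// integral_mkcond.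
  apply: eq_integral => x _; rewrite patchE indicE.
  by case: ifP => _; rewrite ?mul1e ?mul0e.
- move=> f h mf f0 IHf mh h0 IHh; rewrite ge0_integralD// IHf IHh -ge0_integralD//.
  + by apply: eq_integral => x _; rewrite ge0_muleDl.
  + by move=> x _; rewrite mule_ge0// lee_fin.
  + exact: emeasurable_funM.
  + by move=> x _; rewrite mule_ge0// lee_fin.
  + exact: emeasurable_funM.
- move=> k f k0 mf f0 IH; rewrite ge0_integralZl_EFin// IH.
  rewrite -ge0_integralZl_EFin//.
  + by apply: eq_integral => x _; rewrite muleA.
  + by move=> x _; rewrite mule_ge0// lee_fin.
  + exact: emeasurable_funM.
- move=> f_ mf f0 IH nd.
  rewrite monotone_convergence//.
  under eq_fun do rewrite IH.
  rewrite -monotone_convergence//.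
  + apply: eq_integral => x _.
    apply/cvg_lim => //; apply: cvgeZr => //.
    exact: ereal_nondecreasing_is_cvgn.
  + by move=> n; exact: emeasurable_funM.
  + by move=> n x _; rewrite mule_ge0// lee_fin.
  + by move=> x _ m' n mn; rewrite lee_wpmul2r// ?lee_fin//; exact: nd.
Qed.

Section image_measure.
Context d d' (S : measurableType d) (T : measurableType d') (R : realType).

Definition image_measure (f : S -> T) (mf : measurable_fun setT f)
  (m : {measure set S -> \bar R}) : set T -> \bar R := pushforward m f.

Variables (f : S -> T) (mf : measurable_fun setT f) (m : {measure set S -> \bar R}).

HB.instance Definition _ := Measure.copy (image_measure mf m)
  (measure_function_pushforward__canonical__measure_function_Measure m mf).

Lemma ge0_integral_image (g : T -> \bar R) :
  measurable_fun setT g -> (forall x, 0 <= g x)%E ->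
  (\int[image_measure mf m]_y g y = \int[m]_x g (f x))%E.
Proof. by move=> mg g0; rewrite ge0_integral_pushforward. Qed.

End image_measure.

Section as_finite.
Context d (T : measurableType d) (R : realType).

(** The same set function with the finiteness recorded in its type. *)
Definition as_finite (m : {measure set T -> \bar R}) (mT : (m setT < +oo)%E) :
  set T -> \bar R := m.

Variables (m : {measure set T -> \bar R}) (mT : (m setT < +oo)%E).

HB.instance Definition _ := Measure.on (as_finite mT).

Let fin : fin_num_fun (as_finite mT).
Proof.
move=> A mA; rewrite ge0_fin_numE// (le_lt_trans _ mT)//.
by apply: le_measure; rewrite ?inE.
Qed.

HB.instance Definition _ := Measure_isFinite.Build _ _ _ (as_finite mT) fin.

End as_finite.

(** * Gaussian shifts and resampling *)

Section std_gauss.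
Variable R : realType.

(** The standard normal law on the canonical measurable structure of [R];
[normal_prob] lives on the copy [measurableTypeR R]. *)
Definition std_gauss (A : set R) : \bar R := normal_prob 0 1 A.

Let sg0 : std_gauss set0 = 0%E. Proof. exact: measure0. Qed.
Let sg_ge0 A : (0 <= std_gauss A)%E. Proof. exact: measure_ge0. Qed.
Let sg_sigma_additive : semi_sigma_additive std_gauss.
Proof. exact: (@measure_semi_sigma_additive _ _ _ (@normal_prob R 0 1)). Qed.
HB.instance Definition _ := isMeasure.Build _ _ _ std_gauss
  sg0 sg_ge0 sg_sigma_additive.

Let sgT : std_gauss setT = 1%E.
Proof. exact: (probability_setT (@normal_prob R 0 1)). Qed.
HB.instance Definition _ := Measure_isProbability.Build _ _ _ std_gauss sgT.

End std_gauss.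

Section standard_normal.
Context (R : realType).
Local Open Scope ereal_scope.
Notation leb := (@lebesgue_measure R).
Notation N01 := (@std_gauss R).

Lemma ge0_integral_lebesgue_shift (c : R) (f : R -> \bar R) :
  measurable_fun setT f -> (forall x, 0 <= f x) ->
  \int[leb]_x f (x + c)%R = \int[leb]_x f x.
Proof.
move=> mf f0.
have mc : measurable_fun setT ((fun x : R => x + c)%R : measurableTypeR R -> measurableTypeR R).
  exact: measurable_funD.
transitivity (\int[pushforward leb ((fun x : R => x + c)%R : measurableTypeR R -> measurableTypeR R)]_x f x).
  by rewrite ge0_integral_pushforward.
apply: eq_measure_integral => //= A mA _.
apply/esym/lebesgue_measure_unique => //= _ [[a b]] _ <-.
rewrite /pushforward (_ : _ @^-1` _ = `](a - c)%R, (b - c)%R]%classic); last first.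
  by apply/seteqP; split => x /=; rewrite !in_itv/= ltrBlDr lerBrDr.
rewrite !lebesgue_measure_itv/= !lte_fin ltrD2r.
by case: ifP => // _; congr EFin; rewrite opprB addrA subrK.
Qed.

Definition gauss_pdf : R -> R := normal_pdf 0 1.

Lemma measurable_gauss_pdf : measurable_fun setT gauss_pdf.
Proof. exact: measurable_normal_pdf. Qed.

Lemma gauss_pdf_ge0 x : (0 <= gauss_pdf x)%R.
Proof. exact: normal_pdf_ge0. Qed.

Lemma gauss_pdf_shift x c :
  gauss_pdf (x - c) = (gauss_pdf x * expR (c * x - c ^+ 2 / 2))%R.
Proof.
rewrite /gauss_pdf !normal_pdfE ?oner_eq0// /normal_fun -mulrA -expRD.
by congr (_ * expR _)%R; field.
Qed.

Lemma integral_gauss_pdf : \int[leb]_x (gauss_pdf x)%:E = 1.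
Proof. exact: integral_normal_pdf. Qed.

Lemma ge0_integral_gauss (f : R -> \bar R) :
  measurable_fun setT f -> (forall x, 0 <= f x) ->
  \int[N01]_x f x = \int[leb]_x (f x * (gauss_pdf x)%:E).
Proof.
move=> mf f0.
transitivity (\int[@normal_prob R 0 1]_x f x).
  have mid : measurable_fun setT (idfun : measurableTypeR R -> R).
    by move=> _ A mA; rewrite setTI.
  by have := @ge0_integral_pushforward _ _ _ _ R _ mid (@normal_prob R 0 1) setT f
    measurableT mf (fun x _ => f0 x); apply.
apply: ge0_integral_density => //.
- exact: measurable_gauss_pdf.
- exact: gauss_pdf_ge0.
Qed.

Lemma gauss_shift (c : R) (f : R -> \bar R) :
  measurable_fun setT f -> (forall x, 0 <= f x) ->
  \int[N01]_x f (x + c)%R =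
  \int[N01]_x (f x * (expR (c * x - c ^+ 2 / 2))%:E).
Proof.
move=> mf f0.
have mp := measurable_gauss_pdf.
rewrite !ge0_integral_gauss//.
- rewrite -[RHS](ge0_integral_lebesgue_shift c).
  + apply: eq_integral => x _; rewrite -[in gauss_pdf x](addrK c x) gauss_pdf_shift.
    by rewrite EFinM -muleA [X in _ * X]muleC.
  + apply: emeasurable_funM; last exact/measurable_EFinP.
    apply: emeasurable_funM => //; apply/measurable_EFinP/measurableT_comp => //.
    by apply: measurable_funB => //; exact: measurable_funM.
  + by move=> x; rewrite !mule_ge0// lee_fin ?expR_ge0 ?gauss_pdf_ge0.
- apply: emeasurable_funM => //; apply/measurable_EFinP/measurableT_comp => //.
  by apply: measurable_funB => //; exact: measurable_funM.
- by move=> x; rewrite !mule_ge0// lee_fin expR_ge0.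
- by apply: measurableT_comp => //; exact: measurable_funD.
Qed.

End standard_normal.

(** A flow [tau] moves the height [p] at unit speed.  The model is the real line
with its translations, where quasi-invariance singles out the standard normal law. *)
Section shift_flow.
Context (R : realType) d (E : measurableType d).
Local Open Scope ereal_scope.
Notation N01 := (@std_gauss R).
Notation leb := (@lebesgue_measure R).
Variables (p : E -> R) (tau : R -> E -> E).
Hypothesis mp : measurable_fun setT p.
Hypothesis mtau : measurable_fun setT (fun z : R * E => tau z.1 z.2).
Hypothesis p_tau : forall c z, p (tau c z) = (p z + c)%R.

Definition quasi_invariant (rho : {measure set E -> \bar R}) :=
  forall (c : R) (f : E -> \bar R), measurable_fun setT f ->
    (forall z, 0 <= f z) ->
    \int[rho]_z f (tau c z) =
    \int[rho]_z (f z * (expR (c * p z - c ^+ 2 / 2))%:E).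

(** The point at height [y] on the orbit of [z]. *)
Definition resample (z : E) (y : R) : E := tau (y - p z) z.

Definition resample_invariant (rho : {measure set E -> \bar R}) :=
  forall f : E -> \bar R, measurable_fun setT f -> (forall z, 0 <= f z) ->
    \int[rho]_z f z = \int[rho]_z \int[N01]_y f (resample z y).

Lemma measurable_resample : measurable_fun setT (fun z : E * R => resample z.1 z.2).
Proof.
apply: (measurableT_comp mtau (g := fun z : E * R => ((z.2 - p z.1)%R, z.1))).
apply: measurable_fun_pair; last exact: measurable_fst.
apply: measurable_funB; first exact: measurable_snd.
by apply: measurableT_comp => //; exact: measurable_fst.
Qed.

(** With phi the standard normal density, the inner integral is that of
f(tau_c z) phi(p(tau_c z)) over the time c.  Exchanging the integrals and using
quasi-invariance for each c replaces the integrand by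
f(z) phi(p z) exp(c p(z) - c^2/2) = f(z) phi(c - p z), and phi has integral 1 over c. *)
Lemma quasi_invariant_resample (rho : {sigma_finite_measure set E -> \bar R}) :
  quasi_invariant rho -> resample_invariant rho.
Proof.
move=> qi f mf f0; apply/esym.
have mg := @measurable_gauss_pdf R.
have mtau2 : measurable_fun setT (fun z : E * R => tau z.2 z.1).
  by apply: (measurableT_comp mtau (g := fun z : E * R => (z.2, z.1)));
     apply: measurable_fun_pair; [exact: measurable_snd|exact: measurable_fst].
have mt c : measurable_fun setT (tau c).
  exact: (measurableT_comp mtau (pair1_measurable c)).
transitivity (\int[rho]_z \int[leb]_c
    (f (tau c z) * (gauss_pdf (p (tau c z)))%:E)).
  apply: eq_integral => z _.
  have mfz := measurableT_comp mf (measurableT_comp measurable_resample (pair1_measurable z)).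
  transitivity (\int[leb]_y (f (resample z y) * (gauss_pdf y)%:E)).
    exact: (ge0_integral_gauss mfz (fun=> f0 _)).
  rewrite -(ge0_integral_lebesgue_shift (p z)).
  - by apply: eq_integral => y _; rewrite /resample addrK p_tau addrC.
  - apply: emeasurable_funM; last exact/measurable_EFinP.
    by apply: measurableT_comp => //; exact: (measurableT_comp measurable_resample (pair1_measurable z)).
  - by move=> y; rewrite mule_ge0// lee_fin gauss_pdf_ge0.
rewrite (@fubini_tonelli _ _ _ _ _ rho leb
   (fun z => f (tau z.2 z.1) * (gauss_pdf (p (tau z.2 z.1)))%:E)); last 2 first.
- apply: emeasurable_funM; first exact: measurableT_comp.
  by apply/measurable_EFinP; do 2 apply: measurableT_comp => //.
- by move=> z; rewrite mule_ge0// lee_fin gauss_pdf_ge0.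
transitivity (\int[leb]_c \int[rho]_z
   (f z * (gauss_pdf (c - p z))%:E)).
  apply: eq_integral => c _ /=.
  rewrite (qi c (fun z => f z * (gauss_pdf (p z))%:E)).
  - apply: eq_integral => z _; rewrite -muleA -EFinM; congr (_ * _%:E).
    rewrite -[(c - p z)%R]opprB /gauss_pdf.
    have ge u : normal_pdf 0 1 (- u)%R = normal_pdf 0 1 u :> R.
      by rewrite !normal_pdfE ?oner_eq0// /normal_fun !subr0 sqrrN.
    by rewrite ge; have := gauss_pdf_shift (p z) c; rewrite /gauss_pdf => ->.
  - by apply: emeasurable_funM => //; apply/measurable_EFinP; exact: measurableT_comp.
  - by move=> z; rewrite mule_ge0// lee_fin gauss_pdf_ge0.
rewrite -(@fubini_tonelli _ _ _ _ _ rho leb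
   (fun z => f z.1 * (gauss_pdf (z.2 - p z.1))%:E))/=; last 2 first.
- apply: emeasurable_funM.
    by apply: measurableT_comp => //; exact: measurable_fst.
  apply/measurable_EFinP; apply: measurableT_comp => //.
  apply: measurable_funB; first exact: measurable_snd.
  by apply: measurableT_comp => //; exact: measurable_fst.
- by move=> z; rewrite mule_ge0// lee_fin gauss_pdf_ge0.
apply: eq_integral => z _.
have mpz : measurable_fun setT (fun c : R => (gauss_pdf (c - p z))%:E).
  by apply/measurable_EFinP/measurableT_comp => //; exact: measurable_funB.
rewrite ge0_integralZl//; last by move=> c _; rewrite lee_fin gauss_pdf_ge0.
have := @ge0_integral_lebesgue_shift R (- p z)%R (fun c => (gauss_pdf c)%:E).
move=> ->; first by rewrite integral_gauss_pdf mule1.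
- exact/measurable_EFinP.
- by move=> c; rewrite lee_fin gauss_pdf_ge0.
Qed.

Hypothesis tau_tau : forall b c z, tau b (tau c z) = tau (b + c) z.

(** After resampling, the height is standard normal on each orbit, so [gauss_shift]
applies orbit by orbit. *)
Lemma resample_quasi_invariant (rho : {measure set E -> \bar R}) :
  resample_invariant rho -> quasi_invariant rho.
Proof.
move=> ri c f mf f0.
have mt b : measurable_fun setT (tau b).
  exact: (measurableT_comp mtau (pair1_measurable b)).
have mr z : measurable_fun setT (resample z).
  exact: (measurableT_comp measurable_resample (pair1_measurable z)).
have me : measurable_fun setT (fun z => (expR (c * p z - c ^+ 2 / 2))%:E).
  apply/measurable_EFinP/measurableT_comp => //.
  by apply: measurable_funB => //; exact: measurable_funM.
rewrite ri; [|exact: measurableT_comp|by []].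
rewrite [RHS]ri; [|exact: emeasurable_funM|by move=> z; rewrite mule_ge0// lee_fin expR_ge0].
apply: eq_integral => z _.
transitivity (\int[N01]_y f (resample z (y + c)%R)).
  by apply: eq_integral => y _; rewrite /resample tau_tau; congr (f (tau _ _)); ring.
have mfz := measurableT_comp mf (mr z).
transitivity (\int[N01]_y (f (resample z y) * (expR (c * y - c ^+ 2 / 2))%:E)).
  exact: (gauss_shift c mfz (fun=> f0 _)).
by apply: eq_integral => y _; rewrite {3}/resample p_tau subrKC.
Qed.

End shift_flow.

Lemma integral_probability_cst d (T : measurableType d) (R : realType)
  (P : probability T R) (c : \bar R) : (\int[P]_x c = c)%E.
Proof.
transitivity (c * P setT)%E; first exact: integral_cst.
by rewrite probability_setT mule1.
Qed.

(** For r the square root of a^2 + b^2, the law of (a x + b y) / r is quasi-invariant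
under the translations of the line.  These act transitively, so resampling
identifies it with the standard normal law. *)
Lemma gauss_combination (R : realType) (a b : R) (f : R -> \bar R) :
  measurable_fun setT f -> (forall x, 0 <= f x)%E ->
  (\int[@std_gauss R]_x \int[@std_gauss R]_y f (a * x + b * y)%R =
   \int[@std_gauss R]_x f (Num.sqrt (a ^+ 2 + b ^+ 2) * x)%R)%E.
Proof.
move=> mf f0; set r := Num.sqrt _.
have r2 : r ^+ 2 = a ^+ 2 + b ^+ 2 by rewrite sqr_sqrtr// addr_ge0// sqr_ge0.
have [r0|r0] := eqVneq r 0.
  have /eqP : a ^+ 2 + b ^+ 2 = 0 by rewrite -r2 r0 expr0n.
  rewrite paddr_eq0 ?sqr_ge0// !sqrf_eq0 => /andP[/eqP -> /eqP ->].
  under eq_integral do under eq_integral do rewrite !mul0r addr0.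
  under [RHS]eq_integral do rewrite r0 mul0r.
  by rewrite !integral_probability_cst.
pose a' := a / r; pose b' := b / r.
(* The unit vector (a', b') makes the exponents - (a' c)^2/2 and - (b' c)^2/2 add
   up to - c^2/2. *)
have ab1 : a' ^+ 2 + b' ^+ 2 = 1.
  by rewrite !expr_div_n -mulrDl -r2 divff// expf_neq0.
pose N : probability R R := @std_gauss R.
pose g (z : R * R) := a' * z.1 + b' * z.2.
have mg : measurable_fun setT g.
  by apply: measurable_funD; apply: measurable_funM => //.
have mgx x : measurable_fun setT (fun y : R => a' * x + b' * y).
  by apply: measurable_funD => //; exact: measurable_funM.
have me u : measurable_fun setT (fun y : R => (expR (u * y - u ^+ 2 / 2))%:E).
  apply/measurable_EFinP/measurableT_comp => //.
  by apply: measurable_funB => //; exact: measurable_funM.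
have e0 u x : (0 <= (expR (u * x - u ^+ 2 / 2))%:E :> \bar R)%E.
  by rewrite lee_fin expR_ge0.
pose rho : {measure set R -> \bar R} := image_measure mg (N \x N)%E.
have rhoE (h : R -> \bar R) : measurable_fun setT h -> (forall x, 0 <= h x)%E ->
    (\int[rho]_x h x = \int[N]_x \int[N]_y h (a' * x + b' * y)%R)%E.
  move=> mh h0; rewrite ge0_integral_image// fubini_tonelli1//.
  exact: measurableT_comp.
have rhoT : (rho setT < +oo)%E.
  rewrite /rho/= /image_measure /pushforward preimage_setT.
  by rewrite probability_setT ltry.
have qi : quasi_invariant id (fun c x : R => x + c) (as_finite rhoT).
  move=> c h mh h0.
  have mhe : measurable_fun setT (fun x => h x * (expR (c * x - c ^+ 2 / 2))%:E)%E.
    exact: emeasurable_funM.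
  have mhc u : measurable_fun setT (fun x : R => h (x + u)).
    by apply: measurableT_comp => //; exact: measurable_funD.
  rewrite (rhoE _ (mhc c) (fun=> h0 _)) (rhoE _ mhe); last first.
    by move=> x; rewrite mule_ge0.
  pose G x : \bar R := (\int[N]_y (h (a' * x + b' * y)%R *
     (expR (b' * c * y - (b' * c) ^+ 2 / 2))%:E))%E.
  transitivity (\int[N]_x G (x + a' * c)%R)%E.
    apply: eq_integral => x _; rewrite /G -(gauss_shift (b' * c)
      (f := fun y => h (a' * (x + a' * c) + b' * y)%R))//; last exact: measurableT_comp.
    apply: eq_integral => y _; congr h.
    rewrite -[in LHS](mulr1 c) -[in LHS]ab1; ring.
  have G0 x : (0 <= G x)%E by apply: integral_ge0 => y _; rewrite mule_ge0.
  have mG : measurable_fun setT G.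
    apply: (@measurable_fun_fubini_tonelli_F _ _ _ _ R N
      (fun z => h (a' * z.1 + b' * z.2)%R * (expR (b' * c * z.2 - (b' * c) ^+ 2 / 2))%:E)%E).
    - apply: emeasurable_funM; first exact: (measurableT_comp mh mg).
      exact: (measurableT_comp (me _) measurable_snd).
    - by move=> z; rewrite mule_ge0.
  transitivity (\int[N]_x (G x * (expR (a' * c * x - (a' * c) ^+ 2 / 2))%:E))%E.
    exact: (gauss_shift (a' * c) mG G0).
  apply: eq_integral => x _; rewrite /G -ge0_integralZr//; last 2 first.
  - by apply: emeasurable_funM => //; exact: (measurableT_comp mh (mgx x)).
  - by move=> y _; rewrite mule_ge0.
  apply: eq_integral => y _; rewrite -muleA -EFinM -expRD; congr (_ * (expR _)%:E)%E.
  have -> : c ^+ 2 / 2 = (a' ^+ 2 + b' ^+ 2) * c ^+ 2 / 2 by rewrite ab1 mul1r.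
  by field.
have mtau : measurable_fun setT (fun z : R * R => z.2 + z.1).
  by apply: measurable_funD; [exact: measurable_snd|exact: measurable_fst].
have mfr : measurable_fun setT (fun x => f (r * x)).
  by apply: measurableT_comp => //; exact: measurable_funM.
transitivity (\int[rho]_x f (r * x)%R)%E.
  rewrite (rhoE _ mfr (fun=> f0 _)).
  apply: eq_integral => x _; apply: eq_integral => y _; congr f.
  by rewrite /a' /b'; field.
rewrite (@quasi_invariant_resample _ _ _ id (fun c x => x + c) (@measurable_id _ _ _)
  mtau (fun _ _ => erefl) _ qi)//.
transitivity (\int[as_finite rhoT]_z (\int[N]_y f (r * y)%R))%E.
  apply: eq_integral => z _; apply: eq_integral => y _.
  by rewrite /resample addrCA subrr addr0.
transitivity ((\int[N]_y f (r * y)%R) * (as_finite rhoT) setT)%E.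
  exact: integral_cst.
rewrite -[RHS]mule1; congr (_ * _)%E.
by rewrite /as_finite /= /image_measure /pushforward preimage_setT probability_setT.
Qed.

(** * A Cramer-Wold theorem *)

Section step_polynomial.
Context (R : realType).

Lemma bernoulli_ge (a : R) n : -1 <= a -> 1 + n%:R * a <= (1 + a) ^+ n.
Proof.
move=> a1; elim: n => [|n IH]; first by rewrite mul0r addr0 expr0.
rewrite exprS (le_trans _ (ler_wpM2l _ IH))//; last by rewrite -lerBlDl sub0r.
rewrite -[n.+1]addn1 natrD -subr_ge0.
have -> : (1 + a) * (1 + n%:R * a) - (1 + (n%:R + 1%:R) * a) = n%:R * a ^+ 2 by ring.
by rewrite mulr_ge0// sqr_ge0.
Qed.

Lemma cvg_natM_exprn (q : R) : 0 <= q -> q < 1 -> n%:R * q ^+ n @[n --> \oo] --> 0.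
Proof.
rewrite le_eqVlt => /predU1P[<- _|q0 q1].
  apply: cvg_near_cst; near=> n.
  by rewrite expr0n gtn_eqF ?mulr0//; near: n; exists 1%N.
pose r := Num.sqrt q.
have r2 : r ^+ 2 = q by rewrite sqr_sqrtr// ltW.
have r0 : 0 < r by rewrite sqrtr_gt0.
have r1 : r < 1 by rewrite -(@expr_lt1 _ 2)// ?r2// ltW.
pose h := r^-1 - 1.
have h0 : 0 < h by rewrite subr_gt0 invf_gt1.
apply: (@squeeze_cvgr _ _ _ _ (cst 0) (fun n => h^-1 * r ^+ n)).
- near=> n; rewrite mulr_ge0 ?exprn_ge0 ?(ltW q0)//=.
  have -> : q ^+ n = r ^+ n * r ^+ n by rewrite -r2 -exprM mulnC exprM expr2.
  rewrite mulrA. apply: ler_wpM2r; first by rewrite exprn_ge0// ltW.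
  have H : 1 + n%:R * h <= (r ^+ n)^-1.
    have <- : (1 + h) ^+ n = (r ^+ n)^-1 by rewrite /h addrC subrK exprVn.
    by apply: bernoulli_ge; rewrite (le_trans _ (ltW h0))// lerN10.
  rewrite -(ler_pM2l h0) divff ?gt_eqF// mulrA [h * _]mulrC -ler_pdivlMr ?exprn_gt0//.
  by rewrite div1r (le_trans _ H)// lerDr.
- exact: cvg_cst.
- rewrite -[0 in X in _ --> X](mulr0 h^-1); apply: cvgMr.
  by apply: cvg_expr; rewrite ger0_norm// ltW.
Unshelve. all: end_near. Qed.

(** Polynomials that converge to the indicator of ]0, 1] on [-1, 1] while staying in
[0, 1].  With s = (1 - u) / 2, Bernoulli's inequality bounds (1 - s^n)^(2^n n) from
below by 1 - n (2 s)^n, which tends to 1 if s < 1/2, and from above by 2^-n if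
s >= 1/2. *)
Definition step_poly (n : nat) (u : R) : R :=
  (1 - ((1 - u) / 2) ^+ n) ^+ (2 ^ n * n).

Lemma step_poly_itv n u : -1 <= u <= 1 -> 0 <= step_poly n u <= 1.
Proof.
move=> /andP[u0 u1]; have s0 : 0 <= (1 - u) / 2 by lra.
have s1 : (1 - u) / 2 <= 1 by lra.
have sn : ((1 - u) / 2) ^+ n <= 1 by rewrite exprn_ile1.
have sn0 : 0 <= ((1 - u) / 2) ^+ n by rewrite exprn_ge0.
by rewrite exprn_ge0/= ?exprn_ile1// ?subr_ge0// lerBlDr lerDl.
Qed.

Lemma cvg_step_poly (u : R) : -1 <= u <= 1 ->
  step_poly n u @[n --> \oo] --> ((0 < u)%R%:R : R).
Proof.
move=> u11; have /andP[u0 u1] := u11; set s := (1 - u) / 2.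
have s0 : 0 <= s by rewrite /s; lra.
have s1 : s <= 1 by rewrite /s; lra.
have [up|un] := ltP 0 u.
  apply: (@squeeze_cvgr _ _ _ _ (fun n => 1 - n%:R * (2 * s) ^+ n) (cst 1)).
  - near=> n; have /andP[_ ->] := step_poly_itv n u11; rewrite andbT.
    rewrite /step_poly -/s.
    have := @bernoulli_ge (- s ^+ n) (2 ^ n * n).
    rewrite lerN2 exprn_ile1// => /(_ isT); apply: le_trans.
    rewrite mulrN exprMn natrM natrX.
    by have -> : n%:R * (2 ^+ n * s ^+ n) = 2 ^+ n * n%:R * s ^+ n by ring.
  - rewrite -[1 in X in _ --> X]subr0; apply: cvgB; first exact: cvg_cst.
    by apply: cvg_natM_exprn; rewrite /s; lra.
  - exact: cvg_cst.
apply: (@squeeze_cvgr _ _ _ _ (cst 0) (fun n => 2^-1 ^+ n)).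
- near=> n; have /andP[-> _] := step_poly_itv n u11; rewrite /=.
  rewrite /step_poly -/s exprM lerXn2r ?nnegrE ?exprn_ge0 ?subr_ge0 ?exprn_ile1//.
  have h : 2^-1 ^+ n <= s ^+ n by rewrite lerXn2r// ?nnegrE// /s; lra.
  have h1 : 2^-1 ^+ n <= 1 :> R by rewrite exprn_ile1//; lra.
  have h0 : 0 <= 2^-1 ^+ n :> R by rewrite exprn_ge0.
  apply: (@le_trans _ _ ((1 - 2^-1 ^+ n) ^+ (2 ^ n))).
    by apply: lerXn2r; rewrite ?nnegrE ?subr_ge0 ?h1 ?exprn_ile1// lerD2l lerN2.
  apply: (@le_trans _ _ (((1 + 2^-1 ^+ n) ^+ (2 ^ n))^-1)).
    rewrite -[leRHS]mul1r ler_pdivlMr ?exprn_gt0 ?ltr_pwDl// -exprMn; apply: exprn_ile1.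
      by rewrite mulr_ge0 ?subr_ge0 ?addr_ge0.
    by rewrite -subr_sqr expr1n lerBlDr lerDl sqr_ge0.
  rewrite lef_pV2 ?posrE ?exprn_gt0 ?ltr_pwDl//.
  have E2 : 1 + (2 ^ n)%:R * 2^-1 ^+ n = 2 :> R.
    by rewrite natrX exprVn divff ?expf_neq0.
  rewrite -[leLHS]E2; apply: bernoulli_ge.
  by rewrite (le_trans _ h0)// lerN10.
- exact: cvg_cst.
- by apply: cvg_expr; rewrite ger0_norm//; lra.
Unshelve. all: end_near. Qed.

End step_polynomial.

(** Two finite measures that give the same law to each function of a linear space [L]
agree on the sigma-algebra generated by [L].  The common laws give the
common integrals of cos (l + b); these functions span an algebra, which contains
polynomials in them, hence approximations of the indicators of the sets where
finitely many cosines are positive. *)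
Section cramer_wold.
Context (R : realType) d (E : measurableType d).
Variables (L : set (E -> R)).
Hypothesis Lm : forall l, L l -> measurable_fun setT l.
Hypothesis LD : forall l l', L l -> L l' -> L (fun x => l x + l' x).
Hypothesis LZ : forall a l, L l -> L (fun x => a * l x).

(** The linear span of the functions cos (l + b).  It is closed under products by the
addition formulas, sines being cosines with another phase. *)
Inductive trig : (E -> R) -> Prop :=
| trig_cos l b : L l -> trig (fun x => cos (l x + b))
| trigD u v : trig u -> trig v -> trig (fun x => u x + v x)
| trigZ a u : trig u -> trig (fun x => a * u x).

Lemma trigM u v : trig u -> trig v -> trig (fun x => u x * v x).
Proof.
move=> tu tv; elim: tu => [l b Ll|u1 u2 _ IH1 _ IH2|a u1 _ IH].
- elim: tv => [l' b' Ll'|v1 v2 _ IH1 _ IH2|a v1 _ IH].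
  + rewrite (_ : (fun _ => _) = fun x =>
      2^-1 * (cos ((l x + l' x) + (b + b')) + cos ((l x + -1 * l' x) + (b - b')))).
      apply: trigZ; apply: trigD; apply: trig_cos; apply: LD => //.
      exact: LZ.
    apply/funext => x.
    have -> : l x + l' x + (b + b') = (l x + b) + (l' x + b') by ring.
    have -> : l x + -1 * l' x + (b - b') = (l x + b) - (l' x + b') by ring.
    by rewrite (cosB (l x + b)) (cosD (l x + b)); field.
  + by under eq_fun do rewrite mulrDr; exact: trigD.
  + by under eq_fun do rewrite mulrCA; exact: trigZ.
- by under eq_fun do rewrite mulrDl; exact: trigD.
- by under eq_fun do rewrite -mulrA; exact: trigZ.
Qed.

Lemma trig_meas u : trig u -> measurable_fun setT u.
Proof.
elim=> [l b Ll|u1 u2 _ IH1 _ IH2|a u1 _ IH].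
- apply: (measurableT_comp (continuous_measurable_fun (@continuous_cos R))).
  by apply: measurable_funD => //; exact: Lm.
- exact: measurable_funD.
- exact: measurable_funM.
Qed.

Lemma trig_bnd u : trig u -> exists M, forall x, `|u x| <= M.
Proof.
elim=> [l b Ll|u1 u2 _ [M1 h1] _ [M2 h2]|a u1 _ [M h]].
- by exists 1 => x; rewrite ler_norml cos_geN1 cos_le1.
- by exists (M1 + M2) => x; rewrite (le_trans (ler_normD _ _))// lerD.
- by exists (`|a| * M) => x; rewrite normrM ler_wpM2l.
Qed.

Lemma trig_integrable (m : {finite_measure set E -> \bar R}) u :
  trig u -> m.-integrable setT (EFin \o u).
Proof.
move=> tu; have [M h] := trig_bnd tu.
apply: measurable_bounded_integrable => //.
- by rewrite ltey_eq fin_num_measure.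
- exact: trig_meas.
- exists M; split; first exact: num_real.
  by move=> M' MM' x _ /=; rewrite (le_trans (h x))// ltW.
Qed.

Variables m1 m2 : {finite_measure set E -> \bar R}.
Hypothesis Lm12 : forall l, L l -> forall B, measurable B ->
  m1 (l @^-1` B) = m2 (l @^-1` B).

Lemma trig_eq u : trig u -> (\int[m1]_x (u x)%:E = \int[m2]_x (u x)%:E)%E.
Proof.
elim=> [l b Ll|u1 u2 t1 IH1 t2 IH2|a u1 t1 IH].
- have ml := Lm Ll.
  have mc : measurable_fun setT (fun y : R => (cos (y + b))%:E).
    apply/measurable_EFinP/(measurableT_comp (continuous_measurable_fun (@continuous_cos R))).
    exact: measurable_funD.
  have H (m : {finite_measure set E -> \bar R}) :
      (\int[m]_x (cos (l x + b))%:E = \int[pushforward m l]_y (cos (y + b))%:E)%E.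
    rewrite (integral_pushforward ml mc)//.
    by have := trig_integrable m (trig_cos b Ll).
  rewrite !H; apply: (eq_measure_integral (image_measure ml m2)) => A mA _.
  exact: Lm12.
- rewrite !integralD_EFin// ?IH1 ?IH2//; exact: trig_integrable.
- under eq_integral do rewrite EFinM; under [RHS]eq_integral do rewrite EFinM.
  by rewrite !integralZl// ?IH//; exact: trig_integrable.
Qed.

Hypothesis L0 : L (fun=> 0).

Lemma trig_cst c : trig (fun=> c).
Proof.
rewrite (_ : (fun=> c) = fun x => c * cos ((fun=> 0) x + 0)).
  exact/trigZ/trig_cos.
by apply/funext => x; rewrite addr0 cos0 mulr1.
Qed.

Lemma trigX u n : trig u -> trig (fun x => u x ^+ n).
Proof.
move=> tu; elim: n => [|n IH]; first exact: trig_cst.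
by under eq_fun do rewrite exprS; exact: trigM.
Qed.

Lemma trig_prod (u : nat -> E -> R) n : (forall i, trig (u i)) ->
  trig (fun x => \prod_(i < n) u i x).
Proof.
move=> tu; elim: n => [|n IH].
  by under eq_fun do rewrite big_ord0; exact: trig_cst.
by under eq_fun do rewrite big_ord_recr/=; exact: trigM.
Qed.

Lemma trig_step_poly u n : trig u -> trig (fun x => step_poly n (u x)).
Proof.
move=> tu; apply: trigX.
under eq_fun do rewrite -mulN1r; apply: trigD; first exact: trig_cst.
apply: trigZ; apply: trigX.
under eq_fun do rewrite mulrC -mulN1r; apply: trigZ; apply: trigD => //.
  exact: trig_cst.
exact: trigZ.
Qed.

Let pos (l : nat -> E -> R) (b : nat -> R) n :=
  [set x | forall i, (i < n)%N -> 0 < cos (l i x + b i)].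

Let prod_indic (l : nat -> E -> R) (b : nat -> R) n x :
  \prod_(i < n) (0 < cos (l i x + b i))%R%:R = \1_(pos l b n) x :> R.
Proof.
rewrite indicE; elim: n => [|n IH].
  by rewrite big_ord0 mem_set.
rewrite big_ord_recr/= IH -natrM mulnb; congr (nat_of_bool _)%:R.
apply/idP/idP => [/andP[/set_mem H0 H1]|/set_mem H].
  apply/mem_set => i; rewrite ltnS leq_eqVlt => /predU1P[->//|].
  exact: H0.
apply/andP; split; last by apply: H.
by apply/mem_set => i ni; apply: H; rewrite ltnS ltnW.
Qed.

Let meas_pos (l : nat -> E -> R) (b : nat -> R) n : (forall i, L (l i)) -> measurable (pos l b n).
Proof.
move=> Ll; rewrite (_ : pos l b n = \bigcap_(i in [set i | (i < n)%N])
    ((fun x => cos (l i x + b i)) @^-1` `]0, +oo[)); last first.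
  by apply/seteqP; split => x /= H i /= ni; have := H i ni;
    rewrite /= in_itv/= andbT.
apply: bigcap_measurableType => i _; rewrite -[X in measurable X]setTI.
exact: (trig_meas (trig_cos (b i) (Ll i))).
Qed.

(** The indicator is the bounded limit of products of step polynomials of cosines. *)
Lemma trig_pos_eq l b n : (forall i, L (l i)) -> m1 (pos l b n) = m2 (pos l b n).
Proof.
move=> Ll; pose f k x := \prod_(i < n) step_poly k (cos (l i x + b i)).
have c11 i x : -1 <= cos (l i x + b i) <= 1 by rewrite cos_geN1 cos_le1.
have tf k : trig (f k).
  by apply: (trig_prod (u := fun i x => step_poly k (cos (l i x + b i)))) => i;
    apply/trig_step_poly/trig_cos.
have f01 k x : 0 <= f k x <= 1.
  apply/andP; split; first by apply: prodr_ge0 => i _; case/andP: (step_poly_itv k (c11 i x)).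
  by apply: prodr_ile1 => i _; exact: step_poly_itv.
have H (m : {finite_measure set E -> \bar R}) :
    (\int[m]_x (f k x)%:E @[k --> \oo] --> m (pos l b n))%E.
  have -> : m (pos l b n) = (\int[m]_x (\1_(pos l b n) x)%:E)%E.
    by rewrite integral_indic ?setIT//; exact: meas_pos.
  apply: (@dominated_cvg _ _ _ m setT measurableT _ _ (cst 1%E)) => //.
  - by move=> k; apply/measurable_EFinP; exact: trig_meas.
  - move=> x _; rewrite -prod_indic; apply: cvg_EFin; first exact: nearW.
    apply: cvg_big => [|i _]; last exact: cvg_step_poly.
    by move=> z; apply: cvgM; [exact: cvg_fst|exact: cvg_snd].
  - exact: finite_measure_integrable_cst.
  - move=> k x _ /=; rewrite lee_fin ger0_norm; by case/andP: (f01 k x).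
have := H m1; under eq_fun do rewrite (trig_eq (tf _)).
by move=> H1; exact: (cvg_unique _ H1 (H m2)).
Qed.

Lemma pos_setI_closed : setI_closed [set A | exists l b n,
  (forall i, L (l i)) /\ A = pos l b n].
Proof.
move=> _ _ [l [b [n [Ll ->]]]] [l' [b' [n' [Ll' ->]]]].
exists (fun i => if (i < n)%N then l i else l' (i - n)%N).
exists (fun i => if (i < n)%N then b i else b' (i - n)%N), (n + n')%N.
split; first by move=> i; case: ifP.
apply/seteqP; split => x /=.
  move=> [H H'] i inn; case: ifPn => [|]; first exact: H.
  by rewrite -leqNgt => ni; apply: H'; rewrite ltn_subLR.
move=> H; split => i ni.
  by have := H i; rewrite ni; apply; apply: (leq_trans ni); exact: leq_addr.
have E0 : (n + i < n)%N = false by rewrite ltnNge leq_addr.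
by have := H (n + i)%N; rewrite E0 ltn_add2l addKn; apply.
Qed.

(** As soon as k + 1 > |l x - c|, the sign of sin (pi (l x - c) / (k + 1)) is that of
l x - c.  So l > c is the lower limit of these positivity sets. *)
Lemma halfspace_pos l c : L l ->
  <<s [set A | exists l b n, (forall i, L (l i)) /\ A = pos l b n] >>
  (l @^-1` `]c, +oo[).
Proof.
move=> Ll; set G := [set A | _].
pose a (k : nat) : R := pi / k.+1%:R.
pose S k := pos (fun=> fun x => a k * l x) (fun=> - (a k * c) - pi / 2) 1.
have a0 k : 0 < a k by rewrite divr_gt0// pi_gt0.
have SE k x : S k x = (0 < sin (a k * (l x - c))) :> Prop.
  rewrite /S/pos/=; have -> : (0 < sin (a k * (l x - c))) = (0 < cos (a k * l x + (- (a k * c) - pi / 2))).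
    have -> : a k * l x + (- (a k * c) - pi / 2) = a k * (l x - c) - pi / 2 by ring.
    by rewrite cosB cos_pihalf sin_pihalf mulr0 mulr1 add0r.
  by apply/propext; split => [/(_ 0%N isT)//|h i _].
have -> : l @^-1` `]c, +oo[ = \bigcup_N \bigcap_(k in [set k | (N <= k)%N]) S k.
  have near_k x : exists N, forall k, (N <= k)%N -> `|a k * (l x - c)| < pi.
    exists (Num.truncn `|l x - c|).+1 => k Nk.
    rewrite normrM gtr0_norm// /a mulrAC -mulrA gtr_pMr ?pi_gt0//.
    rewrite ltr_pdivrMr// mul1r; apply: (lt_le_trans (truncnS_gt _)).
    by rewrite ler_nat leqW.
  apply/seteqP; split => x /=.
    rewrite in_itv/= andbT => cx; have [N HN] := near_k x.
    exists N => // k /= Nk; rewrite SE; apply: sin_gt0_pi.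
    have p0 : 0 < a k * (l x - c) by rewrite mulr_gt0// subr_gt0.
    by rewrite p0/= -[X in X < _]gtr0_norm// HN.
  move=> [N _ HN]; rewrite in_itv/= andbT ltNge; apply/negP => lc.
  have [N' HN'] := near_k x; pose k := maxn N N'.
  have := HN k (leq_maxl _ _); rewrite SE.
  have := HN' k (leq_maxr _ _).
  have p0 : a k * (l x - c) <= 0 by rewrite pmulr_rle0// subr_le0.
  rewrite ler0_norm// => ltpi; apply/negP; rewrite -leNgt.
  rewrite -[leLHS]opprK -sinN oppr_le0; apply: sin_ge0_pi.
  by rewrite oppr_ge0 p0 ltW.
apply: sigma_algebra_bigcup => N.
have -> : \bigcap_(k in [set k | (N <= k)%N]) S k = \bigcap_k S (N + k)%N.
  apply/seteqP; split => x H k /=; first by move=> _; apply: H; rewrite /= leq_addr.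
  by move=> Nk; have := H (k - N)%N I; rewrite subnKC.
apply: (@bigcapT_measurable _ (g_sigma_algebraType G)) => k.
apply: sub_sigma_algebra.
exists (fun=> fun x => a (N + k)%N * l x), (fun=> - (a (N + k)%N * c) - pi / 2), 1%N.
by split => // _; exact: LZ.
Qed.

Theorem cramer_wold A :
  <<s [set B | exists l c, L l /\ B = l @^-1` `]c, +oo[] >> A -> m1 A = m2 A.
Proof.
set G := [set A | exists l b n, (forall i, L (l i)) /\ A = pos l b n].
move=> sA; apply: (g_sigma_algebra_measure_unique G _ (fun=> setT)).
- by move=> _ [l [b [n [Ll ->]]]]; exact: meas_pos.
- move=> _; exists (fun=> fun=> 0), (fun=> 0), 0%N; split => //.
  by apply/seteqP; split.
- by apply/seteqP; split => // x _; exists 0%N.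
- exact: pos_setI_closed.
- by move=> _ [l [b [n [Ll ->]]]]; exact: trig_pos_eq.
- by move=> _; rewrite ltey_eq fin_num_measure.
move: A sA; apply: smallest_sub; first exact: smallest_sigma_algebra.
by move=> _ [l [c [Ll ->]]]; exact: halfspace_pos.
Qed.

End cramer_wold.

(** * The sequence space *)

Section sequence_space.
Context (R : realType).

Lemma measurable_coord n : measurable_fun setT (fun x : Rinf R => x n).
Proof.
by move=> _ B mB; rewrite setTI; apply: sub_sigma_algebra; exists n, B.
Qed.

Lemma measurable_to_Rinf d (T : measurableType d) (f : T -> Rinf R) :
  (forall n, measurable_fun setT (fun t => f t n)) -> measurable_fun setT f.
Proof.
move=> mf; apply: (@measurability _ _ _ (Rinf R) setT f (@cylinders R)) => //.
move=> _ [_ [n [B mB ->]] <-].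
exact: (mf n measurableT B mB).
Qed.

Lemma measurable_add_seq d (T : measurableType d) (f g : T -> Rinf R) :
  measurable_fun setT f -> measurable_fun setT g ->
  measurable_fun setT (fun t => add_seq (f t) (g t)).
Proof.
move=> mf mg; apply: measurable_to_Rinf => n; apply: measurable_funD.
- exact: (measurableT_comp (measurable_coord n) mf).
- exact: (measurableT_comp (measurable_coord n) mg).
Qed.

Definition coord_shift (n : nat) (c : R) (x : Rinf R) : Rinf R :=
  add_seq x (fun i => c * (n == i)%:R).

Lemma coord_shiftE n c x : coord_shift n c x n = x n + c.
Proof. by rewrite /coord_shift /add_seq eqxx mulr1. Qed.

Lemma coord_shift_neq n c x i : i != n -> coord_shift n c x i = x i.
Proof.
by move=> ni; rewrite /coord_shift /add_seq eq_sym (negbTE ni) mulr0 addr0.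
Qed.

Lemma coord_shiftD n b c x :
  coord_shift n b (coord_shift n c x) = coord_shift n (b + c) x.
Proof. by apply/funext => i; rewrite /coord_shift /add_seq; ring. Qed.

Lemma measurable_coord_shift n :
  measurable_fun setT (fun z : R * Rinf R => coord_shift n z.1 z.2).
Proof.
apply: measurable_add_seq; first exact: measurable_snd.
by apply: measurable_to_Rinf => i; apply: measurable_funM => //; exact: measurable_fst.
Qed.

End sequence_space.

Section fiberwise.
Context (R : realType) d (T : measurableType d).

Definition fiber_coord n (z : Rinf R * T) : R := z.1 n.
Definition fiber_shift n (c : R) (z : Rinf R * T) : Rinf R * T :=
  (coord_shift n c z.1, z.2).

Lemma measurable_fiber_coord n : measurable_fun setT (fiber_coord n).
Proof. exact: (measurableT_comp (measurable_coord n) measurable_fst). Qed.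

Lemma measurable_fiber_shift n :
  measurable_fun setT (fun z : R * (Rinf R * T) => fiber_shift n z.1 z.2).
Proof.
apply: measurable_fun_pair; last exact: measurableT_comp.
apply: (measurableT_comp (measurable_coord_shift n)
  (g := fun z : R * (Rinf R * T) => (z.1, z.2.1))).
by apply: measurable_fun_pair => //; exact: measurableT_comp.
Qed.

Lemma fiber_coord_shift n c z :
  fiber_coord n (fiber_shift n c z) = fiber_coord n z + c.
Proof. exact: coord_shiftE. Qed.

Let depends_on (U : Type) N (f : Rinf R * T -> U) :=
  forall x y t, (forall i, (i < N)%N -> x i = y i) -> f (x, t) = f (y, t).

(** Resampling the coordinates N - 1, ..., 0 turns a function of t and of the first N
coordinates into a function of t alone, with the same integral for both measures. *)
Lemma quasi_invariant_unique (m1 m2 : {finite_measure set (Rinf R * T)%type -> \bar R}) :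
  (forall n, quasi_invariant (fiber_coord n) (fiber_shift n) m1) ->
  (forall n, quasi_invariant (fiber_coord n) (fiber_shift n) m2) ->
  (forall A, measurable A -> m1 (snd @^-1` A) = m2 (snd @^-1` A)) ->
  forall C, measurable C -> m1 C = m2 C.
Proof.
move=> q1 q2 marg.
have ri (m : {finite_measure set (Rinf R * T)%type -> \bar R}) :
    (forall n, quasi_invariant (fiber_coord n) (fiber_shift n) m) ->
    forall n, resample_invariant (fiber_coord n) (fiber_shift n) m.
  move=> q n; apply: quasi_invariant_resample => //.
  - exact: measurable_fiber_coord.
  - exact: measurable_fiber_shift.
  - exact: fiber_coord_shift.
have H N (f : Rinf R * T -> \bar R) : measurable_fun setT f -> (forall z, 0 <= f z)%E ->
    depends_on N f -> (\int[m1]_z f z = \int[m2]_z f z)%E.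
  elim: N f => [|N IH] f mf f0 fN.
    pose f' (t : T) := f ((fun=> 0) : Rinf R, t).
    have mf' : measurable_fun setT f' by exact: (measurableT_comp mf (pair1_measurable _)).
    have ff' z : f z = f' z.2 by case: z => x t; apply: fN.
    have fm (m : {finite_measure set (Rinf R * T)%type -> \bar R}) :
        (\int[m]_z f z = \int[image_measure (@measurable_snd _ _ (Rinf R) T) m]_t f' t)%E.
      rewrite ge0_integral_image// => [|t]; last exact: f0.
      by apply: eq_integral => z _; rewrite ff'.
    by rewrite !fm; apply: eq_measure_integral => A mA _; exact: marg.
  rewrite (ri _ q1 N)// (ri _ q2 N)//; apply: IH.
  - apply: (@measurable_fun_fubini_tonelli_F _ _ _ _ R (@std_gauss R)
      (fun z => f (resample (fiber_coord N) (fiber_shift N) z.1 z.2))) => //.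
    apply: measurableT_comp => //; apply: measurable_resample.
    - exact: measurable_fiber_coord.
    - exact: measurable_fiber_shift.
  - by move=> z; exact: integral_ge0.
  - move=> x y t xy; apply: eq_integral => r _; rewrite /resample /fiber_shift/=.
    apply: fN => i; rewrite ltnS leq_eqVlt => /predU1P[->|iN].
      by rewrite !coord_shiftE /fiber_coord/= !subrKC.
    by rewrite !coord_shift_neq ?ltn_eqF//; exact: xy.
(* The sets depending on finitely many coordinates form a generating pi-system. *)
pose G := [set C | measurable C /\ exists N, depends_on N (fun z => C z : Prop)].
move=> C mC; apply: (g_sigma_algebra_measure_unique G _ (fun=> setT)).
- by move=> ? [].
- by move=> _; split => //; exists 0%N.
- by apply/seteqP; split => // x _; exists 0%N.
- move=> A B [mA [N AN]] [mB [N' BN']]; split; first exact: measurableI.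
  exists (maxn N N') => x y t xy; congr (_ /\ _).
    by apply: AN => i iN; apply: xy; rewrite leq_max iN.
  by apply: BN' => i iN; apply: xy; rewrite leq_max iN orbT.
- move=> A [mA [N AN]].
  rewrite -(setIT A) -!integral_indic//; apply: (H N) => //.
  + exact/measurable_EFinP/measurable_indic.
  + move=> x y t xy; rewrite !indicE; congr (_%:R)%:E; congr nat_of_bool.
    by apply/idP/idP; rewrite !inE (AN _ _ _ xy).
- by move=> _; rewrite ltey_eq fin_num_measure.
suff : measurable_fun setT (id : g_sigma_algebraType G -> Rinf R * T).
  by move=> /(_ measurableT C mC); rewrite setTI.
rewrite (_ : id = fun z => (z.1, z.2)); last by apply/funext => -[].
apply: measurable_fun_pair.
  apply: measurable_to_Rinf => n _ B mB; rewrite setTI; apply: sub_sigma_algebra; split.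
    by rewrite -[X in measurable X]setTI; exact: (measurable_fiber_coord n).
  by exists n.+1 => x y t xy /=; rewrite xy.
move=> _ B mB; rewrite setTI; apply: sub_sigma_algebra; split.
  by rewrite -[X in measurable X]setTI; exact: measurable_snd.
by exists 0%N.
Qed.

End fiberwise.

(** * Generalized functions and their coordinates *)

(** The law of z / s under N(0, s^2) is quasi-invariant under translations of the
line, hence standard normal. *)
Lemma normal_prob_scale (R : realType) (s : R) (A : set R) : s != 0 ->
  measurable A -> normal_prob 0 s A = std_gauss ((fun z => s * z) @^-1` A).
Proof.
move=> s0 mA.
pose N := @std_gauss R.
have ms : measurable_fun setT (fun z : measurableTypeR R => s^-1 * z : R).
  by apply: measurable_funM => //.
pose rho : {measure set R -> \bar R} := image_measure ms (@normal_prob R 0 s).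
have rhoT : (rho setT < +oo)%E.
  rewrite /rho/= /image_measure /pushforward preimage_setT.
  by rewrite probability_setT ltry.
have mpdf : measurable_fun setT (normal_pdf 0 s) := measurable_normal_pdf 0 s.
have rhoE (f : R -> \bar R) : measurable_fun setT f -> (forall x, 0 <= f x)%E ->
    (\int[rho]_x f x = \int[lebesgue_measure]_z (f (s^-1 * z)%R * (normal_pdf 0 s z)%:E))%E.
  move=> mf f0; rewrite ge0_integral_image//.
  apply: (@ge0_integral_density _ (measurableTypeR R) R lebesgue_measure
    (@normal_prob R 0 s) (normal_pdf 0 s) mpdf _ _ (fun z => f (s^-1 * z))) => //.
  - by move=> z; exact: normal_pdf_ge0.
  - exact: (measurableT_comp mf ms).
have qi : quasi_invariant id (fun c x : R => x + c) (as_finite rhoT).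
  move=> c f mf f0.
  have me : measurable_fun setT (fun z => (expR (c * z - c ^+ 2 / 2))%:E).
    apply/measurable_EFinP/measurableT_comp => //.
    by apply: measurable_funB => //; exact: measurable_funM.
  have mfc : measurable_fun setT (fun x : R => f (x + c)).
    by apply: measurableT_comp => //; exact: measurable_funD.
  rewrite (rhoE (fun x => f (x + c)%R))// (rhoE (fun x => f x * _)%E); last 2 first.
  - exact: emeasurable_funM.
  - by move=> x; rewrite mule_ge0// lee_fin expR_ge0.
  rewrite -(ge0_integral_lebesgue_shift (- (s * c))).
  - apply: eq_integral => z _.
    have -> : s^-1 * (z + - (s * c)) + c = s^-1 * z by field.
    rewrite -muleA -EFinM; congr (_ * _%:E)%E.
    rewrite !normal_pdfE// /normal_fun [RHS]mulrCA -expRD; congr (_ * expR _).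
    by rewrite !subr0; field.
  - by apply: emeasurable_funM; [exact: (measurableT_comp mfc ms)|exact/measurable_EFinP].
  - by move=> z; rewrite mule_ge0// lee_fin normal_pdf_ge0.
have mtau : measurable_fun setT (fun z : R * R => z.2 + z.1).
  by apply: measurable_funD; [exact: measurable_snd|exact: measurable_fst].
pose B : set R := (fun z => s * z) @^-1` A.
have mA' : measurable B.
  rewrite -[X in measurable X]setTI.
  by apply: measurable_funM => //; exact: measurable_cst.
rewrite -[X in std_gauss X]/B.
have -> : normal_prob 0 s A = rho B.
  rewrite /rho/= /image_measure /pushforward; congr normal_prob.
  by apply/seteqP; split => z; rewrite /B /= mulrA divff// mul1r.
have mB1 : measurable_fun setT (fun x : R => (\1_B x)%:E : \bar R).
  exact/measurable_EFinP/measurable_indic.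
have B10 x : (0 <= (\1_B x)%:E :> \bar R)%E by rewrite lee_fin.
transitivity (\int[as_finite rhoT]_x (\1_B x)%:E)%E.
  by rewrite integral_indic// setIT.
transitivity (\int[as_finite rhoT]_z N B)%E.
  etransitivity; first exact: (@quasi_invariant_resample _ _ _ id (fun c x => x + c)
    (@measurable_id _ _ _) mtau (fun _ _ => erefl) _ qi _ mB1 B10).
  apply: eq_integral => z _; transitivity (\int[N]_y (\1_B y)%:E)%E; last first.
    by rewrite integral_indic// setIT.
  by apply: eq_integral => y _; rewrite /resample addrCA subrr addr0.
transitivity (N B * as_finite rhoT setT)%E.
  exact: integral_cst.
rewrite -[RHS]mule1; congr (_ * _)%E.
by rewrite /as_finite /= /image_measure /pushforward preimage_setT probability_setT.
Qed.

(** One formula covers the degenerate case: for s = 0 both sides are the Dirac mass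
at 0. *)
Lemma centered_gaussianE (R : realType) (s : R) (A : set R) : measurable A ->
  centered_gaussian s A = std_gauss ((fun z => s * z) @^-1` A).
Proof.
move=> mA; rewrite /centered_gaussian; case: ifPn => [/eqP ->|s0].
  rewrite diracE; have [A0|A0] := boolP (0 \in A).
    have -> : (fun z : R => 0 * z) @^-1` A = setT.
      by apply/seteqP; split => // z _ /=; rewrite mul0r; exact/set_mem.
    by rewrite probability_setT.
  have -> : (fun z : R => 0 * z) @^-1` A = set0.
    apply/seteqP; split => // z /=; rewrite mul0r => /mem_set.
    by rewrite (negbTE A0).
  by rewrite measure0.
exact: normal_prob_scale.
Qed.

Section generalized_function.
Context (R : realType) (H : completeNormedModType R) d (T : measurableType d)
  (mu : {measure set T -> \bar R}) (Y : H -> {mfun_ mu, T >-> R}).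
Hypothesis hY : generalized_function Y.

Lemma measurable_gf x : measurable_fun setT (Y x : T -> R).
Proof. exact: measurable_funP. Qed.

Lemma gf0 : {ae mu, forall t, Y 0 t = 0}.
Proof.
have := hY.1 1 0 0; apply: filterS => t; rewrite scaler0 addr0 mul1r => h.
by apply/eqP; rewrite -(inj_eq (addrI (Y 0 t))) addr0 -h.
Qed.

Lemma gfZ a x : {ae mu, forall t, Y (a *: x) t = a * Y x t}.
Proof.
have h1 := gf0; have h2 := hY.1 a x 0; near=> t.
have -> : a *: x = a *: x + 0 by rewrite addr0.
have -> : Y (a *: x + 0) t = a * Y x t + Y 0 t by near: t.
have -> : Y 0 t = 0 by near: t.
by rewrite addr0.
Unshelve. all: by end_near. Qed.

Lemma gf_sum (c : nat -> R) (e : nat -> H) N :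
  {ae mu, forall t, Y (\sum_(i < N) c i *: e i) t = \sum_(i < N) c i * Y (e i) t}.
Proof.
elim: N => [|N IH].
  by have := gf0; apply: filterS => t; rewrite !big_ord0.
have h := hY.1 (c N) (e N) (\sum_(i < N) c i *: e i).
near=> t; rewrite !big_ord_recr/= [in LHS]addrC.
have -> : Y (c N *: e N + \sum_(i < N) c i *: e i) t =
  c N * Y (e N) t + Y (\sum_(i < N) c i *: e i) t by near: t.
rewrite addrC; congr (_ + _); near: t; exact: IH.
Unshelve. all: by end_near. Qed.

Lemma measurable_coords (e : nat -> H) : measurable_fun setT (coords e Y).
Proof. by apply: measurable_to_Rinf => n; exact: measurable_gf. Qed.

End generalized_function.

Section orthonormal.
Context (R : realType) (H : completeNormedModType R)
    (dot : {dot H for (idfun : R -> R)}) (e : nat -> H).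
Hypothesis hdot : hilbert_dot dot.
Hypothesis he : orthonormal_basis dot e.

Lemma norm_sum_basis (c : nat -> R) N :
  `|\sum_(i < N) c i *: e i| ^+ 2 = \sum_(i < N) c i ^+ 2.
Proof.
rewrite hdot linear_sumlz; apply: eq_bigr => i _.
rewrite linearZl_LR linear_sumr /= (bigD1 i)//= linearZr_LR/= he.1 eqxx mulr1.
rewrite big1 ?addr0 ?expr2// => j ji.
have ij : (i == j :> nat) = false by rewrite eq_sym; exact: negbTE.
by rewrite linearZr_LR/= he.1 ij mulr0.
Qed.

End orthonormal.

(** * The law of the coordinates of a standard Gaussian *)

Section coord_law.
Context (R : realType) (H : completeNormedModType R) d (Omega : measurableType d)
  (P : probability Omega R) (e : nat -> H) (X : H -> {mfun_ P, Omega >-> R}).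

Definition coord_law : set (Rinf R) -> \bar R := pushforward P (coords e X).

HB.instance Definition _ := Measure.copy coord_law
  (image_measure (measurable_coords X e) P).

Let coord_lawT : coord_law setT = 1%E.
Proof. by rewrite /coord_law /pushforward preimage_setT probability_setT. Qed.

HB.instance Definition _ := Measure_isProbability.Build _ _ _ coord_law coord_lawT.

Lemma ge0_integral_coord_law (f : Rinf R -> \bar R) :
  measurable_fun setT f -> (forall x, 0 <= f x)%E ->
  (\int[coord_law]_x f x = \int[P]_w f (coords e X w))%E.
Proof. exact: (ge0_integral_image (measurable_coords X e)). Qed.

End coord_law.

Section linear_functionals.
Context (R : realType).

Definition lin_form (c : nat -> R) N (x : Rinf R) : R := \sum_(i < N) c i * x i.

Lemma measurable_lin_form c N : measurable_fun setT (lin_form c N).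
Proof.
by apply: measurable_sum => i; apply: measurable_funM => //; exact: measurable_coord.
Qed.

Lemma lin_form_pad c N M : (N <= M)%N ->
  lin_form c N = lin_form (fun i => if (i < N)%N then c i else 0) M.
Proof.
move=> NM; apply/funext => x; rewrite /lin_form.
rewrite (big_ord_widen M (fun i => c i * x i) NM) big_mkcond/=.
by apply: eq_bigr => i _; case: ifP => // _; rewrite mul0r.
Qed.

Definition lin_forms : set (Rinf R -> R) := [set l | exists c N, l = lin_form c N].

Lemma lin_formsD l l' : lin_forms l -> lin_forms l' -> lin_forms (fun x => l x + l' x).
Proof.
move=> [c [N ->]] [c' [N' ->]]; pose M := maxn N N'.
rewrite (lin_form_pad c (leq_maxl N N')) (lin_form_pad c' (leq_maxr N N')).
set b := (fun i => if (i < N)%N then c i else 0).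
set b' := (fun i => if (i < N')%N then c' i else 0).
exists (fun i => b i + b' i), M; apply/funext => x.
by rewrite /lin_form -big_split; apply: eq_bigr => i _; rewrite mulrDl.
Qed.

Lemma lin_formsZ a l : lin_forms l -> lin_forms (fun x => a * l x).
Proof.
move=> [c [N ->]]; exists (fun i => a * c i), N; apply/funext => x.
by rewrite /lin_form mulr_sumr; apply: eq_bigr => i _; rewrite mulrA.
Qed.

Lemma lin_forms0 : lin_forms (fun=> 0).
Proof. by exists (fun=> 0), 0%N; apply/funext => x; rewrite /lin_form big_ord0. Qed.

Lemma lin_forms_generate (A : set (Rinf R)) : measurable A ->
  <<s [set B | exists l c, lin_forms l /\ B = l @^-1` `]c, +oo[] >> A.
Proof.
set G := [set B | _].
apply: smallest_sub; first exact: smallest_sigma_algebra.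
move=> _ [n [B mB ->]].
suff : measurable_fun setT ((fun x => x n) : g_sigma_algebraType G -> measurableTypeR R).
  by move=> /(_ measurableT B mB); rewrite setTI.
apply: (measurability _ (RGenOInfty.measurableE R)) => //.
move=> _ [_ [c ->] <-]; rewrite setTI; apply: sub_sigma_algebra.
exists (lin_form (fun i => (i == n)%:R) n.+1), c; split; first by eexists; eexists.
apply/funext => x /=; rewrite /lin_form big_ord_recr/= eqxx mul1r big1 ?add0r// => i _.
by rewrite ltn_eqF ?mul0r.
Qed.

End linear_functionals.

Section gaussian_coordinates.
Context (R : realType) (H : completeNormedModType R)
    (dot : {dot H for (idfun : R -> R)}) (e : nat -> H)
    d (Omega : measurableType d) (P : probability Omega R)
    (X : H -> {mfun_ P, Omega >-> R}).
Hypothesis hdot : hilbert_dot dot.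
Hypothesis he : orthonormal_basis dot e.
Hypothesis hX : standard_gaussian X.

Lemma integral_gaussian_value (xi : H) (f : R -> \bar R) :
  measurable_fun setT f -> (forall x, 0 <= f x)%E ->
  (\int[P]_w f (X xi w) = \int[@std_gauss R]_z f (`|xi| * z)%R)%E.
Proof.
move=> mf f0; have mX := measurable_gf X xi.
have mz : measurable_fun setT (fun z : R => `|xi| * z) by exact: measurable_funM.
rewrite -(ge0_integral_image mX)// -(ge0_integral_image mz)//.
apply: eq_measure_integral => A mA _ /=.
by rewrite -[RHS]centered_gaussianE//; exact: hX.2.
Qed.

Lemma integral_lin_form c N (f : R -> \bar R) :
  measurable_fun setT f -> (forall x, 0 <= f x)%E ->
  (\int[coord_law e X]_x f (lin_form c N x) =
   \int[@std_gauss R]_z f (Num.sqrt (\sum_(i < N) c i ^+ 2) * z)%R)%E.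
Proof.
move=> mf f0; have ml := measurable_lin_form c N.
rewrite ge0_integral_coord_law//; last exact: measurableT_comp.
rewrite -(norm_sum_basis hdot he) sqrtr_sqr normr_id -integral_gaussian_value//.
apply: ge0_ae_eq_integral => //.
- apply: measurableT_comp => //; exact: (measurableT_comp ml (measurable_coords X e)).
- by apply: measurableT_comp => //; exact: measurable_gf.
- have := gf_sum hX.1 c e N; apply: filterS => w h _.
  by rewrite h.
Qed.

Lemma resample_coord n (x : Rinf R) y i :
  resample (fun x : Rinf R => x n) (coord_shift n) x y i = if i == n then y else x i.
Proof.
rewrite /resample; case: eqP => [->|/eqP ni]; first by rewrite coord_shiftE subrKC.
exact: coord_shift_neq.
Qed.

(** Resampling the n-th coordinate by an independent standard normal variable keeps
the law of each linear form sum c_i x_i: it is the centered normal law of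
variance sum c_i^2 before, because [X] is linear, and after, by
[gauss_combination].  The Cramer-Wold theorem then shows that resampling keeps
the law of all the coordinates. *)
Lemma coord_law_quasi_invariant n :
  quasi_invariant (fun x : Rinf R => x n) (coord_shift n) (coord_law e X).
Proof.
pose p (x : Rinf R) := x n.
have mp : measurable_fun setT p := measurable_coord n.
have mt := @measurable_coord_shift R n.
have pt c (x : Rinf R) : p (coord_shift n c x) = p x + c by exact: coord_shiftE.
apply: resample_quasi_invariant => //; first by move=> b c z; exact: coord_shiftD.
pose N := @std_gauss R.
have mr := measurable_resample mp mt.
pose m2 : {measure set (Rinf R) -> \bar R} := image_measure mr (coord_law e X \x N)%E.
have m2T : (m2 setT < +oo)%E.
  by rewrite /m2/= /image_measure /pushforward preimage_setT probability_setT ltry.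
have m2E (f : Rinf R -> \bar R) : measurable_fun setT f -> (forall x, 0 <= f x)%E ->
    (\int[m2]_x f x = \int[coord_law e X]_x \int[N]_y f (resample p (coord_shift n) x y))%E.
  move=> mf f0; rewrite ge0_integral_image// fubini_tonelli1//.
  exact: measurableT_comp.
suff E A : measurable A -> coord_law e X A = m2 A.
  by move=> f mf f0; rewrite -m2E//; apply: eq_measure_integral => A mA _; exact: E.
move=> mA; apply: (@cramer_wold _ _ _ (@lin_forms R) _ _ _ (coord_law e X) (as_finite m2T));
  [| | | | exact: lin_forms0 | exact: lin_forms_generate].
- by move=> _ [c [M ->]]; exact: measurable_lin_form.
- exact: lin_formsD.
- exact: lin_formsZ.
move=> _ [c [M ->]] B mB; rewrite (lin_form_pad c (leq_maxl M n.+1)).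
move: (fun i => if (i < M)%N then c i else 0) (maxn M n.+1) (leq_maxr M n.+1) => {c M mA A} c M nM.
pose f u := (\1_B u)%:E : \bar R.
have mf : measurable_fun setT f by exact/measurable_EFinP/measurable_indic.
have f0 u : (0 <= f u)%E by rewrite lee_fin.
have ml := measurable_lin_form c M.
have mlB : measurable (lin_form c M @^-1` B).
  by rewrite -[X in measurable X]setTI; exact: ml.
have mE (m : {measure set (Rinf R) -> \bar R}) :
    (m (lin_form c M @^-1` B) = \int[m]_x f (lin_form c M x))%E.
  transitivity (\int[m]_x (\1_(lin_form c M @^-1` B) x)%:E)%E.
    by rewrite integral_indic// setIT.
  by apply: eq_integral => x _; rewrite /f !indicE.
rewrite mE [RHS](mE m2) m2E//; last exact: measurableT_comp.
(* Splits the form into the part without x_n and the resampled term c_n y. *)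
pose c0 i := if i == n then 0 else c i.
transitivity (\int[coord_law e X]_x \int[N]_y f (lin_form c0 M x + c n * y)%R)%E; last first.
  apply: eq_integral => x _; apply: eq_integral => y _; congr f.
  rewrite /lin_form (bigD1 (Ordinal nM))//= /c0 eqxx mul0r add0r.
  rewrite [RHS](bigD1 (Ordinal nM))//= resample_coord eqxx addrC; congr (_ + _).
  apply: eq_bigr => i ni; rewrite resample_coord.
  by have -> : (i == n :> nat) = false by exact: negbTE.
rewrite (@integral_lin_form c0 M (fun u => \int[N]_y f (u + c n * y)%R)%E); last 2 first.
- apply: (@measurable_fun_fubini_tonelli_F _ _ R R R N (fun z : R * R => f (z.1 + c n * z.2))) => //.
  apply: measurableT_comp => //; apply: measurable_funD => //.
  by apply: measurable_funM => //; exact: measurable_snd.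
- by move=> u; exact: integral_ge0.
rewrite gauss_combination// sqr_sqrtr; last by apply: sumr_ge0 => i _; exact: sqr_ge0.
rewrite integral_lin_form//; apply: eq_integral => z _; congr (f (Num.sqrt _ * _)).
rewrite (bigD1 (Ordinal nM))//= [in RHS](bigD1 (Ordinal nM))//= /c0 eqxx expr0n add0r addrC.
congr (_ + _); apply: eq_bigr => i ni.
by have -> : (i == n :> nat) = false by exact: negbTE.
Qed.

End gaussian_coordinates.

(** * The Cameron-Martin theorem *)

Section borel_cantelli_ae.
Context (R : realType) d (T : measurableType d) (mu : {measure set T -> \bar R}).

(** By Borel-Cantelli: the measures 2^-k are summable and the tolerances 2^-k tend
to 0. *)
Lemma fast_cvg_in_measure_ae (f_ : nat -> T -> R) (f : T -> R) :
  (forall k, measurable_fun setT (f_ k)) -> measurable_fun setT f ->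
  (forall k, (mu [set t | (2^-1 ^+ k <= `|f_ k t - f t|)%R] <= (2^-1 ^+ k)%:E)%E) ->
  {ae mu, forall t, f_ k t @[k --> \oo] --> f t}.
Proof.
move=> mf_ mf H; pose F k := [set t | 2^-1 ^+ k <= `|f_ k t - f t|].
have mF k : measurable (F k).
  rewrite (_ : F k = (fun t => `|f_ k t - f t|) @^-1` `[2^-1 ^+ k, +oo[); last first.
    by apply/seteqP; split => t /=; rewrite /F/= in_itv/= andbT.
  rewrite -[X in measurable X]setTI.
  have : measurable_fun setT (fun t => `|f_ k t - f t|).
    by apply: measurableT_comp => //; exact: measurable_funB.
  by apply.
exists (lim_sup_set F); split.
- apply: bigcapT_measurable => n; exact: bigcup_measurable.
- apply: lim_sup_set_cvg0 => //.
  apply: (@le_lt_trans _ _ 2%:E); last by rewrite ltry.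
  apply: (@le_trans _ _ (\sum_(k <oo) (2^-1 ^+ k)%:E)%E).
    by apply: lee_nneseries => // k _; exact: H.
  rewrite (_ : (\sum_(k <oo) (2^-1 ^+ k)%:E)%E = 2%:E)//.
  apply/cvg_lim => //.
  have := @cvg_geometric_eseries_half R 2 0; rewrite expr0 divr1.
  rewrite (_ : eseries _ = fun n => (\sum_(0 <= k < n) (2^-1 ^+ k)%:E)%E)//.
  apply/funext => n; rewrite /eseries/=; apply: eq_bigr => k _; congr EFin.
  by rewrite addn1 natrX exprS invfM mulrA divff// mul1r exprVn.
move=> t /= nt; apply: contrapT => tF; apply: nt.
have [n Hn] : exists n, forall j, (n <= j)%N -> `|f_ j t - f t| < 2^-1 ^+ j.
  apply: contrapT => nH; apply: tF => n _; apply: contrapT => nF; apply: nH.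
  exists n => j nj; rewrite ltNge; apply/negP => h; apply: nF.
  by exists j.
have c0 : (2^-1 : R) ^+ k @[k --> \oo] --> 0.
  by apply: cvg_expr; rewrite ger0_norm//; lra.
apply/cvgrPdist_lt => eps eps0.
move/cvgrPdist_lt : c0 => /(_ _ eps0) c0; near=> k.
rewrite distrC (lt_trans (Hn k _))//; first by near: k; exists n.
have : `|0 - 2^-1 ^+ k| < eps by near: k.
by rewrite sub0r normrN ger0_norm// exprn_ge0.
Unshelve. all: by end_near. Qed.

End borel_cantelli_ae.

Section subsequence.
Context (R : realType) (H : completeNormedModType R) d (T : measurableType d)
  (mu : {measure set T -> \bar R}) (Y : H -> {mfun_ mu, T >-> R}).
Hypothesis hY : generalized_function Y.

Lemma gf_cvg_near (x_ : nat -> H) (x : H) : x_ n @[n --> \oo] --> x ->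
  forall k, exists N, forall n, (N <= n)%N ->
    (mu [set t | (2^-1 ^+ k <= `|Y (x_ n) t - Y x t|)%R] <= (2^-1 ^+ k)%:E)%E.
Proof.
move=> xx k; have p : 0 < 2^-1 ^+ k :> R by rewrite exprn_gt0.
have /xx [N _ HN] := hY.2 x (2^-1 ^+ k) (2^-1 ^+ k) p p.
by exists N => n Nn; apply/ltW/HN.
Qed.

End subsequence.

Section density_measure.
Context (R : realType) d (T : measurableType d) (m : {measure set T -> \bar R}).
Variables (g : T -> R) (mg : measurable_fun setT g) (g0 : forall x, 0 <= g x).

Definition density_measure of measurable_fun setT g & (forall x, 0 <= g x) :=
  fun A : set T => (\int[m]_(x in A) (g x)%:E)%E.

Let dm := density_measure mg g0.
Let dm0 : dm set0 = 0%E. Proof. by rewrite /dm /density_measure integral_set0. Qed.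
Let dm_ge0 A : (0 <= dm A)%E.
Proof. by apply: integral_ge0 => x _; rewrite lee_fin. Qed.
Let dm_sigma_additive : semi_sigma_additive dm.
Proof.
move=> F mF tF mUF; rewrite /dm /density_measure ge0_integral_bigcup//.
- by apply: is_cvg_ereal_nneg_natsum_cond => n _ _; exact: dm_ge0.
- by apply: measurable_funTS; exact/measurable_EFinP.
- by move=> x _; rewrite lee_fin.
Qed.

HB.instance Definition _ := isMeasure.Build _ _ _ (density_measure mg g0)
  dm0 dm_ge0 dm_sigma_additive.

End density_measure.

Section cameron_martin.
Context (R : realType) (H : completeNormedModType R)
    (dot : {dot H for (idfun : R -> R)}) (e : nat -> H)
    d (Omega : measurableType d) (P : probability Omega R)
    (X : H -> {mfun_ P, Omega >-> R}).
Hypothesis hdot : hilbert_dot dot.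
Hypothesis he : orthonormal_basis dot e.
Hypothesis hX : standard_gaussian X.
Let gamma : probability (Rinf R) R := coord_law e X.

Definition truncate N (b : nat -> R) : Rinf R := fun i => if (i < N)%N then b i else 0.

Definition cm_exponent (b : nat -> R) N (x : Rinf R) : R :=
  lin_form b N x - (\sum_(i < N) b i ^+ 2) / 2.

Lemma measurable_cm_exponent b N : measurable_fun setT (cm_exponent b N).
Proof. by apply: measurable_funB => //; exact: measurable_lin_form. Qed.

Lemma measurable_cm_truncated b N :
  measurable_fun setT (fun x => (expR (cm_exponent b N x))%:E).
Proof.
apply/measurable_EFinP/measurableT_comp => //; exact: measurable_cm_exponent.
Qed.

(** One coordinate at a time: the exponents of the first N coordinates are not
affected by a shift of the next one. *)
Lemma cameron_martin_truncate b N (f : Rinf R -> \bar R) :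
  measurable_fun setT f -> (forall x, 0 <= f x)%E ->
  (\int[gamma]_x f (add_seq x (truncate N b)) =
   \int[gamma]_x (f x * (expR (cm_exponent b N x))%:E))%E.
Proof.
elim: N f => [|N IH] f mf f0.
  apply: eq_integral => x _; rewrite /cm_exponent /lin_form !big_ord0 mul0r subr0.
  rewrite expR0 mule1; congr f.
  by apply/funext => i; rewrite /add_seq /truncate ltn0 addr0.
have ms : measurable_fun setT (@coord_shift R N (b N)).
  exact: (measurableT_comp (measurable_coord_shift N) (pair1_measurable (b N))).
transitivity (\int[gamma]_x f (coord_shift N (b N) (add_seq x (truncate N b))))%E.
  apply: eq_integral => x _; congr f; apply/funext => i.
  rewrite /coord_shift /add_seq /truncate ltnS leq_eqVlt [N == i]eq_sym.
  case: eqP => [->|_]/=; first by rewrite ltnn mulr1 addr0.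
  by rewrite mulr0 addr0.
transitivity (\int[gamma]_x
    (f (coord_shift N (b N) x) * (expR (cm_exponent b N x))%:E))%E.
  exact: (IH _ (measurableT_comp mf ms) (fun=> f0 _)).
have lE c x : lin_form b N (coord_shift N c x) = lin_form b N x.
  by apply: eq_bigr => i _; rewrite coord_shift_neq// ltn_eqF.
transitivity (\int[gamma]_x ((fun y => f y * (expR (cm_exponent b N y))%:E)
    (coord_shift N (b N) x)))%E.
  by apply: eq_integral => x _; rewrite /cm_exponent lE.
rewrite (coord_law_quasi_invariant hdot he hX N (b N)
  (f := fun y => f y * (expR (cm_exponent b N y))%:E)%E).
- apply: eq_integral => x _; rewrite -muleA -EFinM -expRD; congr (_ * (expR _)%:E)%E.
  rewrite /cm_exponent /lin_form !big_ord_recr/=; by field.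
- apply: emeasurable_funM => //; exact: measurable_cm_truncated.
- by move=> x; rewrite mule_ge0// lee_fin expR_ge0.
Qed.

End cameron_martin.

Section cameron_martin_general.
Context (R : realType) (H : completeNormedModType R)
    (dot : {dot H for (idfun : R -> R)}) (e : nat -> H)
    d (Omega : measurableType d) (P : probability Omega R)
    (X : H -> {mfun_ P, Omega >-> R})
    d' (T : measurableType d') (mu : {measure set T -> \bar R})
    (Y : H -> {mfun_ mu, T >-> R}).
Hypothesis hdot : hilbert_dot dot.
Hypothesis he : orthonormal_basis dot e.
Hypothesis hX : standard_gaussian X.
Hypothesis hY : generalized_function Y.
Let gamma : probability (Rinf R) R := coord_law e X.

Variable xi : H.
Let b : Rinf R := fun n => dot xi (e n).
Let proj N : H := \sum_(i < N) b i *: e i.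

Let cvg_proj : proj N @[N --> \oo] --> xi.
Proof.
have := he.2 xi; rewrite /series/=.
by under eq_fun do rewrite big_mkord.
Qed.

(** A single subsequence serves [X] and [Y], so that X(xi) and Y(xi) are almost surely
limits of the same functions of the coordinates. *)
Lemma fast_subsequence : exists N_ : nat -> nat, [/\ (forall k, (k <= N_ k)%N),
  {ae P, forall w, X (proj (N_ k)) w @[k --> \oo] --> X xi w} &
  {ae mu, forall t, Y (proj (N_ k)) t @[k --> \oo] --> Y xi t}].
Proof.
have /choice[NX HX] := gf_cvg_near hX.1 cvg_proj.
have /choice[NY HY] := gf_cvg_near hY cvg_proj.
exists (fun k => maxn k (maxn (NX k) (NY k))); split.
- by move=> k; exact: leq_maxl.
- apply: fast_cvg_in_measure_ae => [k||k]; [exact: measurable_gf|exact: measurable_gf|].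
  by apply: HX; rewrite !leq_max leqnn orbT.
- apply: fast_cvg_in_measure_ae => [k||k]; [exact: measurable_gf|exact: measurable_gf|].
  by apply: HY; rewrite !leq_max leqnn !orbT.
Qed.

Let N_ := sval (cid fast_subsequence).
Let N_ge k : (k <= N_ k)%N. Proof. by have [] := svalP (cid fast_subsequence). Qed.
Let X_cvg : {ae P, forall w, X (proj (N_ k)) w @[k --> \oo] --> X xi w}.
Proof. by have [] := svalP (cid fast_subsequence). Qed.
Let Y_cvg : {ae mu, forall t, Y (proj (N_ k)) t @[k --> \oo] --> Y xi t}.
Proof. by have [] := svalP (cid fast_subsequence). Qed.

(** The density exp(<x, xi> - |xi|^2/2) as a function on the sequence space, where
<x, xi> only makes sense as an almost sure limit; the upper limit makes it a
measurable function everywhere. *)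
Definition cm_density (x : Rinf R) : R :=
  fine (limn_esup (fun k => (expR (cm_exponent b (N_ k) x))%:E)).

Lemma measurable_cm_density : measurable_fun setT cm_density.
Proof.
apply: measurableT_comp => //; apply: measurable_fun_limn_esup => k.
exact: measurable_cm_truncated.
Qed.

Lemma cm_density_ge0 x : 0 <= cm_density x.
Proof.
apply: fine_ge0; rewrite limn_esup_lim; apply: lime_ge; first exact: is_cvg_esups.
apply: nearW => n; apply: (@le_trans _ _ ((expR (cm_exponent b (N_ n) x))%:E)).
  by rewrite lee_fin expR_ge0.
by apply: ereal_sup_ubound; exists n => /=.
Qed.

Let cvg_sqnorm : \sum_(i < N_ k) b i ^+ 2 @[k --> \oo] --> `|xi| ^+ 2.
Proof.
have N_oo : N_ k @[k --> \oo] --> \oo.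
  move=> A [m _ mA]; exists m => // k /= mk; apply: mA => /=.
  exact: leq_trans mk (N_ge k).
under eq_fun do rewrite -(norm_sum_basis hdot he).
have h : `|proj (N_ k)| @[k --> \oo] --> `|xi|.
  have hp : proj (N_ k) @[k --> \oo] --> xi by exact: (cvg_comp _ _ N_oo cvg_proj).
  exact: cvg_norm hp.
by under eq_fun do rewrite expr2; rewrite expr2; exact: cvgM.
Qed.

Lemma cvg_cm_exponent (x : Rinf R) (l : R) :
  lin_form b (N_ k) x @[k --> \oo] --> l ->
  expR (cm_exponent b (N_ k) x) @[k --> \oo] --> expR (l - `|xi| ^+ 2 / 2) /\
  cm_density x = expR (l - `|xi| ^+ 2 / 2).
Proof.
move=> xl.
have c : expR (cm_exponent b (N_ k) x) @[k --> \oo] --> expR (l - `|xi| ^+ 2 / 2).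
  apply: continuous_cvg; first exact: continuous_expR.
  by apply: cvgB => //; apply: cvgMl; exact: cvg_sqnorm.
split=> //; rewrite /cm_density.
have c' : (expR (cm_exponent b (N_ k) x))%:E @[k --> \oo] -->
    (expR (l - `|xi| ^+ 2 / 2))%:E.
  by apply: cvg_EFin => //; exact: nearW.
by rewrite is_cvg_limn_esupE ?(cvg_lim _ c')//; apply/cvg_ex; eexists; exact: c'.
Qed.

Lemma lin_form_coords_cvg : {ae P, forall w,
  lin_form b (N_ k) (coords e X w) @[k --> \oo] --> X xi w}.
Proof.
have h := ae_foralln (fun k => gf_sum hX.1 b e (N_ k)).
move: X_cvg h; apply: filterS2 => w + hw.
by under eq_fun do rewrite /proj hw.
Qed.

Lemma lin_form_coordsY_cvg : {ae mu, forall t,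
  lin_form b (N_ k) (coords e Y t) @[k --> \oo] --> Y xi t}.
Proof.
have h := ae_foralln (fun k => gf_sum hY b e (N_ k)).
move: Y_cvg h; apply: filterS2 => w + hw.
by under eq_fun do rewrite /proj hw.
Qed.

Lemma cm_density_coords : {ae P, forall w,
  cm_density (coords e X w) = expR (X xi w - `|xi| ^+ 2 / 2)}.
Proof.
by move: lin_form_coords_cvg; apply: filterS => w /cvg_cm_exponent[].
Qed.

(** Along the subsequence <X + Y(t), xi> is the sum of the limits <X, xi> and
<Y(t), xi>. *)
Lemma cm_density_shift : {ae mu, forall t, {ae P, forall w,
  cm_density (add_seq (coords e X w) (coords e Y t)) =
  cm_density (coords e X w) * expR (Y xi t)}}.
Proof.
move: lin_form_coordsY_cvg; apply: filterS => t Yt.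
move: lin_form_coords_cvg; apply: filterS => w Xw.
have [_ ->] := cvg_cm_exponent Xw.
have h : lin_form b (N_ k) (add_seq (coords e X w) (coords e Y t)) @[k --> \oo] -->
    X xi w + Y xi t.
  rewrite (_ : (fun k => _) = fun k => lin_form b (N_ k) (coords e X w) +
    lin_form b (N_ k) (coords e Y t)); first exact: cvgD.
  apply/funext => k; rewrite /lin_form -big_split/=.
  by apply: eq_bigr => i _; rewrite -mulrDr.
have [_ ->] := cvg_cm_exponent h.
by rewrite -expRD; congr expR; ring.
Qed.

Let me N : measurable_fun setT (fun x => (expR (cm_exponent b N x))%:E) :=
  measurable_cm_truncated b N.
Let mb : measurable_fun setT (fun x : Rinf R => add_seq x b).
Proof. by apply: measurable_add_seq. Qed.
Let mW : measurable_fun setT (fun x => (cm_density x)%:E).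
Proof. by apply/measurable_EFinP; exact: measurable_cm_density. Qed.

(* The two sides of the Cameron-Martin formula, both of mass 1. *)
Let nu1 : {measure set (Rinf R) -> \bar R} := image_measure mb gamma.
Let nu2 : {measure set (Rinf R) -> \bar R} :=
  density_measure gamma measurable_cm_density cm_density_ge0.

Let nu1T : nu1 setT = 1%E.
Proof. by rewrite /nu1/= /image_measure /pushforward preimage_setT probability_setT. Qed.

Let nu2T : nu2 setT = 1%E.
Proof.
rewrite /nu2/= /density_measure ge0_integral_coord_law//; last first.
  by move=> x; rewrite lee_fin cm_density_ge0.
pose f (z : R) := (expR (z - `|xi| ^+ 2 / 2))%:E.
have mf : measurable_fun setT f.
  by apply/measurable_EFinP/measurableT_comp => //; exact: measurable_funB.
transitivity (\int[P]_w f (X xi w))%E.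
  apply: ge0_ae_eq_integral => //.
  - exact: (measurableT_comp mW (measurable_coords X e)).
  - by apply: (measurableT_comp mf); exact: measurable_gf.
  - by move=> w _; rewrite lee_fin cm_density_ge0.
  - by move=> w _; rewrite lee_fin expR_ge0.
  - by move: cm_density_coords; apply: filterS => w h _; rewrite /f h.
rewrite (integral_gaussian_value hX)//; last by move=> z; rewrite lee_fin expR_ge0.
have := gauss_shift `|xi| (f := fun=> 1%E) (measurable_cst 1%E) (fun=> lee01).
rewrite integral_probability_cst => ->.
by apply: eq_integral => z _; rewrite mul1e.
Qed.

(* Fatou's lemma along the subsequence gives one inequality on cylinders, where the
   shifts by b and by its truncations beyond K coincide. *)
Let nu21 K (A : set (Rinf R)) : measurable A ->
  (forall x y : Rinf R, (forall i, (i < K)%N -> x i = y i) -> A x -> A y) ->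
  (nu2 A <= nu1 A)%E.
Proof.
move=> mA AK; pose f x : \bar R := (\1_A x)%:E.
have mf : measurable_fun setT f by exact/measurable_EFinP/measurable_indic.
have f0 x : (0 <= f x)%E by rewrite lee_fin.
pose g k x := (f x * (expR (cm_exponent b (N_ k) x))%:E)%E.
have g0 k x : (0 <= g k x)%E by rewrite mule_ge0// lee_fin expR_ge0.
have mg k : measurable_fun setT (g k) by exact: emeasurable_funM.
have -> : nu2 A = (\int[P]_w (f (coords e X w) * (cm_density (coords e X w))%:E))%E.
  rewrite /nu2/= /density_measure integral_mkcond.
  rewrite -(@ge0_integral_coord_law _ _ _ _ _ _ _ (fun x => f x * (cm_density x)%:E)%E).
  - apply: eq_integral => x _; rewrite patchE /f indicE.
    by case: ifP => _; rewrite ?mul1e ?mul0e.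
  - exact: emeasurable_funM.
  - by move=> x; rewrite mule_ge0// lee_fin cm_density_ge0.
have -> : (\int[P]_w (f (coords e X w) * (cm_density (coords e X w))%:E) =
    \int[P]_w limn_einf (fun k => g k (coords e X w)))%E.
  apply: ge0_ae_eq_integral => //.
  - apply: (measurableT_comp (f := fun x => f x * (cm_density x)%:E)%E); last exact: measurable_coords.
    exact: emeasurable_funM.
  - apply: (emeasurable_fun_cvg (fun n w => einfs (fun k => g k (coords e X w)) n)).
      move=> n; apply: (measurable_fun_einfs (f := fun k w => g k (coords e X w))) => k.
      exact: (measurableT_comp (mg k) (measurable_coords X e)).
    by move=> w _; rewrite limn_einf_lim; exact: is_cvg_einfs.
  - by move=> w _; rewrite mule_ge0// lee_fin cm_density_ge0.
  - move=> w _; rewrite limn_einf_lim; apply: lime_ge; first exact: is_cvg_einfs.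
    by apply: nearW => n; apply: le_ereal_inf_tmp => _ [m /= _ <-]; exact: g0.
  - move: lin_form_coords_cvg; apply: filterS => w /cvg_cm_exponent[c ->] _.
    apply/esym; rewrite is_cvg_limn_einfE; last first.
      apply/cvg_ex; eexists; rewrite /g; apply: cvgeZl => //.
      by apply: cvg_EFin; [exact: nearW|exact: c].
    apply/cvg_lim => //; apply: cvgeZl => //.
    by apply: cvg_EFin; [exact: nearW|exact: c].
apply: (le_trans (fatou P measurableT _ _)).
- by move=> k; exact: (measurableT_comp (mg k) (measurable_coords X e)).
- by move=> k w _.
rewrite limn_einf_lim; apply: lime_le; first exact: is_cvg_einfs.
apply: nearW => k.
apply: (@le_trans _ _ (\int[P]_w g (maxn k K) (coords e X w))%E).
  by apply: ereal_inf_lbound; exists (maxn k K) => //=; exact: leq_maxl.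
rewrite -(ge0_integral_coord_law e X (f := g (maxn k K)))//.
rewrite -(cameron_martin_truncate hdot he hX)//.
rewrite le_eqVlt; apply/orP; left; apply/eqP.
transitivity (\int[gamma]_x f (add_seq x b))%E.
  apply: eq_integral => x _; rewrite /f !indicE; congr (_%:R)%:E; congr nat_of_bool.
  have AE i : (i < K)%N -> add_seq x (truncate (N_ (maxn k K)) b) i = add_seq x b i.
    move=> iK; rewrite /add_seq /truncate ifT//.
    by apply: (leq_trans iK); apply: leq_trans (N_ge _); exact: leq_maxr.
  by apply/idP/idP => /set_mem h; apply/mem_set; apply: AK h => i iK; rewrite AE.
rewrite -(ge0_integral_image mb)// integral_indic// setIT//.
Qed.

(** The inequality [nu2 <= nu1] on cylinders, applied to a cylinder and to its
complement, is an equality since both measures have mass 1. *)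
Theorem cameron_martin (f : Rinf R -> \bar R) :
  measurable_fun setT f -> (forall x, 0 <= f x)%E ->
  (\int[gamma]_x f (add_seq x b) = \int[gamma]_x (f x * (cm_density x)%:E))%E.
Proof.
move=> mf f0.
rewrite -(ge0_integral_image mb)// -(ge0_integral_density (nu := nu2)
   measurable_cm_density cm_density_ge0)//.
pose cyl := [set A : set (Rinf R) | measurable A /\ exists K,
  forall x y : Rinf R, (forall i, (i < K)%N -> x i = y i) -> A x -> A y].
apply: eq_measure_integral => A mA _.
apply: (@measure_unique _ _ _ cyl (fun=> setT) _ _ _ _ nu1 nu2) => //.
- apply/seteqP; split => B.
    apply: smallest_sub; first exact: smallest_sigma_algebra.
    move=> _ [n [C mC ->]]; apply: sub_sigma_algebra; split.
      by rewrite -[X in measurable X]setTI; exact: measurable_coord.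
    by exists n.+1 => x y xy /=; rewrite xy.
  apply: smallest_sub; first exact: sigma_algebra_measurable.
  by move=> ? [].
- move=> B C [mB [K BK]] [mC [K' CK']]; split; first exact: measurableI.
  exists (maxn K K') => x y xy [Bx Cx]; split.
    by apply: BK Bx => i iK; apply: xy; rewrite leq_max iK.
  by apply: CK' Cx => i iK; apply: xy; rewrite leq_max iK orbT.
- by move=> _; split => //; exists 0%N.
- by apply/seteqP; split => // x _; exists 0%N.
- move=> B [mB [K BK]]; apply/eqP; rewrite eq_le (nu21 mB BK) andbT.
  have mBc := measurableC mB.
  have BcK x y : (forall i, (i < K)%N -> x i = y i) -> (~` B) x -> (~` B) y.
    by move=> xy nBx By; apply: nBx; apply: BK By => i iK; rewrite xy.
  have := nu21 mBc BcK.
  have split1 (nu : {measure set (Rinf R) -> \bar R}) : nu setT = 1%E ->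
      nu (~` B) = (1 - nu B)%E /\ nu B \is a fin_num.
    move=> nuT; have nuB : nu B \is a fin_num.
      rewrite ge0_fin_numE// (@le_lt_trans _ _ 1%E) ?ltry// -nuT.
      by apply: le_measure; rewrite ?inE.
    split => //; rewrite -nuT -(setvU B) measureU//; last by rewrite setICl.
    by rewrite addeK.
  have [-> f1] := split1 _ nu1T; have [-> f2] := split1 _ nu2T.
  rewrite -(fineK f1) -(fineK f2) -!EFinB !lee_fin; lra.
- by move=> _; rewrite nu1T ltry.
Qed.

End cameron_martin_general.

(** * Coding standard spaces by real numbers *)

Section ternary_coding.
Context (R : realType).

(** Base 3 with the digits 0 and 2 only, so that the digits can be read back without
ambiguity. *)
Fixpoint ternary_sum (n : nat) (b : nat -> bool) : R :=
  if n is m.+1 then (2 * (b 0%N)%:R + ternary_sum m (fun i => b i.+1)) / 3 else 0.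

Lemma ternary_sum_itv n b : 0 <= ternary_sum n b <= 1.
Proof.
elim: n b => [|n IH] b /=; first by rewrite lexx ler01.
have /andP[h0 h1] := IH (fun i => b i.+1).
have b0 : 0 <= (b 0%N)%:R :> R by rewrite ler0n.
have b1 : (b 0%N)%:R <= 1 :> R by rewrite lern1 leq_b1.
apply/andP; split; lra.
Qed.

Lemma ternary_sum_nd b : nondecreasing_seq (ternary_sum ^~ b).
Proof.
apply/nondecreasing_seqP => n; elim: n b => [|n IH] b.
  by case/andP: (ternary_sum_itv 1 b).
by move: (IH (fun i => b i.+1)) => /=; lra.
Qed.

Definition ternary (b : nat -> bool) : R := limn (ternary_sum ^~ b).

Lemma cvg_ternary b : ternary_sum n b @[n --> \oo] --> ternary b.
Proof.
apply: nondecreasing_is_cvgn; first exact: ternary_sum_nd.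
by exists 1 => _ [n _ <-]; case/andP: (ternary_sum_itv n b).
Qed.

Lemma ternary_itv b : 0 <= ternary b <= 1.
Proof.
have c : cvgn (ternary_sum ^~ b) by apply/cvg_ex; eexists; exact: cvg_ternary.
apply/andP; split; [apply: limr_ge => //|apply: limr_le => //]; apply: nearW => n;
  by case/andP: (ternary_sum_itv n b).
Qed.

Lemma ternaryE b : ternary b = (2 * (b 0%N)%:R + ternary (fun i => b i.+1)) / 3.
Proof.
have h1 : ternary_sum n.+1 b @[n --> \oo] --> ternary b.
  by rewrite (cvg_shiftS (ternary_sum ^~ b)); exact: cvg_ternary.
apply: (cvg_unique _ h1) => //=.
by apply: cvgMl; apply: cvgD; [exact: cvg_cst|exact: cvg_ternary].
Qed.

Definition lead_digit (y : R) : bool := 2 / 3 <= y.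
Definition ternary_tail (y : R) : R := 3 * y - 2 * (lead_digit y)%:R.
Definition digit (i : nat) (y : R) : bool := lead_digit (iter i ternary_tail y).

Lemma lead_digit_ternary b : lead_digit (ternary b) = b 0%N.
Proof.
rewrite /lead_digit ternaryE; have /andP[h0 h1] := ternary_itv (fun i => b i.+1).
by case: (b 0%N); [apply/idP|apply/negbTE; rewrite -ltNge] => /=; lra.
Qed.

Lemma digit_ternary i b : digit i (ternary b) = b i.
Proof.
rewrite /digit; elim: i b => [|i IH] b; first exact: lead_digit_ternary.
rewrite iterSr -(IH (fun i => b i.+1)); congr (lead_digit (iter i ternary_tail _)).
by rewrite /ternary_tail lead_digit_ternary ternaryE; field.
Qed.

Lemma measurable_digit i : measurable_fun setT (digit i).
Proof.
have ml : measurable_fun setT lead_digit.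
  by apply: measurable_fun_ler.
have mb : measurable_fun setT (fun b : bool => b%:R : R) by [].
have mt : measurable_fun setT ternary_tail.
  apply: measurable_funB; apply: measurable_funM => //.
  exact: (measurableT_comp mb ml).
suff mi : measurable_fun setT (fun y => iter i ternary_tail y).
  exact: (measurableT_comp ml mi).
elim: i => [|i IH]; first exact: measurable_id.
exact: (measurableT_comp mt IH).
Qed.

Lemma measurable_ternary d (T : measurableType d) (b : T -> nat -> bool) :
  (forall i, measurable_fun setT (fun t => b t i)) ->
  measurable_fun setT (fun t => ternary (b t)).
Proof.
move=> mb; apply: (measurable_fun_cvg (h := fun n t => ternary_sum n (b t))); last first.
  by move=> t _; exact: cvg_ternary.
move=> n; elim: n b mb => [|n IH] b mb //=.
apply: measurable_funM => //; apply: measurable_funD; last exact: IH.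
apply: measurable_funM => //.
have mb' : measurable_fun setT (fun b : bool => b%:R : R) by [].
exact: (measurableT_comp mb' (mb 0%N)).
Qed.

End ternary_coding.

Section polish.
Context (R : realType) (Z : completePseudoMetricType R).
Hypothesis Zhaus : hausdorff_space Z.

(** Closures of the balls of radii 1 / (n + 1) around the points of a dense sequence. *)
Lemma closed_countable_base (D : set Z) : countable D -> dense D ->
  exists C : nat -> set Z, (forall j, closed (C j)) /\
    (forall U z, open U -> U z -> exists j, C j z /\ C j `<=` U).
Proof.
move=> /countable_injP[f finj] dD.
have /choice[c Hc] : forall k, exists z, forall z', D z' -> f z' = k -> z = z'.
  move=> k; have [[z [Dz fz]]|h] := pselect (exists z, D z /\ f z = k).
    by exists z => z' Dz' fz'; apply: finj; rewrite ?inE// fz fz'.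
  by exists point => z' Dz' fz'; exfalso; apply: h; exists z'.
have cD z (r : R) : 0 < r -> exists k, ball (c k) r z.
  move=> r0; have [||z' [/= bz' Dz']] := dD (ball z r)^°.
  - by exists z; apply: nbhsx_ballx.
  - exact: open_interior.
  exists (f z'); rewrite (Hc _ z')//; apply: ball_sym.
  exact: interior_subset bz'.
pose idx (j : nat) : nat * nat := odflt (0, 0)%N (unpickle j).
exists (fun j => closure (ball (c (idx j).1) ((idx j).2.+1%:R^-1))); split.
  by move=> j; exact: closed_closure.
move=> U z oU Uz.
have /nbhs_ballP[r /= r0 rU] : nbhs z U by exact: open_nbhs_nbhs.
have r3 : 0 < r / 3 by rewrite divr_gt0.
pose n := Num.truncn (r / 3)^-1.
have nr : n.+1%:R^-1 < r / 3.
  by rewrite -[ltRHS]invrK ltf_pV2 ?posrE ?invr_gt0// truncnS_gt.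
have n0 : 0 < n.+1%:R^-1 :> R by rewrite invr_gt0.
have [k bk] := cD z _ n0.
exists (pickle (k, n)); rewrite /idx pickleK/=; split.
  exact: subset_closure.
move=> y /(_ (ball y (n.+1%:R^-1)) (nbhsx_ballx _ _ n0))[w [bw yw]].
apply: rU; apply: (@le_ball _ _ _ (n.+1%:R^-1 + (n.+1%:R^-1 + n.+1%:R^-1))).
  by move: (n.+1%:R^-1) nr => x xr; lra.
apply: (ball_triangle (ball_sym bk)); apply: (ball_triangle bw).
exact: ball_sym.
Qed.

Variable C : nat -> set Z.
Hypothesis Ccl : forall j, closed (C j).
Hypothesis Cbase : forall U z, open U -> U z -> exists j, C j z /\ C j `<=` U.

Definition small (n j : nat) := exists x : Z, C j `<=` ball x n.+1%:R^-1.

Definition small_union n N := \bigcup_(j in [set j | (j < N)%N /\ small n j]) C j.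

Lemma small_union_cover n z : exists N, small_union n N z.
Proof.
have n0 : 0 < n.+1%:R^-1 :> R by rewrite invr_gt0.
have [j [Cz Cj]] := Cbase (open_interior (ball z n.+1%:R^-1)) (nbhsx_ballx _ _ n0).
exists j.+1, j => //; split => //; exists z.
by apply: (subset_trans Cj); exact: interior_subset.
Qed.

Lemma closed_bigcup_lt (P : set nat) N :
  closed (\bigcup_(j in [set j | (j < N)%N /\ P j]) C j).
Proof.
apply: closed_bigcup => [|j _]; last exact: Ccl.
apply: (@sub_finite_set _ _ `I_N) => // j [] //.
Qed.

(** Total boundedness and completeness: an ultrafilter on this set contains, for each
n, a set [C j] included in a ball of radius 1 / (n + 1), hence is Cauchy. *)
Lemma compact_small_bigcap (f : nat -> nat) :
  compact (\bigcap_n small_union n (f n)).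
Proof.
set K := \bigcap_n _.
have Kcl : closed K by apply: closed_bigI => n _; exact: closed_bigcup_lt.
rewrite compact_ultra => F FU FK.
have Fn n : exists j, small n j /\ F (C j).
  apply: contrapT => nF.
  have {}nF j : small n j -> F (~` C j).
    move=> sj; have [FC|//] := in_ultra_setVsetC (C j) FU.
    by exfalso; apply: nF; exists j.
  have H N : F (~` small_union n N).
    elim: N => [|N IH].
      by apply: filterS filterT => z _ [j []].
    have [sN|sN] := pselect (small n N).
      apply: filterS (filterI IH (nF N sN)) => z [h1 h2] [j [jN sj] Cj].
      move: jN; rewrite ltnS leq_eqVlt => /predU1P[E|jN].
        by apply: h2; rewrite -E.
      by apply: h1; exists j.
    apply: filterS IH => z h [j [jN sj] Cj]; apply: h; exists j => //; split=> //.
    by move: jN; rewrite ltnS leq_eqVlt => /predU1P[E|//]; move: sN; rewrite -E.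
  have /filter_ex[z []] : F (K `&` ~` small_union n (f n)) by exact: filterI.
  by move=> /(_ n I).
have Fc : cvg F.
  apply: cauchy_cvg; apply: cauchy_exP => eps eps0.
  pose n := Num.truncn eps^-1.
  have ne : n.+1%:R^-1 <= eps.
    by rewrite ltW// -[ltRHS]invrK ltf_pV2 ?posrE ?invr_gt0// truncnS_gt.
  have [j [[x Cx] FC]] := Fn n.
  by exists x; apply: filterS FC => z /Cx; exact: le_ball.
exists (lim F); split => //; apply: Kcl => B nB.
have FB : F B by exact: Fc nB.
have /filter_ex[z [Kz Bz]] : F (K `&` B) by exact: filterI.
by exists z.
Qed.

Lemma compact_closed_family (K : set Z) (E : nat -> set Z) : compact K ->
  (forall i, closed (E i)) ->
  (forall n, exists z, K z /\ forall i, (i < n)%N -> E i z) ->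
  exists z, K z /\ forall i, E i z.
Proof.
move=> Kc Ecl /choice[z_ Hz].
have [|p [Kp cp]] := Kc (z_ n @[n --> \oo]) _ .
  by exists 0%N => // n _ /=; have [] := Hz n.
exists p; split => // i; apply: Ecl => B nB.
apply: (cp (E i) B _ nB); exists i.+1 => // n /= iN.
by have [_] := Hz n; apply.
Qed.

Lemma code_inj y z : (forall i, C i y <-> C i z) -> y = z.
Proof.
move=> yz; apply: contrapT => nyz.
have := Zhaus; rewrite open_hausdorff => /(_ y z) [|[U V] /=]; first exact/eqP.
move=> [/set_mem Uy /set_mem Vz] [oU oV /eqP UV].
have [j [Cy CU]] := Cbase oU Uy.
have := (yz j).1 Cy => /CU Uz.
by have : (U `&` V) z by []; rewrite UV.
Qed.

End polish.

Section borel.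
Context (R : realType) d (T : measurableType d).

(** Ulam's argument: [f i] is chosen so that [U i (f i)] misses a set of measure at
most eps / 2^(i+1). *)
Lemma finite_measure_small_bigcup (mu : {finite_measure set T -> \bar R})
    (U : nat -> nat -> set T) (eps : R) : 0 < eps ->
  (forall i N, measurable (U i N)) ->
  (forall i, nondecreasing_seq (U i)) ->
  (forall i t, exists N, U i N t) ->
  exists f : nat -> nat, (mu (~` \bigcap_i U i (f i)) <= eps%:E)%E.
Proof.
move=> eps0 mU ndU coverU.
have H i : exists N, (mu (~` U i N) <= (eps / (2 ^ i.+1)%:R)%:E)%E.
  have c : (fun N => mu (~` U i N)) @ \oo --> mu (\bigcap_N ~` U i N).
    apply: nonincreasing_cvg_mu.
    - by rewrite ltey_eq fin_num_measure//; exact: measurableC.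
    - by move=> N; exact: measurableC.
    - by apply: bigcapT_measurable => N; exact: measurableC.
    - move=> m n mn; apply/subsetPset; apply: subsetC; exact/subsetPset/ndU.
  have E0 : \bigcap_N ~` U i N = set0.
    apply/seteqP; split => // t Ut; have [N UN] := coverU i t.
    exact: (Ut N I).
  rewrite E0 measure0 in c.
  have p : 0 < eps / (2 ^ i.+1)%:R by rewrite divr_gt0// ltr0n expn_gt0.
  have /fine_cvgP[_] := c => /cvgrPdist_lt /(_ _ p)[N _ HN].
  exists N; have /= := HN N (leqnn N); rewrite sub0r normrN ger0_norm ?fine_ge0//.
  move=> h; rewrite -[leLHS]fineK ?lee_fin ?ltW// fin_num_measure//.
  exact: measurableC.
have /choice[f Hf] := H.
exists f; rewrite setC_bigcap.
have mUc i : measurable (~` U i (f i)) by exact: measurableC.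
apply: (@le_trans _ _ (\sum_(i <oo) mu (~` U i (f i)))%E).
  by apply: measure_sigma_subadditive => //; exact: bigcupT_measurable.
apply: (le_trans _ (epsilon_trick0 xpredT (ltW eps0))).
by apply: lee_nneseries => // i _; exact: Hf.
Qed.

End borel.

Section standard_coding.
Context (R : realType) d (T : measurableType d)
  (Z : completePseudoMetricType R) (h : T -> Z) (C : nat -> set Z).
Hypothesis Zhaus : hausdorff_space Z.
Hypothesis Ccl : forall j, closed (C j).
Hypothesis Cbase : forall U z, open U -> U z -> exists j, C j z /\ C j `<=` U.
Hypothesis hinj : injective h.
Hypothesis hsurj : forall z, exists t, h t = z.
Hypothesis hmeas : forall A : set T, measurable A <->
  exists2 B : set Z, <<s [set U : set Z | open U] >> B & A = h @^-1` B.

Let A i := h @^-1` C i.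

Let mC B : closed B -> measurable (h @^-1` B).
Proof.
move=> Bcl; apply/hmeas; exists B => //; rewrite -(setCK B).
by apply: (@measurableC _ (g_sigma_algebraType [set U : set Z | open U]));
  apply: sub_sigma_algebra; exact: closed_openC.
Qed.

Let mA i : measurable (A i). Proof. exact: mC. Qed.

Lemma coding_generates (B : set T) : measurable B -> <<s range A >> B.
Proof.
move=> /hmeas[B' + ->]; pose S := g_sigma_algebraType (range A).
move: B'; apply: smallest_sub.
  split.
  - by rewrite /= preimage_set0; exact: sigma_algebra0.
  - by move=> B' /= HB; rewrite setTD; exact: (@measurableC _ S).
  - by move=> F HF /=; rewrite preimage_bigcup; exact: (@bigcupT_measurable _ S).
move=> U oU /=.
have -> : h @^-1` U = \bigcup_(j in [set j | C j `<=` U]) A j.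
  apply/seteqP; split => [t /= Ut|t [j CU] Ajt]; last exact: CU.
  by have [j [Cj CU]] := Cbase oU Ut; exists j.
apply: (@bigcup_measurable _ S) => j _; apply: sub_sigma_algebra.
by exists j.
Qed.

Definition code (t : T) (i : nat) : bool := `[< C i (h t) >].

(** Base 3 expansion of the sequence of the memberships of [h t] in the sets [C i]. *)
Definition coding (t : T) : R := ternary R (code t).

Lemma measurable_coding : measurable_fun setT coding.
Proof.
apply: measurable_ternary => i.
apply: (measurable_fun_bool true); rewrite setTI.
rewrite (_ : _ @^-1` _ = A i)//; apply/seteqP; split => t /=.
  by move=> /asboolP.
by move=> Ct; apply/asboolP.
Qed.

Lemma coding_preimage (B : set T) : measurable B ->
  exists2 D : set R, measurable D & B = coding @^-1` D.
Proof.
move=> /coding_generates; move: B; apply: smallest_sub.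
  split.
  - by exists set0; rewrite ?preimage_set0.
  - move=> _ [D mD ->]; exists (~` D); first exact: measurableC.
    by rewrite setTD.
  - move=> F /= HF; have /choice[D HD] : forall i, exists D : set R,
        measurable D /\ F i = coding @^-1` D.
      by move=> i; have [D mD ->] := HF i; exists D.
    exists (\bigcup_i D i); first by apply: bigcupT_measurable => i; have [] := HD i.
    rewrite preimage_bigcup; apply: eq_bigcupr => i _; exact: (HD i).2.
move=> _ [i _ <-]; exists (digit i @^-1` [set true]).
  by rewrite -[X in measurable X]setTI; exact: (@measurable_digit R i).
apply/seteqP; split => t /=; rewrite digit_ternary.
  by move=> Ct; apply/asboolP.
by move=> /asboolP.
Qed.

Section decode.
Variable mu : {finite_measure set T -> \bar R}.

(** Closed approximations from inside of the complement of [C i], by the sets of the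
base that do not meet it. *)
Definition apart i N := \bigcup_(j in [set j | (j < N)%N /\ C j `<=` ~` C i]) C j.

(** Up to measure eps, [h t] lies in a compact set and each of its digits is certified
by a closed condition: [C i], or the closed set [apart i (g i)] disjoint from it. *)
Lemma tight_family (eps : R) : 0 < eps -> exists f g : nat -> nat,
  (mu (~` [set t | (forall n, small_union C n (f n) (h t)) /\
      (forall i, C i (h t) \/ apart i (g i) (h t))]) <= eps%:E)%E.
Proof.
move=> eps0; have e2 : 0 < eps / 2 by rewrite divr_gt0.
have mbig (P : set nat) N : measurable (h @^-1` (\bigcup_(j in [set j | (j < N)%N /\ P j]) C j)).
  by apply: mC; exact: closed_bigcup_lt.
have ndbig (P : set nat) : nondecreasing_seq
    (fun N => h @^-1` (\bigcup_(j in [set j | (j < N)%N /\ P j]) C j)).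
  move=> m n mn; apply/subsetPset => t [j [jm Pj] Cj]; exists j => //; split => //.
  exact: leq_trans jm mn.
have [f Hf] := @finite_measure_small_bigcup _ _ _ mu
  (fun n N => h @^-1` small_union C n N) _ e2 (fun n N => mbig _ _) (fun n => ndbig _)
  (fun n t => small_union_cover Cbase n (h t)).
have [||i t|g Hg] := @finite_measure_small_bigcup _ _ _ mu
  (fun i N => A i `|` h @^-1` apart i N) _ e2.
- by move=> i N; apply: measurableU => //; exact: mbig.
- move=> i m n mn; apply/subsetPset; apply: setUS; apply/subsetPset.
  exact: ndbig mn.
- have [Ct|nCt] := pselect (C i (h t)); first by exists 0%N; left.
  have [j [Cj CC]] := Cbase (closed_openC (@Ccl i)) nCt.
  by exists j.+1; right; exists j.
exists f, g.
have -> : [set t | (forall n, small_union C n (f n) (h t)) /\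
      (forall i, C i (h t) \/ apart i (g i) (h t))] =
    (\bigcap_n (h @^-1` small_union C n (f n))) `&`
    (\bigcap_i (A i `|` h @^-1` apart i (g i))).
  apply/seteqP; split => t /=.
    by move=> [H1 H2]; split => [n _|i _]; [exact: H1|exact: H2].
  by move=> [H1 H2]; split => [n|i]; [exact: (H1 n I)|exact: (H2 i I)].
rewrite setCI; apply: (le_trans (measureU2 _ _ _)).
- by apply: measurableC; apply: bigcapT_measurable => n; exact: mbig.
- apply: measurableC; apply: bigcapT_measurable => i; apply: measurableU => //.
  exact: mbig.
- by rewrite [eps]splitr EFinD leeD.
Qed.

(* The closed condition that certifies the value b of the i-th digit. *)
Let E (g : nat -> nat) (b : bool) i : set Z := if b then C i else apart i (g i).

(* The reals whose first n digits are certified by a common point of K. *)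
Let codes (K : set Z) (g : nat -> nat) n := [set y : R | exists z, K z /\
  forall i, (i < n)%N -> E g (digit i y) i z].

Let measurable_codes K g n : measurable (codes K g n).
Proof.
elim: n K => [|n IH] K.
  have [K0|K0] := pselect (exists z, K z).
    rewrite (_ : codes K g 0 = setT)//; apply/seteqP; split => // y _.
    by have [z Kz] := K0; exists z.
  rewrite (_ : codes K g 0 = set0)//; apply/seteqP; split => // y [z [Kz _]].
  by apply: K0; exists z.
rewrite (_ : codes K g n.+1 =
  (digit n @^-1` [set true] `&` codes (K `&` E g true n) g n) `|`
  (digit n @^-1` [set false] `&` codes (K `&` E g false n) g n)).
  by apply: measurableU; apply: measurableI => //;
    rewrite -[X in measurable X]setTI; exact: (@measurable_digit R n).
apply/seteqP; split => y.
  move=> [z [Kz Hz]].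
  have Ez := Hz n (ltnSn n).
  have Hz' i : (i < n)%N -> E g (digit i y) i z by move=> ni; apply: Hz; rewrite ltnS ltnW.
  by case Dy : (digit n y) Ez => Ez; [left|right]; split => //; exists z.
by case=> -[/= Dy [z [[Kz Ez] Hz]]]; exists z; split => // i;
  rewrite ltnS leq_eqVlt => /predU1P[->|]; [rewrite Dy|exact: Hz|rewrite Dy|exact: Hz].
Qed.

(** The coding has a measurable inverse off a null set.  If, for some m and
each n, the first n digits of y are certified by a point of the compact set K m, then
by compactness all of them are certified by a single point, whose memberships in the
sets [C i] are therefore the digits of y.  The set B of these y is measurable,
contains the code of almost every t, and on B the preimage of [C i] is read on the
i-th digit. *)
Lemma decoding : exists kappa : R -> T, measurable_fun setT kappa /\
  {ae mu, forall t, kappa (coding t) = t}.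
Proof.
have /choice[fg Hfg] : forall m : nat, exists fg : (nat -> nat) * (nat -> nat),
  (mu (~` [set t | (forall n, small_union C n (fg.1 n) (h t)) /\
      (forall i, C i (h t) \/ apart i (fg.2 i) (h t))]) <= (m.+1%:R^-1)%:E)%E.
  move=> m; have p : 0 < m.+1%:R^-1 :> R by rewrite invr_gt0.
  by have [f [g fgP]] := tight_family p; exists (f, g).
pose K m := \bigcap_n small_union C n ((fg m).1 n).
pose B := \bigcup_m \bigcap_n codes (K m) (fg m).2 n.
have mB : measurable B.
  by apply: bigcupT_measurable => m; apply: bigcapT_measurable => n; exact: measurable_codes.
have Bdec y : B y -> exists z, forall i, C i z <-> digit i y.
  move=> [m _ Hy].
  have Kc : compact (K m) by exact: compact_small_bigcap.
  have [||z [_ Ez]] := @compact_closed_family _ _ (K m)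
      (fun i => E (fg m).2 (digit i y) i) Kc.
  - by move=> i; rewrite /E; case: (digit i y); [exact: Ccl|exact: closed_bigcup_lt].
  - by move=> n; exact: (Hy n I).
  exists z => i; have := Ez i; rewrite /E; case: (digit i y) => //.
  by move=> [j [_ jC] Cj]; split => // Ci; exfalso; exact: (jC z Cj Ci).
have /choice[kappa Hk] : forall y, exists t,
    (B y -> forall i, C i (h t) <-> digit i y) /\ (~ B y -> t = point).
  move=> y; have [By|nBy] := pselect (B y); last by exists point; split.
  by have [z Hz] := Bdec y By; have [t tz] := hsurj z; exists t; rewrite tz; split.
exists kappa; split.
  apply: (@measurability _ _ _ _ _ _ (range A)).
    apply/seteqP; split; first by move=> D; exact: coding_generates.
    apply: smallest_sub; first exact: sigma_algebra_measurable.
    by move=> _ [i _ <-].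
  move=> _ [_ [i _ <-] <-]; rewrite setTI.
  have -> : kappa @^-1` A i = (B `&` digit i @^-1` [set true]) `|`
      (~` B `&` [set y | A i point]).
    apply/seteqP; split => y /=; have [HB HnB] := Hk y.
      have [By|nBy] := pselect (B y); first by move=> /(HB By i); left.
      by rewrite /A/= (HnB nBy); right.
    by move=> [[By Dy]|[nBy Ap]]; [exact/(HB By i)|rewrite /A/= (HnB nBy)].
  apply: measurableU; apply: measurableI => //.
  - by rewrite -[X in measurable X]setTI; exact: (@measurable_digit R i).
  - exact: measurableC.
  - have [Ap|nAp] := pselect (A i point).
      by rewrite (_ : [set y | _] = setT)//; apply/seteqP; split.
    by rewrite (_ : [set y | _] = set0)//; apply/seteqP; split.
pose good m := [set t | (forall n, small_union C n ((fg m).1 n) (h t)) /\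
      (forall i, C i (h t) \/ apart i ((fg m).2 i) (h t))].
have mgood m : measurable (good m).
  have -> : good m =
    (\bigcap_n (h @^-1` small_union C n ((fg m).1 n))) `&`
    (\bigcap_i (A i `|` h @^-1` apart i ((fg m).2 i))).
    apply/seteqP; split => t /=.
      by move=> [H1 H2]; split => [n _|i _]; [exact: H1|exact: H2].
    by move=> [H1 H2]; split => [n|i]; [exact: (H1 n I)|exact: (H2 i I)].
  apply: measurableI; apply: bigcapT_measurable => n.
    by apply: mC; exact: closed_bigcup_lt.
  by apply: measurableU => //; apply: mC; exact: closed_bigcup_lt.
exists (\bigcap_m ~` good m); split.
- by apply: bigcapT_measurable => m; exact: measurableC.
- apply/eqP; rewrite eq_le measure_ge0 andbT; apply/lee_addgt0Pr => eps eps0.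
  rewrite add0e; pose m := Num.truncn eps^-1.
  apply: (@le_trans _ _ (mu (~` good m))).
    apply: le_measure; rewrite ?inE.
    + by apply: bigcapT_measurable => k; exact: measurableC.
    + exact: measurableC.
    + by move=> t; apply.
  apply: (le_trans (Hfg m)); rewrite lee_fin ltW//.
  by rewrite -[ltRHS]invrK ltf_pV2 ?posrE ?invr_gt0// truncnS_gt.
move=> t /= nt; apply: contrapT => H; apply: nt.
have [m [Hm1 Hm2]] : exists m, good m t.
  by apply: contrapT => ng; apply: H => m _ gm; apply: ng; exists m.
have By : B (coding t).
  exists m => // n _; exists (h t); split; first by move=> k _; exact: Hm1.
  move=> i _; rewrite digit_ternary /E /code.
  by case: asboolP => // nC; case: (Hm2 i).
apply: hinj; apply: (code_inj Zhaus Cbase) => i.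
have [+ _] := Hk (coding t) => /(_ By i); rewrite digit_ternary /code => ->.
by split => [/asboolP//|Ct]; exact/asboolP.
Qed.

End decode.
End standard_coding.

(** A form of the isomorphism of [T] with a Borel subset of [0, 1]: measurable sets are
preimages under psi, and each finite measure sees psi as invertible. *)
Lemma standard_coding (R : realType) d (T : measurableType d) :
  standard_measurable R T -> exists psi : T -> R, measurable_fun setT psi /\
  (forall t, 0 <= psi t <= 1) /\
  (forall B, measurable B -> exists2 D : set R, measurable D & B = psi @^-1` D) /\
  (forall mu : {finite_measure set T -> \bar R}, exists kappa : R -> T,
     measurable_fun setT kappa /\ {ae mu, forall t, kappa (psi t) = t}).
Proof.
move=> [Z [h [Zh [D [cD dD]] hb hm]]].
have [C [Ccl Cb]] := closed_countable_base cD dD.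
have hs z : exists t, h t = z by case: hb => g _ gK; exists (g z).
exists (coding h C); split; [|split; [|split]].
- exact: (measurable_coding Ccl hm).
- by move=> t; exact: ternary_itv.
- exact: (coding_preimage Cb hm).
- by move=> mu; exact: (decoding Zh Ccl Cb (bij_inj hb) hs hm mu).
Qed.

(** * Disintegration *)

Lemma measurable_lt_set (R : realType) d (T : measurableType d) (f g : T -> R) :
  measurable_fun setT f -> measurable_fun setT g -> measurable [set x | f x < g x].
Proof.
move=> mf mg; rewrite (_ : mkset _ = (fun x => g x - f x) @^-1` `]0, +oo[).
  rewrite -[X in measurable X]setTI.
  have : measurable_fun setT (fun x => g x - f x) by exact: measurable_funB.
  by apply.
by apply/seteqP; split => x /=; rewrite in_itv/= andbT subr_gt0.
Qed.

Lemma measurable_le_set (R : realType) d (T : measurableType d) (f g : T -> R) :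
  measurable_fun setT f -> measurable_fun setT g -> measurable [set x | f x <= g x].
Proof.
by move=> mf mg; have := measurable_fun_le measurableT mf mg; rewrite setTI.
Qed.

Section densities.
Context (R : realType) d (T : measurableType d) (mu : {sigma_finite_measure set T -> \bar R}).

Lemma exists_density (nu : {finite_measure set T -> \bar R}) :
  (forall A, measurable A -> mu A = 0%E -> nu A = 0%E) ->
  exists g : T -> R, [/\ measurable_fun setT g, (forall x, 0 <= g x) &
    forall A, measurable A -> nu A = (\int[mu]_(x in A) (g x)%:E)%E].
Proof.
move=> H.
have numu : nu `<< mu by apply/null_content_dominatesP => A mA; exact: H.
pose f := Radon_Nikodym_SigmaFinite.f nu mu.
have fin x : f x \is a fin_num by exact: Radon_Nikodym_SigmaFinite.f_fin_num.
exists (fine \o f); split.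
- apply: measurableT_comp => //.
  exact: (measurable_int mu (Radon_Nikodym_SigmaFinite.f_integrable numu)).
- by move=> x; apply: fine_ge0; exact: Radon_Nikodym_SigmaFinite.f_ge0.
- move=> A mA; rewrite (Radon_Nikodym_SigmaFinite.f_integral numu mA).
  by apply: eq_integral => x _; rewrite /= fineK.
Qed.

(** On the set where [g] is less than [f] the two have the same integrals, so
this set is null. *)
Lemma density_le (f g : T -> R) : measurable_fun setT f -> measurable_fun setT g ->
  (forall x, 0 <= f x) -> (forall x, 0 <= g x) ->
  (\int[mu]_x (f x)%:E < +oo)%E ->
  (forall A, measurable A ->
     \int[mu]_(x in A) (f x)%:E <= \int[mu]_(x in A) (g x)%:E)%E ->
  {ae mu, forall x, f x <= g x}.
Proof.
move=> mf mg f0 g0 foo H; pose N := [set x | g x < f x].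
have mN : measurable N.
  exact: measurable_lt_set.
have mfE : measurable_fun setT (EFin \o f) by exact/measurable_EFinP.
have mgE : measurable_fun setT (EFin \o g) by exact/measurable_EFinP.
have aeN : ae_eq mu N (EFin \o f) (EFin \o g).
  apply: integral_ae_eq => //.
  - apply: (integrableS measurableT) => //; apply/integrableP; split => //.
    rewrite (eq_integral (fun x => (f x)%:E))// => x _.
    by rewrite /= ger0_norm.
  - exact: measurable_funTS.
  - move=> E EN mE; apply/eqP; rewrite eq_le (H E mE)/=.
    apply: ge0_le_integral => //.
    + by move=> x _; rewrite lee_fin.
    + exact: measurable_funTS.
    + exact: measurable_funTS.
    + by move=> x /EN /ltW; rewrite lee_fin.
move: aeN; apply: filterS => x h.
rewrite leNgt; apply/negP => gf; have := h gf => -[] E.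
by move: gf; rewrite E ltxx.
Qed.

End densities.

Section kernel_of.
Context d d' (S : measurableType d) (T : measurableType d') (R : realType).
Variable k : S -> {measure set T -> \bar R}.

Definition kernel_of (mk : forall U, measurable U -> measurable_fun setT (k ^~ U)) := k.

Variable mk : forall U, measurable U -> measurable_fun setT (k ^~ U).

HB.instance Definition _ := isKernel.Build _ _ S T R (kernel_of mk) mk.

End kernel_of.

(** For each r, the density [g r] gives the mass that the conditional law at x puts on
the set where psi is less than r.  Lebesgue measure on [0, g 2 x[ is pushed by the
generalized inverse of r |-> g r x to the conditional law of psi, and by kappa to
the conditional law of the second variable.  The level 2 exceeds all values of
psi, so that g 2 x is the total mass. *)
Section disintegration_coded.
Context (R : realType) d d' (S : measurableType d) (T : measurableType d')
  (gamma : probability S R) (Q : {finite_measure set (S * T)%type -> \bar R}).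
Hypothesis Qgamma : forall A, measurable A -> gamma A = 0%E -> Q (fst @^-1` A) = 0%E.
Variable psi : T -> R.
Hypothesis mpsi : measurable_fun setT psi.
Hypothesis psi01 : forall t, 0 <= psi t <= 1.
Notation leb := (@lebesgue_measure R).

Let below (r : R) : set (S * T) := [set z | psi z.2 < r].

Let mbelow r : measurable (below r).
Proof.
rewrite (_ : below r = (psi \o snd) @^-1` `]-oo, r[); last first.
  by apply/seteqP; split => z /=; rewrite /below/= in_itv.
rewrite -[X in measurable X]setTI.
by apply: (measurableT_comp mpsi measurable_snd).
Qed.

Let mfstp A : measurable A -> measurable (fst @^-1` A : set (S * T)).
Proof. by move=> mA; rewrite -[X in measurable X]setTI; exact: measurable_fst. Qed.

Lemma exists_cdf_density r : exists g : S -> R,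
  [/\ measurable_fun setT g, (forall x, 0 <= g x) &
   forall A, measurable A ->
     Q (fst @^-1` A `&` below r) = (\int[gamma]_(x in A) (g x)%:E)%E].
Proof.
pose nu := image_measure (@measurable_fst _ _ S T) (mrestr Q (mbelow r)).
have nuT : (nu setT < +oo)%E.
  rewrite /nu /image_measure /pushforward preimage_setT.
  apply: (@le_lt_trans _ _ (Q setT)); last by rewrite ltey_eq fin_num_measure.
  by apply: le_measure; rewrite ?inE//; exact: measurableI.
have [A mA A0|g [mg g0 Hg]] := @exists_density _ _ _ gamma (as_finite nuT).
  apply/eqP; rewrite eq_le measure_ge0 andbT -(Qgamma mA A0).
  apply: le_measure; rewrite ?inE; [|exact: mfstp|exact: subIsetl].
  by apply: measurableI => //; exact: mfstp.
by exists g; split.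
Qed.

Let g (r : R) : S -> R := sval (cid (exists_cdf_density r)).
Let mg r : measurable_fun setT (g r).
Proof. by have [] := svalP (cid (exists_cdf_density r)). Qed.
Let g_ge0 r x : 0 <= g r x.
Proof. by have [_ + _] := svalP (cid (exists_cdf_density r)); apply. Qed.
Let gE r A : measurable A ->
  Q (fst @^-1` A `&` below r) = (\int[gamma]_(x in A) (g r x)%:E)%E.
Proof. by have [_ _ +] := svalP (cid (exists_cdf_density r)); apply. Qed.

Let g_le r s : r <= s -> {ae gamma, forall x, g r x <= g s x}.
Proof.
move=> rs; apply: density_le => //.
  by rewrite -gE// ltey_eq fin_num_measure//; apply: measurableI => //; exact: mfstp.
move=> A mA; rewrite -!gE//; apply: le_measure; rewrite ?inE.
- by apply: measurableI => //; exact: mfstp.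
- by apply: measurableI => //; exact: mfstp.
- by apply: setIS => z /= h; exact: lt_le_trans rs.
Qed.

(* Monotonicity in r holds for almost all x only along countably many levels: the
   rational ones, listed by q. *)
Let q (k : nat) : R := ratr (odflt 0 (unpickle k)).

Let q_pickle (r : rat) : q (pickle r) = ratr r.
Proof. by rewrite /q pickleK. Qed.

Let good x := forall k l, q k <= q l -> g (q k) x <= g (q l) x.

Let ae_good : {ae gamma, forall x, good x}.
Proof.
apply: ae_foralln => k; apply: ae_foralln => l.
have [kl|kl] := boolP (q k <= q l); last by apply: aeW.
by move: (g_le kl); apply: filterS => x h _.
Qed.

(* Rational levels in [0, 2[ at which the conditional distribution function exceeds
   the second component; the others are sent to 2. *)
Let cand (z : S * measurableTypeR R) (k : nat) : R :=
  if (0 <= q k < 2) && (z.2 < g (q k) z.1) then q k else 2.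

Let cand_itv z k : 0 <= cand z k <= 2.
Proof.
rewrite /cand; case: ifPn => [/andP[/andP[-> /ltW ->]]//|_].
by rewrite lexx ler0n.
Qed.

Let phi_e (z : S * measurableTypeR R) : \bar R := einfs (fun k => (cand z k)%:E) 0.

Let phi_e_ge0 z : (0 <= phi_e z)%E.
Proof.
apply: le_ereal_inf_tmp => _ [k /= _ <-]; rewrite lee_fin.
by case/andP: (cand_itv z k).
Qed.

Let phi_e_le z k : (phi_e z <= (cand z k)%:E)%E.
Proof. by apply: ereal_inf_lbound; exists k. Qed.

Let phi_e_fin z : phi_e z \is a fin_num.
Proof.
rewrite ge0_fin_numE; last exact: phi_e_ge0.
by apply: (le_lt_trans (phi_e_le z 0)); rewrite ltry.
Qed.

(** Generalized inverse of the conditional distribution function. *)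
Definition quantile (z : S * measurableTypeR R) : R := fine (phi_e z).

Lemma quantile_ge0 z : 0 <= quantile z.
Proof. exact: fine_ge0. Qed.

Lemma quantile_lt2 z r : 2 < r -> quantile z < r.
Proof.
move=> r2; apply: (@le_lt_trans _ _ (cand z 0)).
  by rewrite -lee_fin fineK.
by case/andP: (cand_itv z 0) => _ /le_lt_trans; apply.
Qed.

Lemma quantile_lt z r : r <= 2 -> quantile z < r <->
  exists k, [/\ 0 <= q k, q k < r & z.2 < g (q k) z.1].
Proof.
move=> r2; split.
  rewrite -lte_fin fineK// => /ereal_inf_lt[_ [k _ <-]]; rewrite lte_fin /cand.
  case: ifPn => [/andP[/andP[h1 h2] h3] h4|_]; first by exists k.
  by rewrite ltNge r2.
move=> [k [k0 kr kg]]; apply: (@le_lt_trans _ _ (cand z k)).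
  by rewrite -lee_fin fineK.
by rewrite /cand k0 kg (lt_le_trans kr r2).
Qed.

Lemma measurable_quantile : measurable_fun setT quantile.
Proof.
apply: measurableT_comp => //; apply: measurable_fun_einfs => k.
apply/measurable_EFinP; apply: measurable_fun_ifT => //.
apply: measurable_and => //; apply: measurable_fun_ltr; first exact: measurable_snd.
exact: (measurableT_comp (mg (q k)) measurable_fst).
Qed.

Let undergraph : set (S * measurableTypeR R) := [set z | 0 <= z.2 < g 2 z.1].

Let mundergraph : measurable undergraph.
Proof.
have m1 : measurable_fun setT (fun z : S * measurableTypeR R => (z.2 : R)).
  exact: measurable_snd.
have m2 : measurable_fun setT (fun z : S * measurableTypeR R => g 2 z.1).
  exact: (measurableT_comp (mg 2) measurable_fst).
rewrite (_ : undergraph = [set z | 0 <= z.2] `&` [set z | z.2 < g 2 z.1]).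
  apply: measurableI.
    by apply: (@measurable_le_set _ _ _ (cst 0)).
  exact: (measurable_lt_set m1 m2).
by apply/seteqP; split => z; rewrite /undergraph/= => /andP.
Qed.

Let mqpair : measurable_fun setT (fun z : S * measurableTypeR R => (z.1, quantile z)).
Proof. by apply: measurable_fun_pair => //; exact: measurable_quantile. Qed.

Let mppair : measurable_fun setT (fun z : S * T => (z.1, psi z.2)).
Proof. by apply: measurable_fun_pair => //; exact: measurableT_comp. Qed.

Let Q1 : {measure set (S * R) -> \bar R} := image_measure mppair Q.
Let Q2 : {measure set (S * R) -> \bar R} :=
  image_measure mqpair (mrestr (gamma \x leb)%E mundergraph).

Let sec r x : set (measurableTypeR R) :=
  [set u | 0 <= u < g 2 x /\ quantile (x, u) < r].

Let secE A r x : xsection ((fun z : S * measurableTypeR R => (z.1, quantile z)) @^-1`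
    (A `*` [set y | y < r]) `&` undergraph) x = if x \in A then sec r x else set0.
Proof.
apply/seteqP; split => u; rewrite /xsection/= inE /=.
  by move=> [[Ax qr] ug]; rewrite mem_set.
by case: ifPn => //= /set_mem Ax [h1 h2].
Qed.

Let msec r x : measurable (sec r x).
Proof.
have := secE setT r x; rewrite in_setT => <-.
apply: measurable_xsection; apply: measurableI => //.
rewrite -[X in measurable X]setTI; apply: mqpair => //.
apply: measurableX => //.
by rewrite (_ : [set y | y < r] = `]-oo, r[%classic).
Qed.

Let Q2_ray A r : measurable A ->
  Q2 (A `*` [set y | y < r]) = (\int[gamma]_(x in A) leb (sec r x))%E.
Proof.
move=> mA; rewrite [RHS]integral_mkcond; apply: eq_integral => x _.
by rewrite /= secE patchE; case: ifPn => // _; rewrite measure0.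
Qed.

Let Q1_ray A r : Q1 (A `*` [set y | y < r]) = Q (fst @^-1` A `&` below r).
Proof. by []. Qed.

Let leb_itv0 (a : R) : 0 <= a -> leb [set u | 0 <= u < a] = a%:E.
Proof.
move=> a0; rewrite (_ : mkset _ = `[0, a[%classic); last first.
  by apply/seteqP; split => u /=; rewrite in_itv.
rewrite lebesgue_measure_itv/= lte_fin oppr0 adde0.
by case: ltP => // a0'; congr EFin; apply/eqP; rewrite eq_le a0 a0'.
Qed.

Let mleb_itv0 (a : R) : measurable ([set u | 0 <= u < a] : set (measurableTypeR R)).
Proof.
by rewrite (_ : mkset _ = `[0, a[%classic).
Qed.

(* Rational levels increasing to r.  The running maximum of the corresponding g is
   monotone for every x, and equal to g at the last level for almost every x. *)
Let app (r : rat) (n : nat) : rat := (r * (1 - n.+1%:R^-1)).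

Let runmax (r : rat) x := fix F n := if n is m.+1
  then Num.max (F m) (g (ratr (app r n)) x) else g (ratr (app r 0)) x.

Let mrunmax r n : measurable_fun setT (fun x => runmax r x n).
Proof.
elim: n => [|n IH] /=; first exact: mg.
by apply: measurable_maxr => //; exact: mg.
Qed.

Let runmax_ge0 r x n : 0 <= runmax r x n.
Proof. by elim: n => [|n IH] /=; rewrite ?g_ge0// le_max IH. Qed.

Section ray.
Variable r : rat.
Hypothesis r0 : 0 < r.

Let app_nd m n : (m <= n)%N -> app r m <= app r n.
Proof.
move=> mn; rewrite /app ler_wpM2l ?(ltW r0)// lerD2l lerN2.
by rewrite lef_pV2 ?posrE ?ltr0n// ler_nat ltnS.
Qed.

Let app_itv n : 0 <= app r n < r.
Proof.
have h : 0 < n.+1%:R^-1 :> rat by rewrite invr_gt0 ltr0n.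
have h1 : n.+1%:R^-1 <= 1 :> rat by rewrite invf_le1 ?ltr0n// ler1n.
rewrite /app mulr_ge0 ?(ltW r0) ?subr_ge0//=.
by rewrite -[ltRHS]mulr1 ltr_pM2l// ltrBlDr ltrDl.
Qed.

Let app_cofinal (s : R) : s < ratr r -> exists n, s < ratr (app r n).
Proof.
move=> sr; have r0' : 0 < ratr r :> R by rewrite ltr0q.
have e0 : 0 < (ratr r - s) / ratr r by rewrite divr_gt0// subr_gt0.
pose n := Num.truncn ((ratr r - s) / ratr r)^-1; exists n.
have ne : n.+1%:R^-1 < (ratr r - s) / ratr r.
  by rewrite -[ltRHS]invrK ltf_pV2 ?posrE ?invr_gt0// truncnS_gt.
rewrite /app rmorphM rmorphB rmorph1 fmorphV /= ratr_nat.
rewrite ltr_pdivlMr// in ne.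
move: (n.+1%:R^-1) ne => z ne; rewrite mulrBr mulr1 [ratr r * z]mulrC; lra.
Qed.

Let runmax_good x : good x -> forall n, runmax r x n = g (ratr (app r n)) x.
Proof.
move=> gx; elim => [//|n IH] /=; rewrite IH; apply/max_idPr.
by rewrite -!q_pickle; apply: gx; rewrite !q_pickle ler_rat app_nd.
Qed.

(** Both sides are limits along the levels [app r n] from below: Q1 by continuity from
below, Q2 because the section where the quantile is less than r is the union of the
intervals [0, g (app r n) x[. *)
Lemma quantile_ray_mid A : ratr r <= 2 :> R -> measurable A ->
  Q2 (A `*` [set y | y < ratr r]) = Q1 (A `*` [set y | y < ratr r]).
Proof.
move=> r2 mA; rewrite Q2_ray// Q1_ray.
have secU x : good x -> sec (ratr r) x =
    \bigcup_n [set u | 0 <= u < g (ratr (app r n)) x].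
  move=> gx; apply/seteqP; split => u.
    move=> [/andP[u0 _] /(quantile_lt _ r2)[k [k0 kr ug]]].
    have [n kn] := app_cofinal kr; exists n => //=; rewrite u0/=.
    apply: (lt_le_trans ug); rewrite /= -q_pickle; apply: gx.
    by rewrite q_pickle ltW.
  move=> [n _ /= /andP[u0 un]]; have /andP[a0 ar] := app_itv n.
  split.
    rewrite u0 (lt_le_trans un)//.
    have <- : ratr 2%:R = 2 :> R by rewrite ratr_nat.
    rewrite -!q_pickle; apply: gx; rewrite !q_pickle ratr_nat.
    by apply: (le_trans _ r2); rewrite ler_rat (ltW ar).
  apply/(quantile_lt _ r2); exists (pickle (app r n)).
  by rewrite q_pickle ler0q a0 ltr_rat ar.
have lebE x : good x -> leb (sec (ratr r) x) = limn (fun n => (runmax r x n)%:E).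
  move=> gx; rewrite secU//; apply/esym/cvg_lim => //.
  rewrite (_ : (fun n => (runmax r x n)%:E) =
    (leb \o (fun n => [set u | 0 <= u < g (ratr (app r n)) x]))); last first.
    by apply/funext => n /=; rewrite leb_itv0// runmax_good.
  apply: nondecreasing_cvg_mu => //.
    by apply: bigcupT_measurable => n; exact: mleb_itv0.
  move=> m n mn; apply/subsetPset => u /= /andP[-> um]; apply: (lt_le_trans um).
  by rewrite -!q_pickle; apply: gx; rewrite !q_pickle ler_rat app_nd.
have mrE n : measurable_fun A (fun x => (runmax r x n)%:E).
  by apply: measurable_funTS; exact/measurable_EFinP.
have rnd x : {homo (fun n => (runmax r x n)%:E) : m n / (m <= n)%N >-> (m <= n)%E}.
  apply/nondecreasing_seqP => n; rewrite lee_fin /= le_max lexx//.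
transitivity (\int[gamma]_(x in A) limn (fun n => (runmax r x n)%:E))%E.
  apply: ge0_ae_eq_integral => //.
  - apply: measurable_funTS; apply: (eq_measurable_fun (fun x => leb (xsection
      ((fun z : S * measurableTypeR R => (z.1, quantile z)) @^-1`
      (setT `*` [set y | y < ratr r]) `&` undergraph) x))).
      by move=> x _; rewrite secE in_setT.
    apply: measurable_fun_xsection; apply: measurableI => //.
    rewrite -[X in measurable X]setTI; apply: mqpair => //.
    apply: measurableX => //.
    by rewrite (_ : mkset _ = `]-oo, ratr r[%classic).
  - apply: (emeasurable_fun_cvg (fun n x => (runmax r x n)%:E)) => //.
    by move=> x _; apply: ereal_nondecreasing_is_cvgn; exact: rnd.
  - move=> x _; apply: lime_ge; first by apply: ereal_nondecreasing_is_cvgn; exact: rnd.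
    by apply: nearW => n; rewrite lee_fin.
  - by move: ae_good; apply: filterS => x gx _; exact: lebE.
rewrite monotone_convergence//; last by move=> n x _; rewrite lee_fin.
have -> : below (ratr r) = \bigcup_n below (ratr (app r n)).
  apply/seteqP; split => z; first by move=> /app_cofinal[n zn]; exists n.
  move=> [n _ zn]; apply: (lt_trans zn); rewrite ltr_rat.
  by have /andP[] := app_itv n.
rewrite setI_bigcupr; apply/cvg_lim => //.
rewrite (_ : (fun n => _) = Q \o (fun n => fst @^-1` A `&` below (ratr (app r n)))).
  apply: nondecreasing_cvg_mu => [n||].
  - by apply: measurableI => //; exact: mfstp.
  - by apply: bigcupT_measurable => n; apply: measurableI => //; exact: mfstp.
  - move=> m n mn; apply/subsetPset; apply: setIS => z zm; apply: (lt_le_trans zm).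
    by rewrite ler_rat app_nd.
apply/funext => n /=; rewrite gE//.
apply: ge0_ae_eq_integral => //.
- by apply: measurable_funTS; exact/measurable_EFinP.
- by move=> x _; rewrite lee_fin.
- by move=> x _; rewrite lee_fin.
- by move: ae_good; apply: filterS => x gx _; rewrite runmax_good.
Qed.

End ray.

Let quantile_ray A (r : rat) : measurable A ->
  Q2 (A `*` [set y | y < ratr r]) = Q1 (A `*` [set y | y < ratr r]).
Proof.
move=> mA; have [r0|r0] := ltP 0 r; last first.
  have r0' : ratr r <= 0 :> R by rewrite -(ler_rat R) rmorph0 in r0.
  rewrite Q2_ray// Q1_ray.
  rewrite (_ : _ `&` _ = set0) ?measure0; last first.
    apply/seteqP; split => // z [_]; rewrite /below/=.
    by have /andP[p0 _] := psi01 z.2 => /lt_le_trans /(_ r0'); rewrite ltNge p0.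
  apply: integral0_eq => x _; rewrite (_ : sec _ _ = set0) ?measure0//.
  apply/seteqP; split => // u [_]; rewrite ltNge.
  by rewrite (le_trans r0' (quantile_ge0 _)).
have [r2|r2] := leP (ratr r : R) 2; first exact: quantile_ray_mid.
rewrite Q2_ray// Q1_ray.
have -> : below (ratr r) = below 2.
  apply/seteqP; split => z _; have /andP[_ p1] := psi01 z.2;
    rewrite /below /=; apply: (le_lt_trans p1); first by rewrite ltr1n.
  by apply: lt_trans r2; rewrite ltr1n.
rewrite gE//; apply: eq_integral => x _; rewrite -leb_itv0//; congr leb.
by apply/seteqP; split => u; [case|move=> h; split => //; exact: quantile_lt2].
Qed.

Let quantile_law (D : set (S * R)) : measurable D -> Q1 D = Q2 D.
Proof.
pose G := [set C : set (S * R) | exists A, exists r : rat,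
  measurable A /\ C = A `*` [set y | y < ratr r]].
have mray (c : R) : measurable [set y : R | y < c].
  by rewrite (_ : mkset _ = `]-oo, c[%classic).
move=> mD; apply: (g_sigma_algebra_measure_unique G _ (fun n => setT `*` [set y | y < ratr n%:R])).
- by move=> _ [A [r [mA ->]]]; exact: measurableX.
- by move=> n; exists setT, n%:R.
- apply/seteqP; split => // -[x y] _; exists (Num.truncn y).+1 => //; split => //=.
  by rewrite ratr_nat truncnS_gt.
- move=> _ _ [A [r [mA ->]]] [A' [r' [mA' ->]]].
  exists (A `&` A'), (Num.min r r'); split; first exact: measurableI.
  rewrite -setXI; congr (_ `*` _); apply/seteqP; split => y /=.
    move=> [h h']; case: (leP r r') => _ //.
  case: (leP r r') => rr h; split => //; apply: (lt_le_trans h); rewrite ler_rat//.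
  exact: ltW.
- by move=> _ [A [r [mA ->]]]; rewrite quantile_ray.
- move=> n; rewrite Q1_ray ltey_eq fin_num_measure//.
  by apply: measurableI => //; exact: mfstp.
suff : measurable_fun setT (id : g_sigma_algebraType G -> S * R).
  by move=> /(_ measurableT D mD); rewrite setTI.
rewrite (_ : id = fun z => (z.1, z.2)); last by apply/funext => -[].
apply: measurable_fun_pair.
  move=> _ A mA; rewrite setTI.
  have -> : fst @^-1` A = \bigcup_n (A `*` [set y : R | y < ratr n%:R]).
    apply/seteqP; split => [[x y] /= Ax|[x y] [n _ []]//].
    by exists (Num.truncn y).+1 => //; split => //=; rewrite ratr_nat truncnS_gt.
  apply: (@bigcupT_measurable _ (g_sigma_algebraType G)) => n.
  by apply: sub_sigma_algebra; exists A, n%:R.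
suff : measurable_fun setT (snd : g_sigma_algebraType G -> measurableTypeR R) by [].
apply: (measurability _ (RGenInftyO.measurableE R)) => //.
move=> _ [_ [c ->] <-]; rewrite setTI.
have -> : snd @^-1` [set` `]-oo, c[] = \bigcup_(r : rat)
    (if ratr r < c then (setT `*` [set y : R | y < ratr r] : set (S * R)) else set0).
  apply/seteqP; split => [[x y]|[x y] [r _]] /=; rewrite in_itv/=.
    move=> yc; have [r] := rat_in_itvoo yc; rewrite in_itv/= => /andP[yr rc].
    by exists r => //; rewrite rc.
  by case: ifPn => // rc [_ yr]; exact: lt_trans rc.
apply: (@bigcupT_measurable_rat _ (g_sigma_algebraType G)) => r.
case: ifP => _; last exact: (@measurable0 _ (g_sigma_algebraType G)).
by apply: sub_sigma_algebra; exists setT, r.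
Qed.

Variable kappa : R -> T.
Hypothesis mkappa : measurable_fun setT kappa.
Hypothesis kappa_psi : {ae Q, forall z, kappa (psi z.2) = z.2}.

Let mkq : measurable_fun setT (fun z : S * measurableTypeR R => kappa (quantile z)).
Proof. exact: (measurableT_comp mkappa measurable_quantile). Qed.

Let mkq2 x : measurable_fun setT (fun u : measurableTypeR R => kappa (quantile (x, u))).
Proof. exact: (measurableT_comp mkq (pair1_measurable x)). Qed.

Let k x : {measure set T -> \bar R} :=
  image_measure (mkq2 x) (mrestr leb (mleb_itv0 (g 2 x))).

Let kE x (U : set T) : k x U = leb (xsection
  ((fun z : S * measurableTypeR R => kappa (quantile z)) @^-1` U `&` undergraph) x).
Proof.
rewrite /k /image_measure /pushforward /mrestr; congr leb.
by apply/seteqP; split => u; rewrite /xsection/= inE.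
Qed.

Let mk U : measurable U -> measurable_fun setT (k ^~ U).
Proof.
move=> mU; apply: (eq_measurable_fun (fun x => leb (xsection
    ((fun z : S * measurableTypeR R => kappa (quantile z)) @^-1` U `&` undergraph) x))).
  by move=> x _; rewrite kE.
apply: measurable_fun_xsection; apply: measurableI => //.
by rewrite -[X in measurable X]setTI; exact: mkq.
Qed.

Lemma disintegration_coded : exists m : R.-ker S ~> T,
  (forall x, m x setT < +oo)%E /\
  forall C, measurable C -> Q C = (\int[gamma]_x m x (xsection C x))%E.
Proof.
exists (kernel_of mk); split.
  move=> x; rewrite [X in (X < _)%E]kE.
  apply: (@le_lt_trans _ _ (leb [set u | 0 <= u < g 2 x])); last first.
    by rewrite leb_itv0// ltry.
  apply: le_measure; rewrite ?inE; [|exact: mleb_itv0|].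
    by apply: measurable_xsection; rewrite preimage_setT setTI.
  by move=> u; rewrite /xsection/= inE => -[].
move=> C mC.
pose h (z : S * R) := (z.1, kappa z.2).
have mh : measurable_fun setT h.
  by apply: measurable_fun_pair => //; exact: (measurableT_comp mkappa).
have mhC : measurable (h @^-1` C) by rewrite -[X in measurable X]setTI; exact: mh.
have mpC : measurable ((fun z : S * T => (z.1, psi z.2)) @^-1` (h @^-1` C)).
  by rewrite -[X in measurable X]setTI; exact: mppair.
transitivity (Q1 (h @^-1` C)).
  transitivity (\int[Q]_z (\1_C z)%:E)%E; first by rewrite integral_indic// setIT.
  transitivity (\int[Q]_z (\1_((fun z => (z.1, psi z.2)) @^-1` (h @^-1` C)) z)%:E)%E;
    last by rewrite integral_indic// setIT.
  apply: ge0_ae_eq_integral => //.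
  - by apply/measurable_EFinP; exact: measurable_indic.
  - by apply/measurable_EFinP; exact: measurable_indic.
  - move: kappa_psi; apply: filterS => -[x t] /= E _; congr EFin.
    by rewrite !indicE; congr (_ %:R : R); congr nat_of_bool; apply/idP/idP;
      rewrite !inE /preimage /h /= E.
rewrite quantile_law//; apply: eq_integral => x _.
rewrite [RHS]kE; congr leb.
apply/seteqP; split => u; rewrite /xsection /h /= ?inE /=.
  by move=> [Cx ?]; split => //; exact: mem_set.
by move=> [/set_mem].
Qed.

End disintegration_coded.

(** The decoding map is chosen for the second marginal of [Q]. *)
Lemma disintegration (R : realType) d d' (S : measurableType d) (T : measurableType d')
    (gamma : probability S R) (Q : {finite_measure set (S * T)%type -> \bar R}) :
  standard_measurable R T ->
  (forall A, measurable A -> gamma A = 0%E -> Q (fst @^-1` A) = 0%E) ->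
  exists m : R.-ker S ~> T, (forall x, m x setT < +oo)%E /\
    forall C, measurable C -> Q C = (\int[gamma]_x m x (xsection C x))%E.
Proof.
move=> /standard_coding[psi [mpsi [psi01 [_ Hdec]]]] Qgamma.
have QT : (image_measure (@measurable_snd _ _ S T) Q setT < +oo)%E.
  by rewrite /image_measure /pushforward preimage_setT ltey_eq fin_num_measure.
have [kappa [mkappa [N [mN N0 HN]]]] := Hdec (as_finite QT).
apply: (@disintegration_coded _ _ _ _ _ gamma Q Qgamma psi mpsi psi01 kappa mkappa).
exists (snd @^-1` N); split => //.
  by rewrite -[X in measurable X]setTI; exact: measurable_snd.
by move=> z; exact: HN.
Qed.

Section semidirect.
Import HBNNSimple.
Context (R : realType) d d' (S : measurableType d) (T : measurableType d')
  (gamma : {measure set S -> \bar R}) (m : R.-ker S ~> T).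

(** The measure gamma(dx) m(x, dt). *)
Definition semidirect (mfin : forall x, (m x setT < +oo)%E) : set (S * T) -> \bar R :=
  fun C => (\int[gamma]_x m x (xsection C x))%E.

Variable mfin : forall x, (m x setT < +oo)%E.

Lemma measurable_kernel_xsection (C : set (S * T)) : measurable C ->
  measurable_fun setT (fun x => m x (xsection C x)).
Proof.
move=> mC.
have [|_] := @measurable_prod_subset_xsection_kernel _ _ _ _ _ m _ measurableT _ _ mC.
  move=> x; exists (fine (m x setT) + 1) => A mA; rewrite EFinD.
  have mf : m x setT \is a fin_num by rewrite ge0_fin_numE.
  rewrite fineK// /mrestr setIT.
  apply: (@le_lt_trans _ _ (m x setT)); first by apply: le_measure; rewrite ?inE.
  by rewrite lteDl ?lte01.
by apply: eq_measurable_fun => x _; rewrite /mrestr setIT.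
Qed.

Let sd0 : semidirect mfin set0 = 0%E.
Proof. by apply: integral0_eq => x _; rewrite xsection0 measure0. Qed.
Let sd_ge0 C : (0 <= semidirect mfin C)%E.
Proof. exact: integral_ge0. Qed.
Let sd_sigma_additive : semi_sigma_additive (semidirect mfin).
Proof.
move=> F mF tF mUF; rewrite /semidirect.
rewrite (eq_integral (fun x => \sum_(n <oo) m x (xsection (F n) x))%E); last first.
  move=> x _; rewrite xsection_bigcup measure_bigcup//.
  - by apply: eq_eseriesl => n; rewrite in_setT.
  - by move=> n _; exact: measurable_xsection.
  - exact: trivIset_xsection.
rewrite integral_nneseries//; last by move=> n; exact: measurable_kernel_xsection.
by apply: is_cvg_ereal_nneg_natsum_cond => n _ _; exact: integral_ge0.
Qed.

HB.instance Definition _ := isMeasure.Build _ _ _ (semidirect mfin)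
  sd0 sd_ge0 sd_sigma_additive.

Lemma measurable_kernel_integral (f : S * T -> \bar R) : measurable_fun setT f ->
  (forall z, 0 <= f z)%E -> measurable_fun setT (fun x => \int[m x]_t f (x, t))%E.
Proof.
move=> mf f0; pose f_ := nnsfun_approx measurableT mf.
apply: (@measurable_fun_xsection_integral _ _ _ _ _ f m f_).
- by move=> a b ab; exact/nd_nnsfun_approx.
- by move=> z; exact: cvg_nnsfun_approx.
- move=> n r; apply: measurable_kernel_xsection.
  by rewrite -[X in measurable X]setTI; exact: (measurable_funPT (f_ n)).
Qed.

Lemma ge0_integral_semidirect (f : S * T -> \bar R) : measurable_fun setT f ->
  (forall z, 0 <= f z)%E ->
  (\int[semidirect mfin]_z f z = \int[gamma]_x \int[m x]_t f (x, t))%E.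
Proof.
have m2 x (g : S * T -> \bar R) : measurable_fun setT g ->
    measurable_fun setT (fun t => g (x, t)).
  by move=> mg; exact: (measurableT_comp mg (pair1_measurable x)).
have mI (g : S * T -> \bar R) := measurable_kernel_integral (f := g).
have I0 (g : S * T -> \bar R) : (forall z, 0 <= g z)%E ->
    forall x, setT x -> (0 <= \int[m x]_t g (x, t))%E.
  by move=> g0 x _; exact: integral_ge0.
move: f; apply: ge0_mfun_ind.
- move=> A mA; rewrite integral_indic// setIT; apply: eq_integral => x _.
  rewrite -(setIT (xsection A x)) -integral_indic//; last exact: measurable_xsection.
  by apply: eq_integral => t _; rewrite !indicE mem_xsection.
- move=> f g mf f0 IHf mg g0 IHg; rewrite ge0_integralD// IHf IHg.
  rewrite -(ge0_integralD gamma measurableT (I0 f f0) (mI f mf f0) (I0 g g0) (mI g mg g0)).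
  apply: eq_integral => x _; apply/esym.
  exact: (ge0_integralD (m x) measurableT (fun _ _ => f0 _) (m2 x f mf)
    (fun _ _ => g0 _) (m2 x g mg)).
- move=> k f k0 mf f0 IH; rewrite ge0_integralZl_EFin// IH.
  rewrite -(ge0_integralZl_EFin gamma measurableT (I0 f f0) (mI f mf f0) k0).
  apply: eq_integral => x _; apply/esym.
  exact: (ge0_integralZl_EFin (m x) measurableT (fun _ _ => f0 _) (m2 x f mf) k0).
- move=> f_ mf f0 IH nd; rewrite monotone_convergence//.
  under eq_fun do rewrite IH.
  rewrite -monotone_convergence//.
  + apply: eq_integral => x _; rewrite monotone_convergence//.
    by move=> n; exact: m2.
  + by move=> n; exact: measurable_kernel_integral.
  + by move=> n x _; exact: integral_ge0.
  + move=> x _ a b ab; apply: ge0_le_integral => //; try exact: m2.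
    by move=> t _; exact: nd.
Qed.

End semidirect.

(** * The joint law of the environment and of a point of a GMC *)

Section finite_part.
Context (R : realType) d d' (S : measurableType d) (T : measurableType d')
  (m : R.-ker S ~> T).

(** The kernel of a GMC is finite at almost every point only; the rest is erased. *)
Definition finite_part (x : S) : {measure set T -> \bar R} :=
  if (m x setT < +oo)%E then m x else mzero.

Lemma finite_part_lty x : (finite_part x setT < +oo)%E.
Proof. by rewrite /finite_part; case: ifP => // _; rewrite /mzero ltry. Qed.

Lemma finite_partE x : (m x setT < +oo)%E -> finite_part x = m x.
Proof. by rewrite /finite_part => ->. Qed.

Lemma measurable_lty_set (f : S -> \bar R) : measurable_fun setT f ->
  measurable [set x | (f x < +oo)%E].
Proof.
by move=> mf; have := emeasurable_fun_infty_o measurableT mf +oo; rewrite setTI.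
Qed.

Let measurable_finite_part U : measurable U -> measurable_fun setT (finite_part ^~ U).
Proof.
move=> mU; apply: (eq_measurable_fun
    (fun x => m x U * (\1_[set x | (m x setT < +oo)%E] x)%:E)%E).
  move=> x _; rewrite /finite_part indicE; case: ifPn => h.
    by rewrite mem_set// mule1.
  by rewrite memNset ?mule0//; exact/negP.
apply: emeasurable_funM; first exact: measurable_kernel.
apply/measurable_EFinP/measurable_indic/measurable_lty_set.
exact: measurable_kernel.
Qed.

HB.instance Definition _ := isKernel.Build _ _ S T R finite_part measurable_finite_part.

End finite_part.

Lemma ae_measure_eq0 (R : realType) d d' (Omega : measurableType d) (T : measurableType d')
    (P : {measure set Omega -> \bar R}) (M : R.-ker Omega ~> T) (N : set T) :
  measurable N -> (\int[P]_w M w N = 0)%E -> {ae P, forall w, M w N = 0%E}.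
Proof.
move=> mN H.
have mM : measurable_fun setT (fun w => M w N) by exact: measurable_kernel.
have /(ae_eq_integral_abs P measurableT mM) h : (\int[P]_(w in setT) `|M w N| = 0)%E.
  by rewrite -[RHS]H; apply: eq_integral => w _; rewrite gee0_abs.
by move: h; apply: filterS => w /(_ I).
Qed.

Section gmc_law.
Context (R : realType) (H : completeNormedModType R)
    (dot : {dot H for (idfun : R -> R)}) (e : nat -> H)
    (d d' : measure_display) (Omega : measurableType d) (T : measurableType d')
    (P : probability Omega R) (mu : {finite_measure set T -> \bar R})
    (X : H -> {mfun_ P, Omega >-> R}) (Y : H -> {mfun_ mu, T >-> R}).
Hypothesis hdot : hilbert_dot dot.
Hypothesis he : orthonormal_basis dot e.
Hypothesis hX : standard_gaussian X.
Hypothesis hY : generalized_function Y.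
Variable M : R.-ker Omega ~> T.
Hypothesis Mfin : forall w, (M w setT < +oo)%E.
Hypothesis Mmean : forall A, measurable A -> mean_measure P M A = mu A.
Variable m : R.-ker (Rinf R) ~> T.
Hypothesis Mm : {ae P, forall w, forall A, measurable A -> M w A = m (coords e X w) A}.
Hypothesis m_shift : forall xi : H, {ae P, forall w, forall A, measurable A ->
  m (add_seq (coords e X w) (fun n => dot xi (e n))) A =
  (\int[M w]_(t in A) (expR (Y xi t))%:E)%E}.

Let gamma : probability (Rinf R) R := coord_law e X.
Let m' : R.-ker (Rinf R) ~> T := finite_part m.
Let m'_lty x : (m' x setT < +oo)%E := finite_part_lty m x.
Let nu : {measure set (Rinf R * T)%type -> \bar R} := semidirect gamma m'_lty.

(* The points where m is infinite form a null set, and so do their shifts along the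
   coordinates, since these keep null sets null. *)
Let bad := [set x | ~~ (m x setT < +oo)%E].
Let mbad : measurable bad.
Proof.
rewrite (_ : bad = ~` [set x | (m x setT < +oo)%E]).
  by apply/measurableC/measurable_lty_set; exact: measurable_kernel.
by apply/seteqP; split => x /negP.
Qed.

Let mcX : measurable_fun setT (coords e X) := measurable_coords X e.

Let bad0 : gamma bad = 0%E.
Proof.
apply/(@measure_negligible _ _ _ P).
  by rewrite -[X in measurable X]setTI; exact: mcX.
apply: negligibleS Mm => w /= b h; move: b; rewrite /bad/=.
by rewrite -(h _ measurableT) Mfin.
Qed.

Let mexp n c : measurable_fun setT
  (fun x : Rinf R => (expR (c * x n - c ^+ 2 / 2))%:E).
Proof.
apply/measurable_EFinP; apply: measurableT_comp => //.
by apply: measurable_funB => //; apply: measurable_funM => //; exact: measurable_coord.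
Qed.

Let mshift n c : measurable_fun setT (@coord_shift R n c) :=
  measurableT_comp (@measurable_coord_shift R n) (pair1_measurable c).

Let ae_good_shift n c : {ae P, forall w, (m (coord_shift n c (coords e X w)) setT < +oo)%E}.
Proof.
have mb : measurable_fun setT (fun x => (\1_bad x)%:E : \bar R).
  exact/measurable_EFinP/measurable_indic.
have E0 : (\int[gamma]_x (\1_bad (coord_shift n c x))%:E = 0)%E.
  rewrite (coord_law_quasi_invariant hdot he hX n c mb)//.
  transitivity (\int[gamma]_x (cst 0 x))%E; last exact: integral0.
  apply: ge0_ae_eq_integral => //.
  - exact: (emeasurable_funM mb (mexp n c)).
  - exists bad; split => // x /=; apply: contra_notP => nb _.
    by rewrite indicE memNset// mul0e.
have mbs : measurable_fun setT (fun w => (\1_bad (coord_shift n c (coords e X w)))%:E : \bar R).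
  exact: (measurableT_comp mb (measurableT_comp (mshift n c) mcX)).
have /(ae_eq_integral_abs P measurableT mbs) h : (\int[P]_(w in setT)
    `|(\1_bad (coord_shift n c (coords e X w)))%:E| = 0)%E.
  rewrite -[RHS]E0 ge0_integral_coord_law//.
  - by apply: eq_integral => w _; rewrite gee0_abs.
  - exact: (measurableT_comp mb (mshift n c)).
move: h; apply: filterS => w /(_ I)[]; rewrite indicE.
by case: (boolP (_ \in bad)) => [_ /eqP|+ _]; rewrite ?oner_eq0// notin_setE => /negP/negPn.
Qed.

Let m2 n : measurable_fun setT (fun t => Y (e n) t) := measurable_gf Y (e n).

Let coord_shift_dot n c : coord_shift n c =
  (fun x => add_seq x (fun i => dot (c *: e n) (e i))) :> (Rinf R -> Rinf R).
Proof.
apply/funext => x; rewrite /coord_shift; congr add_seq; apply/funext => i.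
by rewrite linearZl_LR /= he.1.
Qed.

Let mpair (x : Rinf R) (F : Rinf R * T -> \bar R) : measurable_fun setT F ->
  measurable_fun setT (fun t => F (x, t)).
Proof. by move=> mF; exact: (measurableT_comp mF (pair1_measurable x)). Qed.

Let mrandom (F : Rinf R * T -> \bar R) : measurable_fun setT F ->
  measurable_fun setT (fun z : Omega * T => F (coords e X z.1, z.2)).
Proof.
move=> mF; apply: (measurableT_comp mF (g := fun z : Omega * T => (coords e X z.1, z.2))).
by apply: measurable_fun_pair => //; exact: (measurableT_comp mcX).
Qed.

Lemma integral_gmc_law (F : Rinf R * T -> \bar R) : measurable_fun setT F ->
  (forall z, 0 <= F z)%E ->
  (\int[nu]_z F z = \int[P]_w \int[M w]_t F (coords e X w, t))%E.
Proof.
move=> mF F0; rewrite ge0_integral_semidirect//.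
have mI := measurable_kernel_integral m'_lty mF F0.
rewrite ge0_integral_coord_law//; last by move=> x; exact: integral_ge0.
apply: ge0_ae_eq_integral => //.
- exact: (measurableT_comp mI mcX).
- by apply: (measurable_kernel_integral Mfin (mrandom mF)) => z; exact: F0.
- by move=> w _; exact: integral_ge0.
- by move=> w _; exact: integral_ge0.
- move: Mm; apply: filterS => w h _; apply: eq_measure_integral => A mA _.
  rewrite h//; rewrite /m' /= finite_partE//.
  by rewrite -h.
Qed.

(* The GMC relation in the direction c e_n, integrated. *)
Let gmc_law_tilt n c (F : Rinf R * T -> \bar R) : measurable_fun setT F ->
  (forall z, 0 <= F z)%E ->
  (\int[nu]_z (F z * (expR (c * Y (e n) z.2))%:E) =
   \int[gamma]_x \int[m' (coord_shift n c x)]_t F (x, t))%E.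
Proof.
move=> mF F0.
have mexpY : measurable_fun setT (fun z : Rinf R * T => (expR (c * Y (e n) z.2))%:E).
  apply/measurable_EFinP; apply: measurableT_comp => //; apply: measurable_funM => //.
  exact: (measurableT_comp (m2 n)).
rewrite integral_gmc_law//; last 2 first.
- exact: emeasurable_funM.
- by move=> z; rewrite mule_ge0// lee_fin.
have mI : measurable_fun setT (fun x => \int[m' (coord_shift n c x)]_t F (x, t))%E.
  pose G (z : Rinf R * T) := F (coord_shift n (- c) z.1, z.2).
  rewrite (_ : (fun x => _) = (fun x => \int[m' x]_t G (x, t))%E \o coord_shift n c).
    apply: measurableT_comp => //; apply: (measurable_kernel_integral m'_lty).
      apply: (measurableT_comp mF (g := fun z : Rinf R * T => (coord_shift n (- c) z.1, z.2))).
      by apply: measurable_fun_pair => //; exact: (measurableT_comp (mshift n (- c))).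
    by move=> z; exact: F0.
  apply/funext => x /=; apply: eq_integral => t _; rewrite /G/= coord_shiftD addNr.
  congr (F (_, t)); apply/funext => i.
  by rewrite /coord_shift /add_seq mul0r addr0.
rewrite ge0_integral_coord_law//; last by move=> x; exact: integral_ge0.
apply: ge0_ae_eq_integral => //.
- apply: (measurable_kernel_integral Mfin
    (f := fun z => F (coords e X z.1, z.2) * (expR (c * Y (e n) z.2))%:E)%E).
    apply: emeasurable_funM; first exact: mrandom.
    apply/measurable_EFinP; apply: measurableT_comp => //; apply: measurable_funM => //.
    exact: (measurableT_comp (m2 n)).
  by move=> z; rewrite mule_ge0// lee_fin.
- exact: (measurableT_comp mI mcX).
- by move=> w _; apply: integral_ge0 => t _; rewrite mule_ge0// lee_fin.
- by move=> w _; exact: integral_ge0.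
have [N [mN N0 HN]] := gfZ hY c (e n).
have hN : {ae P, forall w, M w N = 0%E}.
  by apply: ae_measure_eq0 => //; rewrite -[LHS]/(mean_measure P M N) Mmean.
have h1 := m_shift (c *: e n); have h2 := ae_good_shift n c.
near=> w => _.
have g2 : (m (coord_shift n c (coords e X w)) setT < +oo)%E by near: w.
have g1 : forall A, measurable A ->
  m (coord_shift n c (coords e X w)) A = (\int[M w]_(t in A) (expR (Y (c *: e n) t))%:E)%E.
  by rewrite coord_shift_dot; near: w.
have gN : M w N = 0%E by near: w.
rewrite /m' /= finite_partE//.
have mY : measurable_fun setT (fun t => expR (Y (c *: e n) t)).
  by apply: measurableT_comp => //; exact: measurable_gf.
transitivity (\int[M w]_t
    (F (coords e X w, t) * (expR (Y (c *: e n) t))%:E))%E; last first.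
  exact/esym/(ge0_integral_density mY (fun=> expR_ge0 _) g1 (mpair _ mF) (fun=> F0 _)).
apply: ge0_ae_eq_integral => //.
- apply: emeasurable_funM; first exact: mpair.
  by apply/measurable_EFinP; apply: measurableT_comp => //; exact: measurable_funM.
- apply: emeasurable_funM; first exact: mpair.
  by apply/measurable_EFinP; apply: measurableT_comp => //; exact: measurable_gf.
- by move=> t _; rewrite mule_ge0// lee_fin.
- by move=> t _; rewrite mule_ge0// lee_fin.
- exists N; split => // t /= ht; apply: HN => /= E; apply: ht => _.
  by rewrite E.
Unshelve. all: by end_near. Qed.

(* The previous identity after a shift of x_n in its right-hand side. *)
Let gmc_law_shift n c (F : Rinf R * T -> \bar R) : measurable_fun setT F ->
  (forall z, 0 <= F z)%E ->
  (\int[nu]_z (F z * (expR (c * Y (e n) z.2))%:E) =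
   \int[nu]_z (F (fiber_shift n (- c) z) * (expR (c * z.1 n - c ^+ 2 / 2))%:E))%E.
Proof.
move=> mF F0; rewrite gmc_law_tilt//.
have mG : measurable_fun setT (fun z => F (fiber_shift n (- c) z)).
  apply: (measurableT_comp mF).
  exact: (measurableT_comp (@measurable_fiber_shift R _ T n) (pair1_measurable (- c))).
have mGI := measurable_kernel_integral m'_lty mG (fun z => F0 _).
transitivity (\int[gamma]_x (fun y => \int[m' y]_t F (fiber_shift n (- c) (y, t)))%E
    (coord_shift n c x))%E.
  apply: eq_integral => x _; apply: eq_integral => t _.
  rewrite /fiber_shift /= coord_shiftD addNr; congr (F (_, t)); apply/funext => i.
  by rewrite /coord_shift /add_seq mul0r addr0.
rewrite (coord_law_quasi_invariant hdot he hX n c mGI); last first.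
  by move=> x; exact: integral_ge0.
rewrite ge0_integral_semidirect//; last 2 first.
- by apply: emeasurable_funM => //; exact: (measurableT_comp (mexp n c)).
- by move=> z; rewrite mule_ge0// lee_fin.
apply: eq_integral => x _; apply/esym.
apply: (@ge0_integralZr _ _ _ (m' x) _ measurableT
  (fun t => F (fiber_shift n (- c) (x, t))) (mpair x mG)
  (expR (c * x n - c ^+ 2 / 2))%:E (fun t _ => F0 _)).
by rewrite lee_fin.
Qed.

Let unshift (z : Rinf R * T) : Rinf R * T :=
  (add_seq z.1 (fun i => - Y (e i) z.2), z.2).

Let munshift : measurable_fun setT unshift.
Proof.
apply: measurable_fun_pair => //; apply: measurable_add_seq => //.
apply: measurable_to_Rinf => i; apply: measurableT_comp => //.
exact: (measurableT_comp (m2 i)).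
Qed.

Let nu' : {measure set (Rinf R * T)%type -> \bar R} := image_measure munshift nu.

Let mfib n c : measurable_fun setT (@fiber_shift R _ T n c) :=
  measurableT_comp (@measurable_fiber_shift R _ T n) (pair1_measurable c).

Let nu'_quasi_invariant n :
  quasi_invariant (@fiber_coord R _ T n) (fiber_shift n) nu'.
Proof.
move=> c G mG G0.
have mGs := measurableT_comp mG (mfib n c).
have meY a : measurable_fun setT (fun z : Rinf R * T => (expR (a * Y (e n) z.2))%:E).
  apply/measurable_EFinP; apply: measurableT_comp => //; apply: measurable_funM => //.
  exact: (measurableT_comp (m2 n)).
transitivity (\int[nu]_z G (fiber_shift n c (unshift z)))%E.
  exact: (ge0_integral_image munshift nu mGs (fun=> G0 _)).
pose F (z : Rinf R * T) :=
  (G (fiber_shift n c (unshift z)) * (expR ((- c) * Y (e n) z.2))%:E)%E.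
have mF : measurable_fun setT F.
  by apply: emeasurable_funM => //; exact: (measurableT_comp mGs munshift).
have F0 z : (0 <= F z)%E by rewrite mule_ge0// lee_fin.
transitivity (\int[nu]_z (F z * (expR (c * Y (e n) z.2))%:E))%E.
  apply: eq_integral => z _; rewrite /F -muleA -EFinM -expRD.
  by rewrite mulNr addNr expR0 mule1.
rewrite (gmc_law_shift n c mF F0).
have mGe : measurable_fun setT
    (fun z => G z * (expR (c * fiber_coord n z - c ^+ 2 / 2))%:E)%E.
  apply: emeasurable_funM => //; apply/measurable_EFinP; apply: measurableT_comp => //.
  by apply: measurable_funB => //; apply: measurable_funM => //; exact: measurable_fiber_coord.
have Ge0 z : (0 <= G z * (expR (c * fiber_coord n z - c ^+ 2 / 2))%:E)%E.
  by rewrite mule_ge0// lee_fin.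
apply/esym; etransitivity; first exact: (ge0_integral_image munshift nu mGe Ge0).
apply/esym.
apply: eq_integral => -[x t] _; rewrite /F -muleA -EFinM -expRD.
congr (G _ * (expR _)%:E)%E.
  rewrite /fiber_shift /unshift /=; congr (_, _); apply/funext => i.
  by rewrite /coord_shift /add_seq; ring.
by rewrite /fiber_coord /unshift /add_seq /=; ring.
Qed.

Let prod_quasi_invariant n :
  quasi_invariant (@fiber_coord R _ T n) (fiber_shift n) (gamma \x mu)%E.
Proof.
move=> c G mG G0.
have mGs := measurableT_comp mG (mfib n c).
have mGe : measurable_fun setT
    (fun z => G z * (expR (c * fiber_coord n z - c ^+ 2 / 2))%:E)%E.
  apply: emeasurable_funM => //; apply/measurable_EFinP; apply: measurableT_comp => //.
  by apply: measurable_funB => //; apply: measurable_funM => //; exact: measurable_fiber_coord.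
have Ge0 z : (0 <= G z * (expR (c * fiber_coord n z - c ^+ 2 / 2))%:E)%E.
  by rewrite mule_ge0// lee_fin.
rewrite (fubini_tonelli2 _ mGs (fun=> G0 _)) (fubini_tonelli2 _ mGe Ge0).
apply: eq_integral => t _.
exact: (coord_law_quasi_invariant hdot he hX n c
  (measurableT_comp mG (pair2_measurable t)) (fun x => G0 (x, t))).
Qed.

Let nu_snd A : measurable A -> nu' (snd @^-1` A) = mu A.
Proof.
move=> mA.
have mA' : measurable (snd @^-1` A : set (Rinf R * T)).
  by rewrite -[X in measurable X]setTI; exact: measurable_snd.
transitivity (\int[nu]_z (\1_(snd @^-1` A) z)%:E)%E.
  by rewrite integral_indic// setIT.
rewrite integral_gmc_law//; last exact/measurable_EFinP/measurable_indic.
rewrite -Mmean//; apply: eq_integral => w _.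
transitivity (\int[M w]_t (\1_A t)%:E)%E; last by rewrite integral_indic// setIT.
by apply: eq_integral => t _; rewrite !indicE.
Qed.

Let nu'_lty : (nu' setT < +oo)%E.
Proof.
by rewrite -(preimage_setT snd) nu_snd// ltey_eq fin_num_measure.
Qed.

Let prod_lty : ((gamma \x mu)%E setT < +oo)%E.
Proof.
rewrite -setXTT product_measure1E// [X in (X * _)%E]probability_setT mul1e.
by rewrite ltey_eq fin_num_measure.
Qed.

(** Both measures are quasi-invariant under each coordinate shift, and have marginal
[mu] on [T]. *)
Lemma gmc_law_unshift (C : set (Rinf R * T)) : measurable C ->
  nu' C = (gamma \x mu)%E C.
Proof.
apply: (@quasi_invariant_unique _ _ _ (as_finite nu'_lty) (as_finite prod_lty)).
- exact: nu'_quasi_invariant.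
- exact: prod_quasi_invariant.
- move=> A mA; rewrite [LHS]nu_snd//.
  transitivity ((gamma \x mu)%E (setT `*` A)).
    by rewrite product_measure1E// [X in (X * _)%E]probability_setT mul1e.
  by rewrite (_ : snd @^-1` A = setT `*` A)//; apply/seteqP; split => z //= [].
Qed.

Theorem gmc_formula (f : Rinf R * T -> \bar R) :
  measurable_fun setT f -> (forall z, 0 <= f z)%E ->
  (\int[P]_w \int[M w]_t f (coords e X w, t) =
   \int[P]_w \int[mu]_t f (add_seq (coords e X w) (coords e Y t), t))%E.
Proof.
move=> mf f0; rewrite -integral_gmc_law//.
pose shift (z : Rinf R * T) : Rinf R * T := (add_seq z.1 (coords e Y z.2), z.2).
have mshift' : measurable_fun setT shift.
  apply: measurable_fun_pair => //; apply: measurable_add_seq => //.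
  exact: (measurableT_comp (measurable_coords Y e)).
have mfs := measurableT_comp mf mshift'.
transitivity (\int[nu']_z f (shift z))%E.
  rewrite ge0_integral_image//.
  apply: eq_integral => -[x t] _; congr (f (_, t)); apply/funext => i.
  by rewrite /shift /unshift /add_seq /coords /= subrK.
rewrite (@eq_measure_integral _ _ _ _ (gamma \x mu)%E); last first.
  by move=> C mC _; exact: gmc_law_unshift.
rewrite fubini_tonelli1//.
rewrite ge0_integral_coord_law//.
  exact: (@measurable_fun_fubini_tonelli_F _ _ _ _ _ mu _ mfs (fun z => f0 _)).
by move=> x; exact: integral_ge0.
Qed.

End gmc_law.

Section randomized_shift_of_gmc.
Context (R : realType) (H : completeNormedModType R)
    (e : nat -> H)
    (d d' : measure_display) (Omega : measurableType d) (T : measurableType d')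
    (P : probability Omega R) (mu : {finite_measure set T -> \bar R})
    (X : H -> {mfun_ P, Omega >-> R}) (Y : H -> {mfun_ mu, T >-> R}).

Lemma measurable_shifted_coords : measurable_fun setT
  (fun z : Omega * T => add_seq (coords e X z.1) (coords e Y z.2)).
Proof.
apply: measurable_add_seq.
- exact: (measurableT_comp (measurable_coords X e)).
- exact: (measurableT_comp (measurable_coords Y e)).
Qed.

Lemma randomized_shiftP : randomized_shift e X Y <->
  forall A, measurable A -> coord_law e X A = 0%E ->
    image_measure measurable_shifted_coords (P \x mu)%E A = 0%E.
Proof. exact: (@null_content_dominatesP _ _ _ _ (coord_law e X)). Qed.

(** Applied to f(x, t) = 1_A(x) for a null set A of the law of X, the formula equates
the measure of the event that X + Y(t) is in A with the integral of the mass of M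
over the null event that X is in A. *)
Lemma randomized_shift_of_formula (M : R.-ker Omega ~> T) :
  (forall w, M w setT < +oo)%E ->
  (forall f : Rinf R * T -> \bar R, measurable_fun setT f -> (forall z, 0 <= f z)%E ->
    (\int[P]_w \int[M w]_t f (coords e X w, t) =
     \int[P]_w \int[mu]_t f (add_seq (coords e X w) (coords e Y t), t))%E) ->
  randomized_shift e X Y.
Proof.
move=> Mfin HM; apply/randomized_shiftP => A mA A0.
have mS := measurable_shifted_coords.
have mi : measurable_fun setT (fun x : Rinf R => (\1_A x)%:E : \bar R).
  exact/measurable_EFinP/measurable_indic.
have mA' : measurable (coords e X @^-1` A).
  by rewrite -[X in measurable X]setTI; exact: measurable_coords.
transitivity (\int[(P \x mu)%E]_z (\1_A (add_seq (coords e X z.1) (coords e Y z.2)))%:E)%E.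
  transitivity (\int[image_measure mS (P \x mu)%E]_x (\1_A x)%:E)%E.
    by rewrite integral_indic// setIT.
  by rewrite ge0_integral_image.
have mf := measurableT_comp mi mS.
rewrite fubini_tonelli1//.
have mif : measurable_fun setT (fun z : Rinf R * T => (\1_A z.1)%:E : \bar R).
  exact: (measurableT_comp mi measurable_fst).
transitivity (\int[P]_w \int[M w]_t (\1_A (coords e X w))%:E)%E.
  by rewrite (HM _ mif).
rewrite (ge0_negligible_integral (N := coords e X @^-1` A))//.
- by apply: integral0_eq => w [_ Aw]; apply: integral0_eq => t _; rewrite indicE memNset.
- apply: (@measurable_kernel_integral _ _ _ _ _ M Mfin (fun z => (\1_A (coords e X z.1))%:E)) => //.
  exact: (measurableT_comp mi (measurableT_comp (measurable_coords X e) measurable_fst)).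
- by move=> w _; apply: integral_ge0.
Qed.

End randomized_shift_of_gmc.

Lemma finite_measure_rays (R : realType) (m1 m2 : {measure set R -> \bar R}) :
  (m1 setT < +oo)%E ->
  (forall r : rat, m1 [set y | y < ratr r] = m2 [set y | y < ratr r]) ->
  forall D, measurable D -> m1 D = m2 D.
Proof.
move=> m1T H D mD.
have mray (c : R) : measurable [set y : R | y < c].
  by rewrite (_ : mkset _ = `]-oo, c[%classic).
pose G := [set C : set R | exists r : rat, C = [set y | y < ratr r]].
apply: (g_sigma_algebra_measure_unique G _ (fun n => [set y | y < ratr n%:R])).
- by move=> _ [r ->].
- by move=> n; exists n%:R.
- apply/seteqP; split => // y _; exists (Num.truncn y).+1 => //=.
  by rewrite ratr_nat truncnS_gt.
- move=> _ _ [r ->] [r' ->]; exists (Num.min r r').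
  apply/seteqP; split => y /=; first by move=> [h h']; case: (leP r r').
  by case: (leP r r') => rr h; split => //; apply: (lt_le_trans h); rewrite ler_rat// ltW.
- by move=> _ [r ->].
- by move=> n; apply: le_lt_trans m1T; apply: le_measure; rewrite ?inE.
suff : measurable_fun setT (id : g_sigma_algebraType G -> measurableTypeR R).
  by move=> /(_ measurableT D mD); rewrite setTI.
apply: (measurability _ (RGenInftyO.measurableE R)) => //.
move=> _ [_ [c ->] <-]; rewrite setTI.
have -> : id @^-1` [set` `]-oo, c[] = \bigcup_(r : rat)
    (if ratr r < c then [set y : R | y < ratr r] else set0).
  apply/seteqP; split => [y|y [r _]] /=; rewrite in_itv/=.
    move=> yc; have [r] := rat_in_itvoo yc; rewrite in_itv/= => /andP[yr rc].
    by exists r => //; rewrite rc.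
  by case: ifPn => // rc yr; exact: lt_trans rc.
apply: (@bigcupT_measurable_rat _ (g_sigma_algebraType G)) => r.
case: ifP => _; last exact: (@measurable0 _ (g_sigma_algebraType G)).
by apply: sub_sigma_algebra; exists r.
Qed.

(** * Existence of the GMC *)

Section gmc_of_randomized_shift.
Context (R : realType) (H : completeNormedModType R)
    (dot : {dot H for (idfun : R -> R)}) (e : nat -> H)
    (d d' : measure_display) (Omega : measurableType d) (T : measurableType d')
    (P : probability Omega R) (mu : {finite_measure set T -> \bar R})
    (X : H -> {mfun_ P, Omega >-> R}) (Y : H -> {mfun_ mu, T >-> R}).
Hypothesis hdot : hilbert_dot dot.
Hypothesis he : orthonormal_basis dot e.
Hypothesis hT : standard_measurable R T.
Hypothesis hX : standard_gaussian X.
Hypothesis hY : generalized_function Y.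
Hypothesis hshift : randomized_shift e X Y.

Let gamma : probability (Rinf R) R := coord_law e X.

Let mcX : measurable_fun setT (coords e X) := measurable_coords X e.
Let mcY : measurable_fun setT (coords e Y) := measurable_coords Y e.

Let mpsi : measurable_fun setT
  (fun z : Omega * T => (add_seq (coords e X z.1) (coords e Y z.2), z.2)).
Proof. by apply: measurable_fun_pair => //; exact: measurable_shifted_coords. Qed.

(* The law of (X + Y(t), t). *)
Let Q : {measure set (Rinf R * T)%type -> \bar R} := image_measure mpsi (P \x mu)%E.

Let Q_snd A : measurable A -> Q (snd @^-1` A) = mu A.
Proof.
move=> mA; transitivity ((P \x mu)%E (setT `*` A)).
  by rewrite (_ : setT `*` A = snd @^-1` A)//; apply/seteqP; split => z //= [].
by rewrite product_measure1E// [X in (X * _)%E]probability_setT mul1e.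
Qed.

Let Q_lty : (Q setT < +oo)%E.
Proof. by rewrite -(preimage_setT snd) Q_snd// ltey_eq fin_num_measure. Qed.

Let disint : exists m : R.-ker (Rinf R) ~> T, (forall x, m x setT < +oo)%E /\
    forall C, measurable C -> Q C = (\int[gamma]_x m x (xsection C x))%E.
Proof.
apply: (@disintegration _ _ _ _ _ gamma (as_finite Q_lty) hT) => A mA A0.
by have /randomized_shiftP := hshift; exact.
Qed.

Let m : R.-ker (Rinf R) ~> T := sval (cid disint).
Let mfin x : (m x setT < +oo)%E.
Proof. by have [+ _] := svalP (cid disint); exact. Qed.
Let QE C : measurable C -> Q C = semidirect gamma mfin C.
Proof. by have [_ +] := svalP (cid disint); exact. Qed.

Let integral_disint (f : Rinf R * T -> \bar R) : measurable_fun setT f ->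
  (forall z, 0 <= f z)%E ->
  (\int[gamma]_x \int[m x]_t f (x, t) =
   \int[mu]_t \int[gamma]_x f (add_seq x (coords e Y t), t))%E.
Proof.
move=> mf f0; rewrite -(ge0_integral_semidirect gamma mfin)//.
have mfs := measurableT_comp mf mpsi.
transitivity (\int[Q]_z f z)%E.
  by apply: eq_measure_integral => C mC _; rewrite QE.
rewrite ge0_integral_image// fubini_tonelli2//.
apply: eq_integral => t _; rewrite ge0_integral_coord_law//.
apply: (measurableT_comp mf (g := fun x => (add_seq x (coords e Y t), t))).
by apply: measurable_fun_pair => //; exact: measurable_add_seq.
Qed.

Section shift.
Variable xi : H.
Let b : Rinf R := fun n => dot xi (e n).
Let bN : Rinf R := fun n => - b n.
Notation W := (cm_density he hX hY xi).

Let mW : measurable_fun setT (fun x => (W x)%:E).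
Proof. by apply/measurable_EFinP; exact: (measurable_cm_density he hX hY xi). Qed.

Let mYxi : measurable_fun setT (fun t => (expR (Y xi t))%:E).
Proof. by apply/measurable_EFinP; apply: measurableT_comp => //; exact: measurable_gf. Qed.

Let madd (c : Rinf R) : measurable_fun setT (fun x : Rinf R => add_seq x c).
Proof. exact: measurable_add_seq. Qed.

Let mtrans (c : Rinf R) (F : Rinf R * T -> \bar R) : measurable_fun setT F ->
  measurable_fun setT (fun z => F (add_seq z.1 c, z.2)).
Proof.
move=> mF; apply: (measurableT_comp mF (g := fun z => (add_seq z.1 c, z.2))).
by apply: measurable_fun_pair => //; exact: (measurableT_comp (madd c)).
Qed.

Let mpair1 t (F : Rinf R * T -> \bar R) : measurable_fun setT F ->
  measurable_fun setT (fun x => F (x, t)).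
Proof. by move=> mF; exact: (measurableT_comp mF (pair2_measurable t)). Qed.

Let mpair2 x (F : Rinf R * T -> \bar R) : measurable_fun setT F ->
  measurable_fun setT (fun t => F (x, t)).
Proof. by move=> mF; exact: (measurableT_comp mF (pair1_measurable x)). Qed.

Let add_bNK x : add_seq (add_seq x b) bN = x.
Proof. by apply/funext => i; rewrite /add_seq /bN addrK. Qed.

Let mavg (K : Rinf R * T -> \bar R) : measurable_fun setT K -> (forall z, 0 <= K z)%E ->
  measurable_fun setT (fun t => \int[gamma]_x K (add_seq x (coords e Y t), t))%E.
Proof.
move=> mK K0.
have ms : measurable_fun setT
    (fun z : Rinf R * T => (add_seq z.1 (coords e Y z.2), z.2)).
  apply: measurable_fun_pair => //; apply: measurable_add_seq => //.
  exact: (measurableT_comp mcY).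
exact: (@measurable_fun_fubini_tonelli_G _ _ _ _ _ gamma _
  (measurableT_comp mK ms) (fun z => K0 _)).
Qed.

(** With G(x, t) = F(x - b, t), the left-hand side is the integral of G at x + b, hence
of G W against gamma(dx) m(x, dt), hence of G W at (X + Y(t), t).  There W splits into
W(X) exp(<Y(t), xi>), and the factor W(X) shifts X by b, which cancels the shift in
G; the disintegration turns the result into the right-hand side. *)
Lemma shift_kernel_identity (F : Rinf R * T -> \bar R) : measurable_fun setT F ->
  (forall z, 0 <= F z)%E ->
  (\int[gamma]_x \int[m (add_seq x b)]_t F (x, t) =
   \int[gamma]_x \int[m x]_t (F (x, t) * (expR (Y xi t))%:E))%E.
Proof.
move=> mF F0.
have mG := mtrans bN mF.
have mGI := measurable_kernel_integral mfin mG (fun z => F0 _).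
transitivity (\int[gamma]_x (fun y => \int[m y]_t F (add_seq y bN, t))%E (add_seq x b))%E.
  by apply: eq_integral => x _; apply: eq_integral => t _; rewrite add_bNK.
rewrite (cameron_martin hdot he hX hY xi mGI); last first.
  by move=> x; exact: integral_ge0.
transitivity (\int[gamma]_x \int[m x]_t
    (F (add_seq x bN, t) * (W x)%:E))%E.
  apply: eq_integral => x _; apply/esym.
  apply: (@ge0_integralZr _ _ _ (m x) _ measurableT
    (fun t => F (add_seq x bN, t)) (mpair2 x mG) (W x)%:E (fun t _ => F0 _)).
  by rewrite lee_fin; exact: cm_density_ge0.
have mGW : measurable_fun setT (fun z : Rinf R * T => F (add_seq z.1 bN, z.2) * (W z.1)%:E)%E.
  by apply: emeasurable_funM => //; exact: (measurableT_comp mW measurable_fst).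
have W0 x : (0 <= (W x)%:E)%E by rewrite lee_fin; exact: cm_density_ge0.
have GW0 (z : Rinf R * T) : (0 <= F (add_seq z.1 bN, z.2) * (W z.1)%:E)%E.
  by rewrite mule_ge0.
rewrite (integral_disint mGW GW0) /=.
have mFY : measurable_fun setT (fun z : Rinf R * T => F z * (expR (Y xi z.2))%:E)%E.
  by apply: emeasurable_funM => //; exact: (measurableT_comp mYxi measurable_snd).
have FY0 (z : Rinf R * T) : (0 <= F z * (expR (Y xi z.2))%:E)%E.
  by rewrite mule_ge0// lee_fin.
rewrite (integral_disint mFY FY0) /=.
apply: ge0_ae_eq_integral => //; first 4 last.
- move: (cm_density_shift hdot he hX hY xi); apply: filterS => t ht _.
  have mFt : measurable_fun setT (fun x => F (add_seq (add_seq x (coords e Y t)) bN, t)).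
    exact: (measurableT_comp (mpair1 t mG) (madd (coords e Y t))).
  have mFYt : measurable_fun setT (fun x => F (add_seq x (coords e Y t), t)).
    exact: (measurableT_comp (mpair1 t mF) (madd (coords e Y t))).
  transitivity (\int[gamma]_x (F (add_seq (add_seq x (coords e Y t)) bN, t) *
      (W x * expR (Y xi t))%:E))%E.
    rewrite !ge0_integral_coord_law//; last 4 first.
    + apply: emeasurable_funM => //; apply/measurable_EFinP; apply: measurable_funM => //.
      exact: measurable_cm_density.
    + by move=> x; rewrite mule_ge0// EFinM mule_ge0// lee_fin.
    + exact: (emeasurable_funM mFt (measurableT_comp mW (madd (coords e Y t)))).
    + by move=> x; rewrite mule_ge0.
    apply: ge0_ae_eq_integral => //.
    + apply: emeasurable_funM; first exact: (measurableT_comp mFt mcX).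
      exact: (measurableT_comp mW (measurableT_comp (madd (coords e Y t)) mcX)).
    + apply: emeasurable_funM; first exact: (measurableT_comp mFt mcX).
      apply/measurable_EFinP; apply: measurable_funM => //.
      exact: (measurableT_comp (measurable_cm_density he hX hY xi) mcX).
    + by move=> w _; rewrite mule_ge0.
    + by move=> w _; rewrite mule_ge0// EFinM mule_ge0// lee_fin.
    + by move: ht; apply: filterS => w hw _; rewrite hw.
  transitivity ((\int[gamma]_x (F (add_seq (add_seq x (coords e Y t)) bN, t) *
      (W x)%:E)) * (expR (Y xi t))%:E)%E.
    rewrite -ge0_integralZr//.
    + by apply: eq_integral => x _; rewrite EFinM muleA.
    + exact: emeasurable_funM.
    + by move=> x _; rewrite mule_ge0.
  rewrite -(cameron_martin hdot he hX hY xi mFt)//.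
  rewrite ge0_integralZr//; congr (_ * _)%E; apply: eq_integral => x _.
  congr (F (_, t)); apply/funext => i; rewrite /add_seq /bN /b; ring.
- exact: (mavg mGW GW0).
- exact: (mavg mFY FY0).
- by move=> t _; apply: integral_ge0 => x _; exact: (GW0 (_, t)).
- by move=> t _; apply: integral_ge0 => x _; exact: (FY0 (_, t)).
Qed.

Let mindicE d1 (U : measurableType d1) (A : set U) : measurable A ->
  measurable_fun setT (fun t : U => (\1_A t)%:E : \bar R).
Proof. by move=> mA; exact/measurable_EFinP/measurable_indic. Qed.

Let mYc A : measurable A -> measurable_fun setT
  (fun z : Rinf R * T => (\1_A z.2)%:E * (expR (Y xi z.2))%:E)%E.
Proof.
move=> mA; apply: emeasurable_funM; last exact: (measurableT_comp mYxi measurable_snd).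
exact: (measurableT_comp (mindicE mA) measurable_snd).
Qed.

Lemma shift_kernel_set A : measurable A -> {ae gamma, forall x,
  m (add_seq x b) A = (\int[m x]_(t in A) (expR (Y xi t))%:E)%E}.
Proof.
move=> mA.
pose u x := m (add_seq x b) A.
pose v x := (\int[m x]_t ((\1_A t)%:E * (expR (Y xi t))%:E))%E.
have mu' : measurable_fun setT u by exact: (measurableT_comp (measurable_kernel m _ mA) (madd b)).
have mv : measurable_fun setT v.
  apply: (measurable_kernel_integral mfin (mYc mA)) => z.
  by rewrite mule_ge0// lee_fin.
have v0 x : (0 <= v x)%E by apply: integral_ge0 => t _; rewrite mule_ge0// lee_fin.
(* On each set where the left-hand side is bounded, hence integrable, the identities
   in mean over its subsets give an almost sure equality. *)
pose E k := [set x | (u x <= k%:R%:E)%E].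
have mE k : measurable (E k).
  by have := emeasurable_fun_infty_c measurableT mu' k%:R%:E; rewrite setTI.
have uvE k : ae_eq gamma (E k) u v.
  apply: integral_ae_eq => //.
  - apply/integrableP; split; first exact: measurable_funTS.
    apply: (@le_lt_trans _ _ (\int[gamma]_(x in E k) (cst k%:R%:E x))%E).
      apply: ge0_le_integral => //.
      + by apply: measurable_funTS; exact: measurableT_comp.
      + by move=> x Ex; rewrite gee0_abs// /u.
    rewrite integral_cst//; apply: (@le_lt_trans _ _ (k%:R%:E * 1)%E).
      by rewrite lee_wpmul2l// ?lee_fin// probability_le1.
    by rewrite mule1 ltry.
  - exact: measurable_funTS.
  move=> D DE mD.
  pose F (z : Rinf R * T) : \bar R := ((\1_D z.1)%:E * (\1_A z.2)%:E)%E.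
  have mF : measurable_fun setT F.
    apply: emeasurable_funM.
    + exact: (measurableT_comp (mindicE mD) measurable_fst).
    + exact: (measurableT_comp (mindicE mA) measurable_snd).
  have F0 z : (0 <= F z)%E by rewrite mule_ge0// lee_fin.
  have mAE := mindicE mA.
  transitivity (\int[gamma]_x \int[m (add_seq x b)]_t F (x, t))%E.
    rewrite integral_mkcond; apply: eq_integral => x _.
    rewrite patchE /F /= ge0_integralZl//.
    rewrite integral_indic// setIT indicE.
    by case: (x \in D); rewrite ?mul1e ?mul0e.
  rewrite (shift_kernel_identity mF F0) integral_mkcond; apply: eq_integral => x _.
  rewrite patchE (eq_integral (fun t => (\1_D x)%:E * ((\1_A t)%:E * (expR (Y xi t))%:E))%E);
    last by move=> t _; rewrite /F muleA.
  have mAY := emeasurable_funM mAE mYxi.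
  rewrite ge0_integralZl//.
  by rewrite indicE; case: (x \in D); rewrite ?mul1e ?mul0e.
have := ae_foralln uvE; apply: filterS => x h.
have ufin : u x \is a fin_num.
  rewrite ge0_fin_numE// /u; apply: le_lt_trans (mfin (add_seq x b)).
  by apply: le_measure; rewrite ?inE.
have -> : m (add_seq x b) A = v x.
  apply: (h (Num.truncn (fine (u x))).+1); rewrite /E/= -[leLHS]fineK// lee_fin.
  by rewrite ltW// truncnS_gt.
rewrite [RHS]integral_mkcond; apply: eq_integral => t _.
by rewrite patchE indicE; case: (t \in A); rewrite ?mul1e ?mul0e.
Qed.

Let mexp : measurable_fun setT (fun t => expR (Y xi t)).
Proof. by apply: measurableT_comp => //; exact: measurable_gf. Qed.

Let exp0 t : 0 <= expR (Y xi t). Proof. exact: expR_ge0. Qed.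

(** The sets where psi is less than a rational number are countably many and determine
a finite measure on [T]. *)
Lemma shift_kernel : {ae gamma, forall x, forall A, measurable A ->
  m (add_seq x b) A = (\int[m x]_(t in A) (expR (Y xi t))%:E)%E}.
Proof.
have [psi [mpsi' [_ [psi_gen _]]]] := standard_coding hT.
pose A (k : nat) := psi @^-1` [set y | y < ratr (odflt 0 (unpickle k) : rat)].
have mA k : measurable (A k).
  rewrite /A -[X in measurable X]setTI; apply: mpsi' => //.
  by rewrite (_ : mkset _ = `]-oo, ratr (odflt 0 (unpickle k))[%classic).
have := ae_foralln (fun k => shift_kernel_set (mA k)); apply: filterS => x h B mB.
have [D mD ->] := psi_gen B mB.
rewrite -[LHS]/(image_measure mpsi' (m (add_seq x b)) D).
rewrite -[RHS]/(image_measure mpsi' (density_measure (m x) mexp exp0) D).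
apply: finite_measure_rays => //; first exact: mfin.
move=> r; have := h (pickle r); rewrite /A pickleK; exact.
Qed.

End shift.

Theorem gmc_of_randomized_shift : exists M : R.-ker Omega ~> T,
  subcritical_gmc dot e X Y M /\
  (forall A, measurable A -> mean_measure P M A = mu A).
Proof.
have mM U : measurable U -> measurable_fun setT (fun w => m (coords e X w) U).
  by move=> mU; exact: (measurableT_comp (measurable_kernel m _ mU) mcX).
exists (kernel_of mM).
have mean A : measurable A -> mean_measure P (kernel_of mM) A = mu A.
  move=> mA; rewrite -Q_snd// QE; last first.
    by rewrite -[X in measurable X]setTI; exact: measurable_snd.
  rewrite /semidirect ge0_integral_coord_law//; last first.
    apply: (measurable_kernel_xsection mfin).
    by rewrite -[X in measurable X]setTI; exact: measurable_snd.
  apply: eq_integral => w _; congr (m _ _).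
  by apply/seteqP; split => t; rewrite /xsection/= ?inE.
split => //; split; last first.
  exists (fun=> setT); first by rewrite bigcup_const.
  by move=> _; split => //; rewrite mean// ltey_eq fin_num_measure.
split.
  split; first by move=> w; exact: mfin.
  by apply/null_content_dominatesP => A mA; rewrite mean.
exists m; split; first exact: aeW.
move=> xi; have [N [mN N0 HN]] := shift_kernel xi.
exists (coords e X @^-1` N); split => //.
  by rewrite -[X in measurable X]setTI; exact: mcX.
by move=> w; exact: HN.
Qed.

End gmc_of_randomized_shift.

Theorem theorem6 (R : realType) (H : completeNormedModType R)
    (dot : {dot H for (idfun : R -> R)}) (e : nat -> H)
    (d d' : measure_display) (Omega : measurableType d) (T : measurableType d')
    (P : probability Omega R) (mu : {finite_measure set T -> \bar R})
    (X : H -> {mfun_ P, Omega >-> R}) (Y : H -> {mfun_ mu, T >-> R})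
    (hdot : hilbert_dot dot) (he : orthonormal_basis dot e)
    (hOmega : standard_probability P) (hT : standard_measurable R T)
    (hX : standard_gaussian X) (hY : generalized_function Y) :
  ((exists M : R.-ker Omega ~> T,
      subcritical_gmc dot e X Y M /\
      (forall A : set T, measurable A -> mean_measure P M A = mu A))
   <-> randomized_shift e X Y) /\
  (forall M : R.-ker Omega ~> T,
     subcritical_gmc dot e X Y M ->
     (forall A : set T, measurable A -> mean_measure P M A = mu A) ->
     forall f : Rinf R * T -> \bar R,
       measurable_fun setT f -> (forall z, (0 <= f z)%E) ->
       (\int[P]_w \int[M w]_t f (coords e X w, t) =
        \int[P]_w \int[mu]_t f (add_seq (coords e X w) (coords e Y t), t))%E).
Proof.
split; first split.
- move=> [M [[[[Mfin _] [m [Mm m_shift]]] _] Mmean]].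
  apply: (randomized_shift_of_formula Mfin) => f mf f0.
  exact: (gmc_formula hdot he hX hY Mfin Mmean Mm m_shift).
- exact: (gmc_of_randomized_shift hdot he hT hX hY).
- move=> M [[[Mfin _] [m [Mm m_shift]]] _] Mmean f mf f0.
  exact: (gmc_formula hdot he hX hY Mfin Mmean Mm m_shift).
Qed.
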